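(* Let $1\le m\le n$. There exists a $U(n)$-equivariant isometric diffeomorphism $$\Phi:\mathrm{Orb}(i)\longrightarrow T^*_{1,0}\mathrm{Gr}_{\mathbb{C}}$$ with the properties $$\Phi^*\,\mathrm{Re}\,\Omega_{\mathrm{can}}=\mathrm{Im}\,\Omega_{\mathrm{KKS}},\qquad \Phi^*\,\mathrm{Im}\,\Omega_{\mathrm{can}}=\omega_{\mathrm K},\qquad \Phi^*\omega_{\mathrm C}=\mathrm{Re}\,\Omega_{\mathrm{KKS}}.$$ Writing $\Phi(\xi)=(\Pi,\eta)$, where $\Pi\in\mathrm{Gr}_{\mathbb{C}}$ and $\eta:\mathbb{C}^n/\Pi\to\Pi$ is a covector to $\Pi$, the map $\Phi$ is given explicitly by $$\Pi=\{x+\sqrt{\xi^\dagger\xi}\,(x)\mid x\in\mathrm{Im}\,\xi\},\qquad \eta=\tfrac12\big(\sqrt{\xi^\dagger\xi}-\sqrt{\xi\xi^\dagger}-i\xi-i\xi^\dagger\big).$$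
   Context: $\dagger$ is conjugate transpose; square roots are positive-semidefinite Hermitian roots. $\mathrm{Gr}_{\mathbb{C}}$: Grassmannian of complex $m$-dimensional subspaces of $\mathbb{C}^n$. Covectors to $\Pi$ are linear maps $\eta:\mathbb{C}^n/\Pi\to\Pi$ (equivalently $n\times n$ matrices with $\eta(\Pi)=0$, $\mathrm{Im}\,\eta\subset\Pi$), paired by trace with $T_\Pi\mathrm{Gr}_{\mathbb{C}}=\mathrm{Hom}(\Pi,\mathbb{C}^n/\Pi)$. $\Omega_{\mathrm{can}}=-d\lambda$ is the holomorphic canonical symplectic form on $T^*_{1,0}\mathrm{Gr}_{\mathbb{C}}$, $\lambda$ the canonical one-form. $\mathrm{Orb}(\zeta)=\{\xi=QP\mid Q\in\mathbb{C}^{n\times m},P\in\mathbb{C}^{m\times n},PQ=\zeta\,\mathrm{Id}_m\}\subset\mathfrak{gl}_n\mathbb{C}^*\cong\mathfrak{gl}_n\mathbb{C}$ (trace form), $\zeta\ne0$, with $\Omega_{\mathrm{KKS}}([\xi,X],[\xi,Y])=\mathrm{Tr}(\xi[X,Y])$. $U(n)$ acts on $\mathrm{Orb}(i)$ by conjugation and on $T^*_{1,0}\mathrm{Gr}_{\mathbb{C}}$ by cotangent lift. The metrics and the Kähler forms $\omega_{\mathrm K},\omega_{\mathrm C}$ are defined by hyperkähler reduction as follows. On $\mathrm{Hom}(\mathbb{H}^m,\mathbb{H}^n)$ (quaternionic $n\times m$ matrices) let $I,J,K$ be left multiplication of entries by $i,j,k$ and $g(A,B)=\frac12\mathrm{Tr}(AB^\dagger+BA^\dagger)$,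 with $\omega_1=g(I\cdot,\cdot)$, $\omega_2=g(J\cdot,\cdot)$, $\omega_3=g(K\cdot,\cdot)$ and $\Omega_1=\omega_2+i\omega_3$, $\Omega_2=\omega_3+i\omega_1$, $\Omega_3=\omega_1+i\omega_2$. Write $A=Q+jP^\dagger$ with $Q\in\mathbb{C}^{n\times m}$, $P\in\mathbb{C}^{m\times n}$. $U(m)$ acts by $A\mapsto Ah^{-1}$, i.e. $(Q,P)\mapsto(Qh^{-1},hP)$, with momentum maps (in $\mathfrak u(m)\cong\mathfrak u(m)^*$) $\mu_1=\frac i2(Q^\dagger Q-PP^\dagger)$ and $\mu_2+i\mu_3=PQ$ with $\mu_2,\mu_3\in\mathfrak u(m)$. Let $\tilde M=(\mu_1^{-1}(i\,\mathrm{Id}_m)\cap\mu_2^{-1}(0)\cap\mu_3^{-1}(0))/U(m)$ be the hyperkähler quotient of the open set $\{\mathrm{rank}\,Q=m\}$, with induced structures $(g,I,J,K)$. There are holomorphic symplectomorphisms $(\tilde M,I,\Omega_1)\cong(T^*_{1,0}\mathrm{Gr}_{\mathbb{C}},i,\Omega_{\mathrm{can}})$, $[Q,P]\mapsto(\mathrm{Im}\,Q,QP)$, and $(\tilde M,K,\Omega_3)\cong(\mathrm{Orb}(i),i,\Omega_{\mathrm{KKS}})$, $[Q,P]\mapsto UV$, where $U=\frac{Q-P^\dagger}{\sqrt2}$ and $V=\frac{i(Q^\dagger+P)}{\sqrt2}$. The metrics on $T^*_{1,0}\mathrm{Gr}_{\mathbb{C}}$ and $\mathrm{Orb}(i)$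 are those transported from $\tilde M$ by these identifications, and $\omega_{\mathrm C}$, $\omega_{\mathrm K}$ are the corresponding Kähler forms $g(i\cdot,\cdot)$ for the standard complex structures of $T^*_{1,0}\mathrm{Gr}_{\mathbb{C}}$ and of $\mathrm{Orb}(i)$, respectively. *)

(* Defs.v *)
From HB Require Import structures.
From mathcomp Require Import all_boot all_order all_algebra.
From mathcomp Require Import complex.
From mathcomp Require Import all_classical all_reals all_analysis.

Set Implicit Arguments.
Unset Strict Implicit.
Unset Printing Implicit Defensive.

Import Order.TTheory GRing.Theory Num.Theory.
Import numFieldNormedType.Exports.
Local Open Scope classical_set_scope.
Local Open Scope complex_scope.
Local Open Scope sesquilinear_scope.
Local Open Scope ring_scope.

(* C^k and C^oo maps on an open set. In finite dimension, the only case used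
   below, this iterated condition is the usual one. *)
Section Smooth.
Context {R : realType} {V W : normedModType R}.

Fixpoint Ck (k : nat) (U : set V) (f : V -> W) : Prop :=
  if k is k'.+1 then
    (forall x, U x -> differentiable f x) /\ (forall v, Ck k' U ('D_v f))
  else forall x, U x -> {for x, continuous f}.

Definition smooth (U : set V) (f : V -> W) : Prop :=
  open U /\ forall k, Ck k U f.

End Smooth.

(* Complex matrices carry no normed R-module structure in the library, so
   real differential calculus goes through the coordinates [rc] and [rc2]
   (real and imaginary parts), which are R-linear isomorphisms. *)
Section RealCoordinates.
Context {R : realType}.

Definition realmx p q : normedModType R := ('M[R]_(p, q) * 'M[R]_(p, q))%type.

Definition rc {p q} (A : 'M[R[i]]_(p, q)) : realmx p q :=
  (map_mx (@complex.Re R) A, map_mx (@complex.Im R) A).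

Definition cr {p q} (a : realmx p q) : 'M[R[i]]_(p, q) :=
  \matrix_(i, j) (a.1 i j +i* a.2 i j).

Definition realmx2 p q p' q' : normedModType R :=
  (realmx p q * realmx p' q')%type.

Definition rc2 {p q p' q'} (x : 'M[R[i]]_(p, q) * 'M[R[i]]_(p', q')) :
  realmx2 p q p' q' := (rc x.1, rc x.2).

Definition cr2 {p q p' q'} (a : realmx2 p q p' q') :
  'M[R[i]]_(p, q) * 'M[R[i]]_(p', q') := (cr a.1, cr a.2).

End RealCoordinates.

(* Curves in a space T with real coordinates [kappa], and tangent vectors of a
   subset S of T as velocities of smooth curves in S. *)
Section Curves.
Context {R : realType} {T : Type} {V : normedModType R} (kappa : T -> V).

Definition curve (c : R -> T) (x v : T) : Prop :=
  [/\ c 0 = x,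
      exists2 I : set R^o, I 0 & smooth I (kappa \o c : R^o -> V)
    & derive1 (kappa \o c) 0 = kappa v].

Definition curve_in (S : set T) (c : R -> T) (x v : T) : Prop :=
  curve c x v /\ \forall t \near (0 : R), S (c t).

Definition tangent (S : set T) (x v : T) : Prop :=
  exists c, curve_in S c x v.

End Curves.

Section LinearAlgebra.
Context {R : realType}.
Local Notation C := R[i].

Definition mximg {p q} (A : 'M[C]_(p, q)) : {vspace 'cV[C]_p} :=
  limg (linfun (mulmx A : 'cV[C]_q -> 'cV[C]_p)).

Definition psd {p} (S : 'M[C]_p) : Prop :=
  S^t* = S /\ forall x : 'cV[C]_p, 0 <= (x^t* *m S *m x) 0 0.

Definition sqrtmx {p} (A : 'M[C]_p) : 'M[C]_p :=
  xget 0 [set S | psd S /\ S *m S = A].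

End LinearAlgebra.

Section Orbit.
Context {R : realType} {n : nat} (m : nat).
Local Notation C := R[i].
Implicit Types xi v w X Y : 'M[C]_n.

Definition Orb (zeta : C) : set 'M[C]_n :=
  [set xi | exists (Q : 'M[C]_(n, m)) (P : 'M[C]_(m, n)),
    xi = Q *m P /\ P *m Q = zeta%:M].

Definition bracket X Y : 'M[C]_n := X *m Y - Y *m X.

Definition OmegaKKS xi v w : C :=
  xget 0 [set z | exists X Y, [/\ v = bracket xi X, w = bracket xi Y
    & z = \tr (xi *m bracket X Y)]].

End Orbit.

Section CotangentGrassmannian.
Context {R : realType} {n m : nat}.
Local Notation C := R[i].

(* A covector at Pi, i.e. a linear map C^n/Pi -> Pi, is encoded as the n x n
   matrix that kills Pi and has image in Pi. *)
Definition cotpoint : Type := ({vspace 'cV[C]_n} * 'M[C]_n)%type.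

Definition CotGr : set cotpoint :=
  [set x | [/\ \dim x.1 = m,
    forall y : 'cV[C]_n, y \in x.1 -> x.2 *m y = 0
    & forall y : 'cV[C]_n, x.2 *m y \in x.1]].

(* A basis of C^n split into m vectors [fa] and n - m vectors [fb], together
   with the blocks [fa'], [fb'] of the dual basis. *)
Record frame : Type := Frame {
  fa : 'M[C]_(n, m);
  fb : 'M[C]_(n, n - m);
  fa' : 'M[C]_(m, n);
  fb' : 'M[C]_(n - m, n);
  frameK : col_mx fa' fb' *m row_mx fa fb = 1%:M;
  frameVK : row_mx fa fb *m col_mx fa' fb' = 1%:M }.

Definition chartspace : Type := ('M[C]_(n - m, m) * 'M[C]_(m, n - m))%type.
Implicit Types (phi : frame) (e u v : chartspace).

(* Standard holomorphic cotangent chart: Z parametrizes the subspaces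
   Pi = Im (fa + fb Z) transverse to Im fb, and W the covectors at Pi; indeed
   fb' - Z fa' has kernel Pi. These charts cover CotGr and define its smooth
   and complex structures; a tangent vector at [par phi e] is represented in
   the chart by an element of [chartspace], on which the complex structure is
   scalar multiplication by 'i. *)
Definition par phi e : cotpoint :=
  let F := fa phi + fb phi *m e.1 in
  (mximg F, F *m e.2 *m (fb' phi - e.1 *m fa' phi)).

(* The tangent vector (dZ, dW) projects to the tangent vector of Gr which, as
   a map Pi -> C^n/Pi, is induced by the matrix fb dZ fa': the vector
   (fa + fb Z) y of Pi moves with velocity fb dZ y, and y is recovered from it
   by fa'. *)
Definition dproj phi u : 'M[C]_n := fb phi *m u.1 *m fa' phi.

Definition lambda_can phi e u : C := \tr ((par phi e).2 *m dproj phi u).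

Definition dirder (f : chartspace -> C) e u : C :=
  derive1 (fun t : R => complex.Re (f (e + t%:C *: u))) 0
  +i* derive1 (fun t : R => complex.Im (f (e + t%:C *: u))) 0.

Definition ext_d (alpha : chartspace -> chartspace -> C) e u v : C :=
  dirder (alpha ^~ v) e u - dirder (alpha ^~ u) e v.

Definition OmegaCan phi e u v : C := - ext_d (lambda_can phi) e u v.

(* The curve gamma in CotGr passes through the point of coordinates e in the
   chart phi at time 0, with velocity represented by u in this chart. *)
Definition cot_curve phi (gamma : R -> cotpoint) e u : Prop :=
  exists c : R -> chartspace, curve rc2 c e u /\
    \forall t \near (0 : R), par phi (c t) = gamma t.

Definition act (h : 'M[C]_n) (x : cotpoint) : cotpoint :=
  ((linfun (mulmx h : 'cV[C]_n -> 'cV[C]_n) @: x.1)%VS,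
   h *m x.2 *m invmx h).

End CotangentGrassmannian.

Arguments CotGr {R n} m.
Arguments frame R n m : clear implicits.

Section Quaternions.
Context {R : realType}.
Local Notation C := R[i].
Local Notation "A ^*m" := (map_mx Num.conj A) (at level 8).

(* The quaternionic matrix X + j Y, with X and Y complex, is encoded as the
   pair (X, Y); the product follows from z j = j z^* for z in C. *)
Definition qmx p q : Type := ('M[C]_(p, q) * 'M[C]_(p, q))%type.

Definition qmul {p q r} (A : qmx p q) (B : qmx q r) : qmx p r :=
  (A.1 *m B.1 - A.2 ^*m *m B.2, A.2 *m B.1 + A.1 ^*m *m B.2).

Definition qadj {p q} (A : qmx p q) : qmx q p := (A.1 ^t*, - A.2^T).

(* g(A, B) = 1/2 Tr (A B^dagger + B A^dagger), a real quaternion. *)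
Definition gflat {p q} (A B : qmx p q) : R :=
  2^-1 * complex.Re (\tr (qmul A (qadj B) + qmul B (qadj A)).1).

End Quaternions.

Section HyperkahlerReduction.
Context {R : realType} {n m : nat}.
Local Notation C := R[i].

Definition QP : Type := ('M[C]_(n, m) * 'M[C]_(m, n))%type.
Implicit Types (q A B : QP).

(* Q + j P^dagger *)
Definition qmx_of q : qmx n m := (q.1, q.2 ^t*).

Definition mu1 q : 'M[C]_m :=
  ('i / 2) *: (q.1 ^t* *m q.1 - q.2 *m q.2 ^t*).

(* mu2 and mu3 are the skew-Hermitian matrices with mu2 + 'i mu3 = P Q. *)
Definition mu2 q : 'M[C]_m := 2^-1 *: (q.2 *m q.1 - (q.2 *m q.1) ^t*).
Definition mu3 q : 'M[C]_m := (2 * 'i)^-1 *: (q.2 *m q.1 + (q.2 *m q.1) ^t*).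

Definition level : set QP :=
  [set q | [/\ \rank q.1 = m, mu1 q = 'i%:M, mu2 q = 0 & mu3 q = 0]].

(* Tangent vectors of the level set that are orthogonal to the U(m)-orbit,
   whose tangent space is {(- Q a, a P) | a in u(m)}; they represent the
   tangent vectors of the quotient, isometrically. *)
Definition horizontal q A : Prop :=
  tangent rc2 level q A /\
  forall a : 'M[C]_m, a ^t* = - a ->
    gflat (qmx_of A) (qmx_of (- (q.1 *m a), a *m q.2)) = 0.

Definition toCot q : @cotpoint R n := (mximg q.1, q.1 *m q.2).

Definition toOrb q : 'M[C]_n :=
  let s : C := (Num.sqrt 2)%:C in
  let U := s^-1 *: (q.1 - q.2 ^t*) in
  let V := ('i / s) *: (q.1 ^t* + q.2) in
  U *m V.

(* The differentials of toOrb and toCot along the level set. *)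
Definition push_Orb q A (v : 'M[C]_n) : Prop :=
  exists c, curve_in rc2 level c q A /\ curve rc (toOrb \o c) (toOrb q) v.

Definition push_Cot q A (phi : frame R n m) e u : Prop :=
  exists c, curve_in rc2 level c q A /\ cot_curve phi (toCot \o c) e u.

Definition gOrb (xi v w : 'M[C]_n) : R :=
  xget 0 [set r | exists q A B,
    [/\ toOrb q = xi, horizontal q A /\ push_Orb q A v,
        horizontal q B /\ push_Orb q B w
      & r = gflat (qmx_of A) (qmx_of B)]].

Definition gCot (phi : frame R n m) e u v : R :=
  xget 0 [set r | exists q A B,
    [/\ toCot q = par phi e, horizontal q A /\ push_Cot q A phi e u,
        horizontal q B /\ push_Cot q B phi e v
      & r = gflat (qmx_of A) (qmx_of B)]].

Definition omegaK (xi v w : 'M[C]_n) : R := gOrb xi ('i *: v) w.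

Definition omegaC (phi : frame R n m) e u v : R := gCot phi e ('i *: u) v.

End HyperkahlerReduction.

Arguments gOrb {R n} m.
Arguments omegaK {R n} m.

Section MapsOrbCot.
Context {R : realType} {n m : nat}.
Local Notation C := R[i].
Implicit Type Phi : 'M[C]_n -> @cotpoint R n.

Definition smooth_on_Orb Phi : Prop :=
  forall xi, Orb m 'i xi ->
  exists (phi : frame R n m) (U : set (realmx n n))
      (F : realmx n n -> realmx2 (n - m) m m (n - m)),
    [/\ U (rc xi), smooth U F
      & forall xi', Orb m 'i xi' -> U (rc xi') ->
          Phi xi' = par phi (cr2 (F (rc xi')))].

Definition smooth_on_Cot (Psi : @cotpoint R n -> 'M[C]_n) : Prop :=
  forall phi : frame R n m,
    smooth setT (fun e => rc (Psi (par phi (cr2 e)))).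

(* Phi restricts to a diffeomorphism from Orb('i) onto the cotangent bundle *)
Definition diffeo Phi : Prop :=
  set_bij (Orb m 'i) (CotGr m) Phi /\ smooth_on_Orb Phi /\
  exists Psi : @cotpoint R n -> 'M[C]_n,
    (forall xi, Orb m 'i xi -> Psi (Phi xi) = xi) /\ smooth_on_Cot Psi.

(* dPhi maps the tangent vector v of Orb('i) at xi to the tangent vector
   represented by u in the chart phi, where Phi xi has coordinates e. *)
Definition differential Phi xi v (phi : frame R n m) e u : Prop :=
  exists c, curve_in rc (Orb m 'i) c xi v /\ cot_curve phi (Phi \o c) e u.

End MapsOrbCot.

Arguments diffeo {R n} m.

(* Main.v *)
(* On the level set one has P Q = 0 and Q^dagger Q = 2 + P P^dagger, so
   D = Q - P^dagger and E = Q^dagger + P satisfy E D = 2 and D^dagger D = E E^dagger;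
   hence xi = (i/2) D E, sqrt(xi^dagger xi) = E^dagger E / 2 and
   sqrt(xi xi^dagger) = D D^dagger / 2. It follows that
   xi + sqrt(xi^dagger xi) xi = i Q E has image Im Q, and that the formula of the
   statement gives eta = Q P: so Phi is [Q, P] |-> (Im Q, Q P) after the inverse of
   [Q, P] |-> U V. Both identifications of the quotient are bijective because an
   orbit of GL(m) on the pairs (Q, P) meets the level set in one orbit of U(m),
   which amounts to the unique solvability of Riccati equations for positive
   matrices; the solutions are explicit in terms of square roots, and the square
   root of a smooth family of positive matrices is smooth by induction on the
   order, its derivative solving a Sylvester equation.

   The horizontal vectors at (Q, P) form the quaternionic subspace
   Q^dagger X = Y P^dagger, P X + Y Q = 0. The map [Q, P] |-> U V intertwines
   K : (X, Y) |-> (- i Y^dagger, i X^dagger) with multiplication by i, and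
   [Q, P] |-> (Im Q, Q P) intertwines I : (X, Y) |-> (i X, i Y) with
   multiplication by i, so that the three identities between two-forms become
   trace identities on horizontal vectors. *)

(* One hyperkähler quotient is seen through two complex structures: the canonical form is
   [Omega_1 = omega_2 + i omega_3], holomorphic for I, and the KKS form is
   [Omega_3 = omega_1 + i omega_2], holomorphic for K. They share [omega_2], and the components
   [omega_3] and [omega_1] that remain are the two Kähler forms. The metrics and the KKS form are
   defined by choosing a value, and tangent vectors by curves, so each evaluation asks for a curve
   that realizes the vector and for independence of the lift. No quotient manifold is formed, and
   explicit formulas do the work of the implicit function theorem: a cotangent chart carries a
   smooth section into the level set, which lifts curves; a Sylvester equation removes the vertical
   part of the velocity; conversely, every solution of the horizontality system is the velocity of
   an explicit curve in the level set. The 2 in [E D = 2] comes from [mu_1 = i]: since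
   [mu_1 = (i/2)(Q^dagger Q - P P^dagger)], the difference of the two squares is 2. *)
From HB Require Import structures.
Require Import Defs.
From mathcomp Require Import all_boot all_order all_algebra.
From mathcomp Require Import complex.
From mathcomp Require Import all_classical all_reals all_analysis.
From mathcomp Require Import ring.
Import Order.TTheory GRing.Theory Num.Theory.
Import numFieldNormedType.Exports.
Local Open Scope classical_set_scope.
Local Open Scope complex_scope.
Local Open Scope sesquilinear_scope.
Local Open Scope ring_scope.

Set Implicit Arguments.
Unset Strict Implicit.
Unset Printing Implicit Defensive.

(** * Positive matrices *)

Section PositiveMatrices.
Context {R : realType}.
Local Notation C := R[i].

Lemma addr_ge0_eq0 {F : numDomainType} (a b : F) :
  0 <= a -> 0 <= b -> a + b = 0 -> a = 0 /\ b = 0.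
Proof.
move=> a0 b0 /eqP; rewrite (paddr_eq0 a0 b0).
by move=> /andP[/eqP-> /eqP->].
Qed.

Lemma adjmxM {p q r} (A : 'M[C]_(p, q)) (B : 'M[C]_(q, r)) :
  (A *m B)^t* = B^t* *m A^t*.
Proof. by rewrite trmx_mul map_mxM. Qed.

Lemma adjmxD {p q} (A B : 'M[C]_(p, q)) : (A + B)^t* = A^t* + B^t*.
Proof. by rewrite linearD /= map_mxD. Qed.

Lemma adjmxN {p q} (A : 'M[C]_(p, q)) : (- A)^t* = - A^t*.
Proof. by rewrite linearN /= map_mxN. Qed.

Lemma adjmxB {p q} (A B : 'M[C]_(p, q)) : (A - B)^t* = A^t* - B^t*.
Proof. by rewrite adjmxD adjmxN. Qed.

Lemma adjmxZ {p q} (a : C) (A : 'M[C]_(p, q)) :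
  (a *: A)^t* = Num.conj a *: A^t*.
Proof. by rewrite linearZ /= map_mxZ. Qed.

Lemma adjmx_scalar {p} (a : C) : (a%:M : 'M[C]_p)^t* = (Num.conj a)%:M.
Proof. by rewrite tr_scalar_mx map_scalar_mx. Qed.

Lemma adjmx1 {p} : (1%:M : 'M[C]_p)^t* = 1%:M.
Proof. by rewrite adjmx_scalar conjC1. Qed.

Lemma adjmx0 {p q} : (0 : 'M[C]_(p, q))^t* = 0.
Proof. by rewrite trmx0 map_mx0. Qed.

Lemma adjmxV {p} (A : 'M[C]_p) : (invmx A)^t* = invmx (A^t*).
Proof. by rewrite trmx_inv map_invmx. Qed.

Lemma unitmx_adj {p} (A : 'M[C]_p) : (A^t* \in unitmx) = (A \in unitmx).
Proof. by rewrite map_unitmx unitmx_tr. Qed.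

Lemma mxtrace_adj {p} (A : 'M[C]_p) : \tr (A^t*) = Num.conj (\tr A).
Proof.
by rewrite /mxtrace rmorph_sum; apply: eq_bigr => i _; rewrite !mxE.
Qed.

Lemma trace_adjmul {p q} (A : 'M[C]_(p, q)) :
  \tr (A^t* *m A) = \sum_j \sum_i `|A i j| ^+ 2.
Proof.
apply: eq_bigr => j _; rewrite !mxE; apply: eq_bigr => i _.
by rewrite !mxE normCK mulrC.
Qed.

Lemma trace_adjmul_ge0 {p q} (A : 'M[C]_(p, q)) : 0 <= \tr (A^t* *m A).
Proof.
rewrite trace_adjmul; apply: sumr_ge0 => j _; apply: sumr_ge0 => i _.
exact: exprn_ge0.
Qed.

Lemma trace_adjmul_eq0 {p q} (A : 'M[C]_(p, q)) :
  \tr (A^t* *m A) = 0 -> A = 0.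
Proof.
rewrite trace_adjmul => /eqP; rewrite psumr_eq0; last first.
  by move=> j _; apply: sumr_ge0 => i _; exact: exprn_ge0.
move=> /allP /= A0; apply/matrixP => i j; rewrite mxE.
have /eqP := A0 j (mem_index_enum _).
move=> /eqP; rewrite psumr_eq0; last by move=> k _; exact: exprn_ge0.
by move=> /allP /(_ i (mem_index_enum _)); rewrite expf_eq0 normr_eq0 => /eqP.
Qed.

Lemma adjmul_eq0 {p q} (A : 'M[C]_(p, q)) : A^t* *m A = 0 -> A = 0.
Proof. by move=> A0; apply: trace_adjmul_eq0; rewrite A0 mxtrace0. Qed.

Lemma psd_adjmul {p q} (A : 'M[C]_(p, q)) : psd (A^t* *m A).
Proof.
split=> [|x]; first by rewrite adjmxM trmxCK.
rewrite mulmxA -mulmxA -adjmxM; have := trace_adjmul_ge0 (A *m x).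
by rewrite /mxtrace big_ord1.
Qed.

Lemma psd_muladj {p q} (A : 'M[C]_(p, q)) : psd (A *m A^t*).
Proof. by rewrite -{1}(trmxCK A); exact: psd_adjmul. Qed.

Lemma psdD {p} (S T : 'M[C]_p) : psd S -> psd T -> psd (S + T).
Proof.
move=> [Sh S0] [Th T0]; split=> [|x]; first by rewrite adjmxD Sh Th.
by rewrite mulmxDr mulmxDl mxE addr_ge0.
Qed.

Lemma psd_conj {p q} (A : 'M[C]_(p, q)) (S : 'M[C]_p) :
  psd S -> psd (A^t* *m S *m A).
Proof.
move=> [Sh S0]; split=> [|x]; first by rewrite !adjmxM trmxCK Sh mulmxA.
by have := S0 (A *m x); rewrite adjmxM !mulmxA.
Qed.

Lemma psd1 {p} : psd (1%:M : 'M[C]_p).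
Proof. by have := psd_adjmul (1%:M : 'M[C]_p); rewrite adjmx1 mulmx1. Qed.

Lemma psdZ {p} (a : C) (S : 'M[C]_p) : 0 <= a -> psd S -> psd (a *: S).
Proof.
move=> a0 [Sh S0]; split=> [|x].
  by rewrite adjmxZ Sh (CrealP _) // ger0_real.
by rewrite -scalemxAr -scalemxAl mxE mulr_ge0.
Qed.

Lemma psd_sqrt_ex {p} (A : 'M[C]_p) : psd A -> exists2 S, psd S & S *m S = A.
Proof.
move=> [Ah A0].
have Ahs : A \is hermsymmx by apply/eqP; rewrite expr0 scale1r Ah.
have /hermitian_normalmx/orthomx_spectralP Aeq := Ahs.
have Pu := spectral_unitarymx A.
rewrite invmx_unitary // in Aeq.
set P := spectralmx A in Aeq Pu; set d := spectral_diag A in Aeq.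
have PP : P *m P^t* = 1%:M by apply/unitarymxP.
have d0 i : 0 <= d 0 i.
  have := A0 (P^t* *m delta_mx i (0 : 'I_1)).
  rewrite Aeq adjmxM trmxCK !mulmxA -[_ *m P *m P^t*]mulmxA PP mulmx1.
  rewrite -[_ *m P *m P^t*]mulmxA PP mulmx1.
  rewrite mul_mx_diag.
  rewrite !mxE (bigD1 i) //= big1 ?addr0; last first.
    by move=> j ji; rewrite !mxE (negPf ji) mulr0.
  by rewrite !mxE !eqxx /= conjC1 mul1r mulr1.
pose e := map_mx sqrtC d.
exists (P^t* *m diag_mx e *m P).
  (* A second root displays the conjugated diagonal matrix as a product [A^t* *m A], which is
     [psd]. *)
  have -> : diag_mx e = (diag_mx (map_mx sqrtC e))^t* *m diag_mx (map_mx sqrtC e).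
    rewrite tr_diag_mx map_diag_mx mulmx_diag; congr diag_mx.
    apply/rowP => i; rewrite !mxE.
    have e0 : 0 <= sqrtC (sqrtC (d 0 i)) by rewrite !sqrtC_ge0.
    by rewrite /= (CrealP (ger0_real e0)) -expr2 sqrtCK.
  rewrite mulmxA -adjmxM -mulmxA; exact: psd_adjmul.
rewrite !mulmxA -[_ *m P *m P^t*]mulmxA PP mulmx1.
rewrite -[_ *m diag_mx e *m diag_mx e]mulmxA mulmx_diag [RHS]Aeq.
suff -> : \row_j (e 0 j * e 0 j) = d by [].
by apply/rowP => i; rewrite !mxE -expr2 sqrtCK.
Qed.

Lemma mxtrace_psd_ge0 {p q} (S : 'M[C]_p) (X : 'M[C]_(p, q)) :
  psd S -> 0 <= \tr (X^t* *m S *m X).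
Proof.
move=> /psd_sqrt_ex[T [Th _] <-].
by rewrite -{1}Th !mulmxA -adjmxM -mulmxA trace_adjmul_ge0.
Qed.

Lemma mxtrace_psd_eq0 {p q} (S : 'M[C]_p) (X : 'M[C]_(p, q)) :
  psd S -> \tr (X^t* *m S *m X) = 0 -> S *m X = 0.
Proof.
move=> /psd_sqrt_ex[T [Th _] <-].
rewrite -{1}Th !mulmxA -adjmxM -mulmxA => /trace_adjmul_eq0 TX.
by rewrite -mulmxA TX mulmx0.
Qed.

(* Taking the trace of [X^dagger (S X + X T)] makes both terms nonnegative. *)
Lemma sylvester_eq0 {p q} (S : 'M[C]_p) (T : 'M[C]_q) (X : 'M[C]_(p, q)) :
  psd S -> psd T -> S *m X + X *m T = 0 -> S *m X = 0 /\ X *m T = 0.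
Proof.
move=> Sp Tp SXT; have [[Sh _] [Th _]] := (Sp, Tp).
have tS := mxtrace_psd_ge0 X Sp.
have tT := mxtrace_psd_ge0 (X^t*) Tp.
have : \tr (X^t* *m S *m X) + \tr ((X^t*)^t* *m T *m X^t*) = 0.
  rewrite trmxCK [X in _ + X]mxtrace_mulC -mxtraceD -!mulmxA -mulmxDr SXT.
  by rewrite mulmx0 mxtrace0.
move=> /(addr_ge0_eq0 tS tT)[S0 T0].
split; first exact: (mxtrace_psd_eq0 Sp S0).
have := mxtrace_psd_eq0 Tp T0.
by move=> /(congr1 (fun Z => Z^t*)); rewrite adjmxM trmxCK Th adjmx0.
Qed.

(** The difference [D = S - T] solves [S D + D T = 0], so [S D = 0] and [D T = 0]. The adjoint of
    the latter is [T D = 0], and [D^dagger D = S D - T D] vanishes. *)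
Lemma psd_sqrt_uniq {p} (S T : 'M[C]_p) :
  psd S -> psd T -> S *m S = T *m T -> S = T.
Proof.
move=> Sp Tp ST; apply/eqP; rewrite -subr_eq0; apply/eqP.
have [] := @sylvester_eq0 _ _ S T (S - T) Sp Tp.
  by rewrite mulmxBr mulmxBl ST addrA subrK subrr.
move=> SD DT; have [[Sh _] [Th _]] := (Sp, Tp).
apply: adjmul_eq0; rewrite adjmxB Sh Th mulmxBl SD sub0r.
apply/eqP; rewrite oppr_eq0; apply/eqP.
have := congr1 (fun Z => Z^t*) DT.
by rewrite adjmxM adjmxB Sh Th adjmx0.
Qed.

Lemma sqrtmxP {p} (A : 'M[C]_p) :
  psd A -> psd (sqrtmx A) /\ sqrtmx A *m sqrtmx A = A.
Proof.
move=> /psd_sqrt_ex[S Sp SA].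
by have := @xgetPex _ 0 [set S | psd S /\ S *m S = A] (ex_intro _ S (conj Sp SA)).
Qed.

Lemma sqrtmx_uniq {p} (A S : 'M[C]_p) : psd S -> S *m S = A -> sqrtmx A = S.
Proof.
move=> Sp SA.
have [|] := @sqrtmxP _ A.
  by case: Sp => Sh _; rewrite -SA -{1}Sh; exact: psd_adjmul.
by move=> Tp TA; apply: psd_sqrt_uniq => //; rewrite TA.
Qed.

Definition pd {p} (S : 'M[C]_p) : Prop := psd S /\ S \in unitmx.

Lemma mulmx_inj_unit {p} (S : 'M[C]_p) :
  (forall x : 'cV[C]_p, S *m x = 0 -> x = 0) -> S \in unitmx.
Proof.
move=> Sinj; rewrite -unitmx_tr -row_free_unit -kermx_eq0.
apply/eqP/row_matrixP => i; rewrite row0; apply: trmx_inj; rewrite trmx0.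
apply: Sinj; apply: trmx_inj; rewrite trmx_mul trmxK trmx0.
by apply/sub_kermxP; exact: row_sub.
Qed.

Lemma psd_vec0 {p} (S : 'M[C]_p) (x : 'cV[C]_p) :
  psd S -> (x^t* *m S *m x) 0 0 = 0 -> S *m x = 0.
Proof. by move=> Sp x0; apply: mxtrace_psd_eq0 => //; rewrite /mxtrace big_ord1. Qed.

Lemma pdD {p} (S T : 'M[C]_p) : pd S -> psd T -> pd (S + T).
Proof.
move=> [Sp Su] Tp; split; first exact: psdD.
apply: mulmx_inj_unit => x STx.
suff Sx : S *m x = 0 by rewrite -[x](mulKmx Su) Sx mulmx0.
apply: psd_vec0 => //.
have : (x^t* *m (S + T) *m x) 0 0 = 0 by rewrite -mulmxA STx mulmx0 mxE.
by rewrite mulmxDr mulmxDl mxE => /(addr_ge0_eq0 (Sp.2 x) (Tp.2 x))[].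
Qed.

Lemma pd1 {p} : pd (1%:M : 'M[C]_p).
Proof. by split; [exact: psd1 | exact: unitmx1]. Qed.

Lemma pd_adjmul {p q} (A : 'M[C]_(p, q)) (L : 'M[C]_(q, p)) :
  L *m A = 1%:M -> pd (A^t* *m A).
Proof.
move=> LA; split; first exact: psd_adjmul.
apply: mulmx_inj_unit => x Ax.
suff Ax0 : A *m x = 0 by rewrite -[x]mul1mx -LA -mulmxA Ax0 mulmx0.
apply: adjmul_eq0; rewrite adjmxM -[_ *m (A *m x)]mulmxA.
by rewrite [A^t* *m _]mulmxA Ax mulmx0.
Qed.

Lemma pd_conj {p} (A S : 'M[C]_p) :
  A \in unitmx -> pd S -> pd (A^t* *m S *m A).
Proof.
move=> Au [Sp Su]; split; first exact: psd_conj.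
by rewrite !unitmx_mul unitmx_adj Au Su.
Qed.

Lemma pd_inv {p} (S : 'M[C]_p) : pd S -> pd (invmx S).
Proof.
move=> [Sp Su]; have [Sh _] := Sp; split; last by rewrite unitmx_inv.
have := psd_conj (invmx S) Sp.
by rewrite adjmxV Sh (mulVmx Su) mul1mx.
Qed.

Lemma pd_sqrt {p} (S : 'M[C]_p) : pd S -> pd (sqrtmx S).
Proof.
move=> [/sqrtmxP[Tp TT] Su]; split=> //.
by move: Su; rewrite -{1}TT unitmx_mul => /andP[].
Qed.

Lemma sylvester_inj {p q} (S : 'M[C]_p) (T : 'M[C]_q) (X : 'M[C]_(p, q)) :
  pd S -> psd T -> S *m X + X *m T = 0 -> X = 0.
Proof.
move=> [Sp Su] Tp /(sylvester_eq0 Sp Tp)[SX _].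
by rewrite -[X](mulKmx Su) SX mulmx0.
Qed.

(** The matrix of [X |-> S X + X T] on vectorized matrices. Its inverse writes the solution of a
    Sylvester equation as an explicit expression in [S], [T] and the right-hand side, so that
    regularity passes from these to the solution. *)
Definition sylv {p q} (S : 'M[C]_p) (T : 'M[C]_q) : 'M[C]_(p * q) :=
  lin_mulmx S + lin_mulmxr T.

Lemma mul_sylv {p q} (S : 'M[C]_p) (T : 'M[C]_q) (X : 'M[C]_(p, q)) :
  mxvec X *m sylv S T = mxvec (S *m X + X *m T).
Proof. by rewrite mulmxDr !mul_vec_lin linearD. Qed.

Lemma sylv_unit {p q} (S : 'M[C]_p) (T : 'M[C]_q) :
  pd S -> psd T -> sylv S T \in unitmx.
Proof.
move=> Sp Tp; rewrite -row_free_unit -kermx_eq0.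
apply/eqP/row_matrixP => i; rewrite row0 -[row _ _]vec_mxK.
set X := vec_mx _; suff -> : X = 0 by rewrite linear0.
apply: (sylvester_inj Sp Tp); apply: (can_inj mxvecK).
rewrite -mul_sylv linear0 vec_mxK.
by apply/sub_kermxP; exact: row_sub.
Qed.

Lemma sylvester_solve {p q} (S : 'M[C]_p) (T : 'M[C]_q) (H : 'M[C]_(p, q)) :
  pd S -> psd T -> exists X, S *m X + X *m T = H.
Proof.
move=> Sp Tp; exists (vec_mx (mxvec H *m invmx (sylv S T))).
by apply: (can_inj mxvecK); rewrite -mul_sylv vec_mxK mulmxKV // sylv_unit.
Qed.

Lemma sylvester_sol {p q} (S : 'M[C]_p) (T : 'M[C]_q) (X : 'M[C]_(p, q)) :
  pd S -> psd T ->
  X = vec_mx (mxvec (S *m X + X *m T) *m invmx (sylv S T)).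
Proof.
by move=> Sp Tp; rewrite -mul_sylv mulmxK ?sylv_unit // mxvecK.
Qed.

End PositiveMatrices.

(** * Differential calculus of complex matrices *)

Section CkTheory.
Context {R : realType} {V : normedModType R}.

Lemma differentiable_expansion {W : normedModType R} (f : V -> W)
    (df : {linear V -> W}) (x : V) :
  continuous df -> f \o shift x = cst (f x) + df +o_ 0 id ->
  differentiable f x.
Proof.
by move=> dfc fE; apply/diff_locallyP; rewrite (diff_unique dfc fE).
Qed.

Lemma near_eq_differentiable {W : normedModType R} (f g : V -> W) (x : V) :
  (\forall y \near x, f y = g y) -> differentiable f x -> differentiable g x.
Proof.
move=> fg df; have dfc := diff_continuous df.
apply: (@differentiable_expansion _ g ('d f x) x dfc).
have /eqaddoP fE := diff_locally df.
apply/eqaddoP => e e0.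
have fg0 : \forall h \near 0, f (h + x) = g (h + x).
  by move: fg; rewrite (near_shift 0); apply: filterS => h /=; rewrite subr0.
have := fE e e0; apply: filterS2 fg0 => h /= fgh.
by rewrite !fctE /= fgh (nbhs_singleton fg).
Qed.

Lemma Ck_ext {W : normedModType R} k (U : set V) (f g : V -> W) :
  open U -> (forall x, U x -> f x = g x) -> Ck k U f -> Ck k U g.
Proof.
move=> Uo; have nU x : U x -> \forall y \near x, U y by move=> Ux; exact: open_nbhs_nbhs.
elim: k f g => [|k IH] f g fg /=.
  move=> fc x Ux; have := fc x Ux; rewrite /prop_for /continuous_at (fg x Ux).
  apply: cvg_trans; apply: near_eq_cvg.
  by near=> y; rewrite fg //; near: y; exact: nU.
have nfg x : U x -> \forall y \near x, f y = g y.
  by move=> /nU; apply: filterS => y; exact: fg.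
move=> [fd fD]; split=> [x Ux|v].
  exact: near_eq_differentiable (nfg _ Ux) (fd _ Ux).
by apply: IH (fD v) => x Ux; apply: near_eq_derive; exact: nfg.
Unshelve. all: by end_near. Qed.

Lemma CkW {W : normedModType R} k (U : set V) (f : V -> W) :
  Ck k.+1 U f -> Ck k U f.
Proof.
elim: k f => [|k IH] f [fd fD].
  by move=> x Ux; exact: differentiable_continuous (fd x Ux).
by split=> // v; apply: IH; exact: fD.
Qed.

Lemma Ck_sub {W : normedModType R} k (U U' : set V) (f : V -> W) :
  U' `<=` U -> Ck k U f -> Ck k U' f.
Proof.
move=> U'U; elim: k f => [|k IH] f /=; first by move=> fc x /U'U; exact: fc.
by move=> [fd fD]; split=> [x /U'U|v]; [exact: fd|exact: IH (fD v)].
Qed.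

Lemma Ck_cst {W : normedModType R} k (U : set V) (w : W) : Ck k U (cst w : V -> W).
Proof.
elim: k w => [|k IH] w /=; first by move=> x _; exact: cst_continuous.
split=> [x _|v]; first exact: differentiable_cst.
have -> : 'D_v (cst w : V -> W) = cst 0 by apply/funext => x; rewrite derive_cst.
exact: IH.
Qed.

Lemma Ck_linear {W : normedModType R} k (U : set V) (f : {linear V -> W}) :
  continuous f -> Ck k U f.
Proof.
move=> fc; case: k => [|k] /=; first by move=> x _; exact: fc.
split=> [x _|v]; first exact: linear_differentiable.
have -> : 'D_v f = cst (f v).
  apply/funext => x; rewrite deriveE; last exact: linear_differentiable.
  by rewrite diff_lin.
exact: Ck_cst.
Qed.

Section Operations.
Variables (U : set V) (Uo : open U).

Lemma CkD {W : normedModType R} k (f g : V -> W) :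
  Ck k U f -> Ck k U g -> Ck k U (fun x => f x + g x).
Proof.
elim: k f g => [|k IH] f g /=.
  by move=> fc gc x Ux; apply: continuousD; [exact: fc|exact: gc].
move=> [fd fD] [gd gD]; split=> [x Ux|v].
  by apply: differentiableD; [exact: fd|exact: gd].
apply: Ck_ext (IH _ _ (fD v) (gD v)) => // x Ux.
by rewrite -deriveD //; apply: diff_derivable; [exact: fd|exact: gd].
Qed.

Lemma Ck_comp_linear {W W' : normedModType R} k (f : V -> W)
    (l : {linear W -> W'}) : continuous l ->
  Ck k U f -> Ck k U (fun x => l (f x)).
Proof.
move=> lc; elim: k f => [|k IH] f /=.
  by move=> fc x Ux; apply: continuous_comp; [exact: fc|exact: lc].
move=> [fd fD]; split=> [x Ux|v].
  by apply: differentiable_comp; [exact: fd|exact: linear_differentiable].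
apply: Ck_ext (IH _ (fD v)) => // x Ux.
rewrite [RHS]deriveE; last first.
  by apply: differentiable_comp; [exact: fd|exact: linear_differentiable].
rewrite diff_comp; [|exact: fd|exact: linear_differentiable].
by rewrite /= diff_lin // deriveE //; exact: fd.
Qed.

Lemma CkN k (f : V -> R^o) : Ck k U f -> Ck k U (fun x => - f x : R^o).
Proof.
elim: k f => [|k IH] f /=.
  by move=> fc x Ux; apply: continuousN; exact: fc.
move=> [fd fD]; split=> [x Ux|v]; first by apply: differentiableN; exact: fd.
apply: Ck_ext (IH _ (fD v)) => // x Ux.
by rewrite -deriveN //; apply: diff_derivable; exact: fd.
Qed.

Lemma CkM k (f g : V -> R^o) :
  Ck k U f -> Ck k U g -> Ck k U (fun x => f x * g x : R^o).
Proof.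
elim: k f g => [|k IH] f g.
  by move=> fc gc x Ux; apply: continuousM; [exact: fc|exact: gc].
move=> fk gk; have [fW gW] := (CkW fk, CkW gk); move: fk gk => [fd fD] [gd gD].
split=> [x Ux|v]; first by apply: differentiableM; [exact: fd|exact: gd].
apply: Ck_ext (CkD (IH _ _ fW (gD v)) (IH _ _ gW (fD v))) => // x Ux.
by rewrite -deriveM //; apply: diff_derivable; [exact: fd|exact: gd].
Qed.

Lemma CkV k (f : V -> R^o) : (forall x, U x -> f x != 0) ->
  Ck k U f -> Ck k U (fun x => (f x)^-1 : R^o).
Proof.
move=> f0; elim: k => [|k IH].
  by move=> fc x Ux; apply: cvgV; [exact: f0|exact: fc].
move=> fk; have fW := IH (CkW fk); move: fk => [fd fD].
split=> [x Ux|v]; first by apply: differentiableV; [exact: fd|exact: f0].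
apply: Ck_ext (CkN (CkM (CkM fW fW) (fD v))) => // x Ux.
rewrite deriveV; [|exact: f0|by apply: diff_derivable; exact: fd].
by rewrite -invfM -expr2 /GRing.scale /= mulNr.
Qed.

Lemma Ck_scaler {W : normedModType R} k (f : V -> R^o) (w : W) :
  Ck k U f -> Ck k U (fun x => f x *: w).
Proof.
elim: k f => [|k IH] f /=.
  by move=> fc x Ux; apply: continuousZr_tmp; exact: fc.
move=> [fd fD]; split=> [x Ux|v]; first by apply: differentiableZl; exact: fd.
apply: Ck_ext (IH _ (fD v)) => // x Ux.
rewrite !deriveE ?diffZl //; try exact: fd.
by apply: differentiableZl; exact: fd.
Qed.

Lemma Ck_sum {W : normedModType R} k (I : Type) (r : seq I) (P : pred I)
    (f : I -> V -> W) :
  (forall i, P i -> Ck k U (f i)) -> Ck k U (fun x => \sum_(i <- r | P i) f i x).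
Proof.
move=> fk; elim: r => [|i r IH].
  by apply: Ck_ext (Ck_cst k U 0) => // x _; rewrite big_nil.
case Pi : (P i); last by apply: Ck_ext IH => // x _; rewrite big_cons Pi.
by apply: Ck_ext (CkD (fk i Pi) IH) => // x _; rewrite big_cons Pi.
Qed.

End Operations.
End CkTheory.

Section ComplexParts.
Context {R : realType}.
Implicit Types z w : R[i].

Lemma Re_add z w : complex.Re (z + w) = complex.Re z + complex.Re w.
Proof. by case: z w => [a b] [c d]. Qed.

Lemma Im_add z w : complex.Im (z + w) = complex.Im z + complex.Im w.
Proof. by case: z w => [a b] [c d]. Qed.

Lemma Re_opp z : complex.Re (- z) = - complex.Re z.
Proof. by case: z. Qed.

Lemma Im_opp z : complex.Im (- z) = - complex.Im z.
Proof. by case: z. Qed.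

Lemma Re_mul z w :
  complex.Re (z * w) =
  complex.Re z * complex.Re w - complex.Im z * complex.Im w.
Proof. by case: z w => [a b] [c d]. Qed.

Lemma Im_mul z w :
  complex.Im (z * w) =
  complex.Re z * complex.Im w + complex.Im z * complex.Re w.
Proof. by case: z w => [a b] [c d]. Qed.

Lemma Re_inv z :
  complex.Re z^-1 = complex.Re z / (complex.Re z ^+ 2 + complex.Im z ^+ 2).
Proof. by case: z. Qed.

Lemma Im_inv z :
  complex.Im z^-1 = - complex.Im z / (complex.Re z ^+ 2 + complex.Im z ^+ 2).
Proof. by case: z => a b /=; rewrite mulNr. Qed.

Lemma Re_conj z : complex.Re (Num.conj z) = complex.Re z.
Proof. by case: z. Qed.

Lemma Im_conj z : complex.Im (Num.conj z) = - complex.Im z.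
Proof. by case: z. Qed.

Lemma Re_i : complex.Re ('i : R[i]) = 0.
Proof. by []. Qed.

Lemma Im_i : complex.Im ('i : R[i]) = 1.
Proof. by []. Qed.

Lemma complex_eq z w :
  complex.Re z = complex.Re w -> complex.Im z = complex.Im w -> z = w.
Proof. by case: z w => [a b] [c d] /= -> ->. Qed.

Lemma normsq_parts_neq0 z :
  z != 0 -> complex.Re z ^+ 2 + complex.Im z ^+ 2 != 0.
Proof.
case: z => a b; apply: contra => /=.
rewrite paddr_eq0 ?sqr_ge0 // !sqrf_eq0 => /andP[/eqP-> /eqP->].
exact/eqP.
Qed.

End ComplexParts.

Section RealCoordinateMaps.
Context {R : realType} {p q : nat}.

Lemma rcK : cancel (@rc R p q) cr.
Proof.
by move=> A; apply/matrixP => i j; rewrite !mxE; apply: complex_eq.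
Qed.

Lemma crK : cancel (@cr R p q) rc.
Proof.
by case=> a b; congr pair; apply/matrixP => i j; rewrite !mxE.
Qed.

(** A finite sum of real scalar functions times constant vectors: the regularity of a matrix-valued
    map reduces to that of its entries. *)
Lemma rc_linear_sum (A : 'M[R[i]]_(p, q)) :
  rc A = \sum_i \sum_j (complex.Re (A i j) *: ((delta_mx i j, 0) : Defs.realmx p q)
                      + complex.Im (A i j) *: ((0, delta_mx i j) : Defs.realmx p q)).
Proof.
under eq_bigr do rewrite big_split /=.
rewrite big_split /=.
have fstE (I : finType) (G : I -> Defs.realmx p q) : (\sum_i G i).1 = \sum_i (G i).1.
  by apply: (big_morph fst).
have sndE (I : finType) (G : I -> Defs.realmx p q) : (\sum_i G i).2 = \sum_i (G i).2.
  by apply: (big_morph snd).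
apply: injective_projections.
  rewrite /= !fstE /= [X in _ + X]big1; last first.
    by move=> i _; rewrite fstE big1 // => j _; rewrite /= scaler0.
  rewrite addr0 [LHS]matrix_sum_delta; apply: eq_bigr => i _; rewrite fstE.
  by apply: eq_bigr => j _; rewrite mxE.
rewrite /= !sndE /= [X in X + _]big1; last first.
  by move=> i _; rewrite sndE big1 // => j _; rewrite /= scaler0.
rewrite add0r [LHS]matrix_sum_delta; apply: eq_bigr => i _; rewrite sndE.
by apply: eq_bigr => j _; rewrite mxE.
Qed.

Definition coord_re (i : 'I_p) (j : 'I_q) (a : Defs.realmx p q) : R^o := a.1 i j.
Definition coord_im (i : 'I_p) (j : 'I_q) (a : Defs.realmx p q) : R^o := a.2 i j.

Lemma coord_re_is_linear i j : linear (coord_re i j).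
Proof. by move=> c a b; rewrite /coord_re /= !mxE. Qed.

Lemma coord_im_is_linear i j : linear (coord_im i j).
Proof. by move=> c a b; rewrite /coord_im /= !mxE. Qed.

HB.instance Definition _ i j :=
  GRing.isLinear.Build R (Defs.realmx p q) R^o _ (coord_re i j) (coord_re_is_linear i j).
HB.instance Definition _ i j :=
  GRing.isLinear.Build R (Defs.realmx p q) R^o _ (coord_im i j) (coord_im_is_linear i j).

Lemma coord_re_continuous i j : continuous (coord_re i j).
Proof.
move=> a; apply: (@continuous_comp _ _ _ fst (fun M : 'M[R]_(p, q) => M i j)).
  exact: cvg_fst.
exact: coord_continuous.
Qed.

Lemma coord_im_continuous i j : continuous (coord_im i j).
Proof.
move=> a; apply: (@continuous_comp _ _ _ snd (fun M : 'M[R]_(p, q) => M i j)).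
  exact: cvg_snd.
exact: coord_continuous.
Qed.

End RealCoordinateMaps.

Section ComplexSmooth.
Context {R : realType} {V : normedModType R}.
Local Notation C := R[i].

Definition cCk k (U : set V) (z : V -> C) : Prop :=
  Ck k U (fun x => complex.Re (z x) : R^o) /\
  Ck k U (fun x => complex.Im (z x) : R^o).

Definition mCk {p q} k (U : set V) (F : V -> 'M[C]_(p, q)) : Prop :=
  forall i j, cCk k U (fun x => F x i j).

Lemma cCk_sub k (U U' : set V) z : U' `<=` U -> cCk k U z -> cCk k U' z.
Proof. by move=> U'U [zr zi]; split; apply: Ck_sub U'U _. Qed.

Lemma mCk_sub {p q} k (U U' : set V) (F : V -> 'M[C]_(p, q)) :
  U' `<=` U -> mCk k U F -> mCk k U' F.
Proof. by move=> U'U FU i j; exact: cCk_sub U'U (FU i j). Qed.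

Lemma mCkW {p q} k (U : set V) (F : V -> 'M[C]_(p, q)) :
  mCk k.+1 U F -> mCk k U F.
Proof. by move=> Fk i j; have [? ?] := Fk i j; split; exact: CkW. Qed.

Lemma mCk_cst {p q} k (U : set V) (A : 'M[C]_(p, q)) : mCk k U (fun=> A).
Proof. by move=> i j; split; exact: Ck_cst. Qed.

Section Operations.
Variables (U : set V) (Uo : open U).

Lemma cCk_ext k z w : (forall x, U x -> z x = w x) -> cCk k U z -> cCk k U w.
Proof.
by move=> zw [zr zi]; split; [move: zr|move: zi]; apply: Ck_ext => // x Ux;
  rewrite zw.
Qed.

Lemma cCkD k z w : cCk k U z -> cCk k U w -> cCk k U (fun x => z x + w x).
Proof.
move=> [zr zi] [wr wi]; split.
  by apply: Ck_ext (CkD Uo zr wr) => // x _; rewrite Re_add.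
by apply: Ck_ext (CkD Uo zi wi) => // x _; rewrite Im_add.
Qed.

Lemma cCkN k z : cCk k U z -> cCk k U (fun x => - z x).
Proof.
move=> [zr zi]; split.
  by apply: Ck_ext (CkN Uo zr) => // x _; rewrite Re_opp.
by apply: Ck_ext (CkN Uo zi) => // x _; rewrite Im_opp.
Qed.

Lemma cCk_conj k z : cCk k U z -> cCk k U (fun x => Num.conj (z x)).
Proof.
move=> [zr zi]; split.
  by apply: Ck_ext zr => // x _; rewrite Re_conj.
by apply: Ck_ext (CkN Uo zi) => // x _; rewrite Im_conj.
Qed.

Lemma cCkM k z w : cCk k U z -> cCk k U w -> cCk k U (fun x => z x * w x).
Proof.
move=> [zr zi] [wr wi]; split.
  apply: Ck_ext (CkD Uo (CkM Uo zr wr) (CkN Uo (CkM Uo zi wi))) => // x _.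
  by rewrite Re_mul.
apply: Ck_ext (CkD Uo (CkM Uo zr wi) (CkM Uo zi wr)) => // x _.
by rewrite Im_mul.
Qed.

Lemma cCkV k z : (forall x, U x -> z x != 0) ->
  cCk k U z -> cCk k U (fun x => (z x)^-1).
Proof.
move=> z0 [zr zi].
have zn : Ck k U (fun x => (complex.Re (z x) * complex.Re (z x)
                         + complex.Im (z x) * complex.Im (z x))^-1 : R^o).
  apply: CkV => //; first by move=> x Ux; rewrite -!expr2 normsq_parts_neq0 ?z0.
  by apply: CkD => //; exact: CkM.
split.
  by apply: Ck_ext (CkM Uo zr zn) => // x _; rewrite Re_inv !expr2.
apply: Ck_ext (CkM Uo (CkN Uo zi) zn) => // x _.
by rewrite Im_inv !expr2.
Qed.

Lemma cCk_cst k (c : C) : cCk k U (fun=> c).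
Proof. by split; exact: Ck_cst. Qed.

Lemma cCk_sum k (I : Type) (r : seq I) (P : pred I) (z : I -> V -> C) :
  (forall i, P i -> cCk k U (z i)) ->
  cCk k U (fun x => \sum_(i <- r | P i) z i x).
Proof.
move=> zk; elim: r => [|i r IH].
  by apply: cCk_ext (cCk_cst k 0) => x _; rewrite big_nil.
case Pi : (P i); last by apply: cCk_ext IH => x _; rewrite big_cons Pi.
by apply: cCk_ext (cCkD (zk i Pi) IH) => x _; rewrite big_cons Pi.
Qed.

Lemma cCk_prod k (I : Type) (r : seq I) (P : pred I) (z : I -> V -> C) :
  (forall i, P i -> cCk k U (z i)) ->
  cCk k U (fun x => \prod_(i <- r | P i) z i x).
Proof.
move=> zk; elim: r => [|i r IH].
  by apply: cCk_ext (cCk_cst k 1) => x _; rewrite big_nil.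
case Pi : (P i); last by apply: cCk_ext IH => x _; rewrite big_cons Pi.
by apply: cCk_ext (cCkM (zk i Pi) IH) => x _; rewrite big_cons Pi.
Qed.

Lemma mCk_ext {p q} k (F G : V -> 'M[C]_(p, q)) :
  (forall x, U x -> F x = G x) -> mCk k U F -> mCk k U G.
Proof. by move=> FG Fk i j; apply: cCk_ext (Fk i j) => x Ux; rewrite FG. Qed.

Lemma mCkD {p q} k (F G : V -> 'M[C]_(p, q)) :
  mCk k U F -> mCk k U G -> mCk k U (fun x => F x + G x).
Proof.
by move=> Fk Gk i j; apply: cCk_ext (cCkD (Fk i j) (Gk i j)) => x _; rewrite mxE.
Qed.

Lemma mCkN {p q} k (F : V -> 'M[C]_(p, q)) :
  mCk k U F -> mCk k U (fun x => - F x).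
Proof. by move=> Fk i j; apply: cCk_ext (cCkN (Fk i j)) => x _; rewrite mxE. Qed.

Lemma mCkB {p q} k (F G : V -> 'M[C]_(p, q)) :
  mCk k U F -> mCk k U G -> mCk k U (fun x => F x - G x).
Proof. by move=> Fk Gk; apply: mCkD => //; exact: mCkN. Qed.

Lemma mCkM {p q r} k (F : V -> 'M[C]_(p, q)) (G : V -> 'M[C]_(q, r)) :
  mCk k U F -> mCk k U G -> mCk k U (fun x => F x *m G x).
Proof.
move=> Fk Gk i j.
apply: (@cCk_ext k (fun x => \sum_l F x i l * G x l j)).
  by move=> x _; rewrite mxE.
by apply: cCk_sum => l _; exact: cCkM.
Qed.

Lemma mCkZ {p q} k z (F : V -> 'M[C]_(p, q)) :
  cCk k U z -> mCk k U F -> mCk k U (fun x => z x *: F x).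
Proof.
by move=> zk Fk i j; apply: cCk_ext (cCkM zk (Fk i j)) => x _; rewrite mxE.
Qed.

Lemma mCkZc {p q} k (c : C) (F : V -> 'M[C]_(p, q)) :
  mCk k U F -> mCk k U (fun x => c *: F x).
Proof. by apply: mCkZ; exact: cCk_cst. Qed.

Lemma mCk_adj {p q} k (F : V -> 'M[C]_(p, q)) :
  mCk k U F -> mCk k U (fun x => (F x)^t*).
Proof.
by move=> Fk i j; apply: cCk_ext (cCk_conj (Fk j i)) => x _; rewrite !mxE.
Qed.

Lemma mCk_mxvec {p q} k (F : V -> 'M[C]_(p, q)) :
  mCk k U F -> mCk k U (fun x => mxvec (F x)).
Proof.
move=> Fk i j; case/mxvec_indexP: j => j l.
by apply: cCk_ext (Fk j l) => x _; rewrite ord1 mxvecE.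
Qed.

Lemma mCk_vec_mx {p q} k (F : V -> 'rV[C]_(p * q)) :
  mCk k U F -> mCk k U (fun x => vec_mx (F x)).
Proof. by move=> Fk i j; apply: cCk_ext (Fk 0 (mxvec_index i j)) => x _; rewrite mxE. Qed.

Lemma cCk_det {p} k (F : V -> 'M[C]_p) :
  mCk k U F -> cCk k U (fun x => \det (F x)).
Proof.
move=> Fk; apply: cCk_sum => s _; apply: cCkM; first exact: cCk_cst.
by apply: cCk_prod => i _; exact: Fk.
Qed.

Lemma mCkV {p} k (F : V -> 'M[C]_p) : (forall x, U x -> F x \in unitmx) ->
  mCk k U F -> mCk k U (fun x => invmx (F x)).
Proof.
move=> Fu Fk; apply: (@mCk_ext _ _ k (fun x => (\det (F x))^-1 *: \adj (F x))).
  by move=> x Ux; rewrite /invmx (Fu x Ux).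
apply: mCkZ.
  apply: cCkV; last exact: cCk_det.
  by move=> x Ux; have := Fu x Ux; rewrite unitmxE unitfE.
move=> i j.
apply: (@cCk_ext k (fun x => cofactor (F x) j i)); first by move=> x _; rewrite mxE.
apply: cCkM; first exact: cCk_cst.
apply: cCk_det => a b.
apply: (@cCk_ext k (fun x => F x (lift j a) (lift i b))); last exact: Fk.
by move=> x _; rewrite !mxE.
Qed.

Lemma mCk_sylv {p q} k (S : V -> 'M[C]_p) (T : V -> 'M[C]_q) :
  mCk k U S -> mCk k U T -> mCk k U (fun x => sylv (S x) (T x)).
Proof.
move=> Sk Tk; apply: mCkD => i j.
  apply: (@cCk_ext k (fun x => mxvec (S x *m vec_mx (delta_mx 0 i)) 0 j)).
    by move=> x _; rewrite mxE.
  by apply: mCk_mxvec; apply: mCkM => //; exact: mCk_cst.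
apply: (@cCk_ext k (fun x => mxvec (vec_mx (delta_mx 0 i) *m T x) 0 j)).
  by move=> x _; rewrite mxE.
by apply: mCk_mxvec; apply: mCkM => //; exact: mCk_cst.
Qed.

Lemma open_cneq0 z : cCk 0 U z -> open [set x | U x /\ z x != 0].
Proof.
move=> [zr zi].
have o1 (f : V -> R^o) : Ck 0 U f -> open [set x | U x /\ f x != 0].
  move=> fc; rewrite openE => x [Ux fx0].
  have nU : \forall y \near x, U y by exact: open_nbhs_nbhs.
  have nf : \forall y \near x, f y != 0.
    have := fc x Ux; move=> /(_ [set r : R^o | r != 0]); apply.
    by apply: open_nbhs_nbhs; split=> //; exact: open_neq.
  by rewrite /interior /=; near=> y; split; near: y.
have -> : [set x | U x /\ z x != 0] =
    [set x | U x /\ (complex.Re (z x) : R^o) != 0] `|`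
    [set x | U x /\ (complex.Im (z x) : R^o) != 0].
  apply/seteqP; split=> x /=.
    move=> [Ux zx0]; have [r0|r0] := eqVneq (complex.Re (z x)) 0; last by left.
    right; split=> //; apply: contra zx0 => /eqP i0; apply/eqP.
    exact: complex_eq.
  by case=> [[Ux r0]|[Ux i0]]; split=> //; [move: r0|move: i0];
    apply: contra => /eqP ->.
by apply: openU; exact: o1.
Unshelve. all: by end_near. Qed.

Lemma open_unitmx {p} (F : V -> 'M[C]_p) :
  mCk 0 U F -> open [set x | U x /\ F x \in unitmx].
Proof.
move=> F0; have := open_cneq0 (cCk_det F0).
suff -> : [set x | U x /\ F x \in unitmx] = [set x | U x /\ \det (F x) != 0] by [].
by apply/seteqP; split=> x /=; rewrite unitmxE unitfE.
Qed.

Lemma Ck_rc {p q} k (F : V -> 'M[C]_(p, q)) :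
  mCk k U F -> Ck k U (fun x => rc (F x)).
Proof.
move=> Fk; apply: Ck_ext (fun x _ => esym (rc_linear_sum (F x))) _ => //.
apply: Ck_sum => // i _; apply: Ck_sum => // j _.
by have [Fr Fi] := Fk i j; apply: CkD => //; exact: Ck_scaler.
Qed.

Lemma mCk_rc {p q} k (F : V -> 'M[C]_(p, q)) :
  Ck k U (fun x => rc (F x)) -> mCk k U F.
Proof.
move=> Fk i j; split.
  apply: Ck_ext (Ck_comp_linear Uo (coord_re_continuous (i := i) (j := j)) Fk) => //.
  by move=> x _; rewrite /= /coord_re mxE.
apply: Ck_ext (Ck_comp_linear Uo (coord_im_continuous (i := i) (j := j)) Fk) => //.
by move=> x _; rewrite /= /coord_im mxE.
Qed.

End Operations.
End ComplexSmooth.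

Section PointwiseDerivative.
Context {R : realType} {V : normedModType R}.
Local Notation C := R[i].
Implicit Types (z w : V -> C) (x v : V).

Lemma near_origin x (P : set V) :
  (\forall y \near x, P y) -> \forall h \near 0, P (h + x).
Proof. by rewrite (near_shift 0); apply: filterS => h /=; rewrite subr0. Qed.

(** The increment of [b] is O(h) and that of [a] is o(1), so replacing [a y] by [a x] costs only
    o(h), and the differential at [x] is [a x] times that of [b]. *)
Lemma differentiable_caratheodory (a b : V -> R^o) x :
  {for x, continuous a} -> differentiable b x ->
  differentiable (fun y => a y * (b y - b x) : R^o) x.
Proof.
move=> ac bd; have dbc := diff_continuous bd.
pose df := (a x \*: ('d b x)).
have dfc : continuous df by move=> y; apply: continuousZl_tmp; exact: dbc.
apply: (@differentiable_expansion _ _ _ _ df x dfc).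
have [K K0 Kb] := linear_lipschitz dbc.
have /eqaddoP bE := diff_locally bd.
apply/eqaddoP => e e0.
(* [K] bounds the differential of [b] and the extra 1 absorbs its remainder, so [(K + 1) |h|] bounds
   the increment of [b]. The error splits into an [a]-increment times a [b]-increment, and [a x]
   times the remainder of [b]; each is made at most [(e / 2) |h|]. The 1 added to [|a x|] keeps the
   divisor positive. *)
have K1 : 0 < K + 1 by rewrite addr_gt0.
have a1 : 0 < `|a x| + 1 by rewrite ltr_wpDl.
have near_a : \forall h \near 0, `|a x - a (h + x)| <= e / 2 / (K + 1).
  have e1 : 0 < e / 2 / (K + 1) by rewrite !divr_gt0.
  have := ac; rewrite /prop_for /continuous_at => /cvgrPdist_le /(_ _ e1).
  exact: near_origin.
have near_b := bE (e / 2 / (`|a x| + 1)) (divr_gt0 (divr_gt0 e0 (ltr0n _ 2)) a1).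
have near_b1 := bE 1 ltr01.
apply: filterS3 near_a near_b near_b1 => h ha hb hb1.
move: hb hb1; rewrite !fctE /= /df /= subrr mulr0 mul1r add0r.
set d := 'd b x h; set D := b (h + x).
rewrite opprD addrA => hb hb1.
have hD : `|D - b x| <= (K + 1) * `|h|.
  rewrite -[D - b x](subrK d) (le_trans (ler_normD _ _)) // mulrDl mul1r addrC.
  by apply: lerD hb1; exact: Kb.
have -> : a (h + x) * (D - b x) - a x *: d =
    (a (h + x) - a x) * (D - b x) + a x * (D - b x - d).
  by rewrite /GRing.scale /=; ring.
rewrite (le_trans (ler_normD _ _)) // !normrM [e]splitr mulrDl.
apply: lerD.
  apply: (@le_trans _ _ ((e / 2 / (K + 1)) * ((K + 1) * `|h|))).
    by apply: ler_pM => //; rewrite distrC.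
  by rewrite mulrA divfK ?gt_eqF.
apply: (@le_trans _ _ ((`|a x| + 1) * (e / 2 / (`|a x| + 1) * `|h|))).
  by apply: ler_pM => //; rewrite lerDl.
by rewrite mulrA [X in X * _]mulrC divfK ?gt_eqF.
Qed.

Definition ccont x z : Prop :=
  {for x, continuous (fun y => complex.Re (z y) : R^o)} /\
  {for x, continuous (fun y => complex.Im (z y) : R^o)}.

Definition cdiff x z : Prop :=
  differentiable (fun y => complex.Re (z y) : R^o) x /\
  differentiable (fun y => complex.Im (z y) : R^o) x.

Definition cder x v z (d : C) : Prop :=
  is_derive x v (fun y => complex.Re (z y) : R^o) (complex.Re d) /\
  is_derive x v (fun y => complex.Im (z y) : R^o) (complex.Im d).

Lemma cdiff_near x z w :
  (\forall y \near x, z y = w y) -> cdiff x z -> cdiff x w.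
Proof.
move=> zw [zr zi]; split; [move: zr|move: zi]; apply: near_eq_differentiable;
  by apply: filterS zw => y ->.
Qed.

Lemma cdiff_cst x (c : C) : cdiff x (fun=> c).
Proof. by split; exact: differentiable_cst. Qed.

Lemma cdiffD x z w : cdiff x z -> cdiff x w -> cdiff x (fun y => z y + w y).
Proof.
move=> [zr zi] [wr wi]; split.
  rewrite (_ : (fun y => _) = (fun y => complex.Re (z y) : R^o) +
    (fun y => complex.Re (w y) : R^o)); first exact: differentiableD.
  by apply/funext => y; rewrite Re_add.
rewrite (_ : (fun y => _) = (fun y => complex.Im (z y) : R^o) +
  (fun y => complex.Im (w y) : R^o)); first exact: differentiableD.
by apply/funext => y; rewrite Im_add.
Qed.

Lemma cdiff_sum x (I : Type) (r : seq I) (z : I -> V -> C) :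
  (forall i, cdiff x (z i)) -> cdiff x (fun y => \sum_(i <- r) z i y).
Proof.
move=> zd; elim: r => [|i r IH].
  rewrite (_ : (fun y => _) = fun=> 0); first exact: cdiff_cst.
  by apply/funext => y; rewrite big_nil.
rewrite (_ : (fun y => _) = fun y => z i y + \sum_(j <- r) z j y).
  exact: cdiffD.
by apply/funext => y; rewrite big_cons.
Qed.

Lemma cdiff_caratheodory x z w :
  ccont x z -> cdiff x w -> cdiff x (fun y => z y * (w y - w x)).
Proof.
move=> [zr zi] [wr wi]; split.
  rewrite (_ : (fun y => _) =
    (fun y => complex.Re (z y) * (complex.Re (w y) - complex.Re (w x)) : R^o) -
    (fun y => complex.Im (z y) * (complex.Im (w y) - complex.Im (w x)) : R^o)).
    by apply: differentiableB; exact: differentiable_caratheodory.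
  by apply/funext => y; rewrite Re_mul Re_add Im_add Re_opp Im_opp.
rewrite (_ : (fun y => _) =
  (fun y => complex.Re (z y) * (complex.Im (w y) - complex.Im (w x)) : R^o) +
  (fun y => complex.Im (z y) * (complex.Re (w y) - complex.Re (w x)) : R^o)).
  by apply: differentiableD; exact: differentiable_caratheodory.
by apply/funext => y; rewrite Im_mul Re_add Im_add Re_opp Im_opp.
Qed.

Lemma cder_uniq x v z (d e : C) : cder x v z d -> cder x v z e -> d = e.
Proof.
move=> [zr zi] [wr wi]; apply: complex_eq.
  by have := @derive_val _ _ _ _ _ _ _ zr; rewrite (@derive_val _ _ _ _ _ _ _ wr).
by have := @derive_val _ _ _ _ _ _ _ zi; rewrite (@derive_val _ _ _ _ _ _ _ wi).
Qed.

Lemma cder_near x v z w (d : C) :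
  (\forall y \near x, z y = w y) -> cder x v z d -> cder x v w d.
Proof.
move=> zw [zr zi]; split; [move: zr|move: zi]; apply: near_eq_is_derive;
  by apply: filterS zw => y ->.
Qed.

Lemma cder_cst x v (c : C) : cder x v (fun=> c) 0.
Proof. by split; exact: is_derive_cst. Qed.

Lemma cderD x v z w (d e : C) :
  cder x v z d -> cder x v w e -> cder x v (fun y => z y + w y) (d + e).
Proof.
move=> [zr zi] [wr wi]; split.
  rewrite Re_add (_ : (fun y => _) = (fun y => complex.Re (z y) : R^o) +
    (fun y => complex.Re (w y) : R^o)); first exact: is_deriveD.
  by apply/funext => y; rewrite Re_add.
rewrite Im_add (_ : (fun y => _) = (fun y => complex.Im (z y) : R^o) +
  (fun y => complex.Im (w y) : R^o)); first exact: is_deriveD.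
by apply/funext => y; rewrite Im_add.
Qed.

Lemma cder_conj x v z (d : C) :
  cder x v z d -> cder x v (fun y => Num.conj (z y)) (Num.conj d).
Proof.
move=> [zr zi]; split.
  rewrite Re_conj (_ : (fun y => _) = (fun y => complex.Re (z y) : R^o)) //.
  by apply/funext => y; rewrite Re_conj.
rewrite Im_conj (_ : (fun y => _) = - (fun y => complex.Im (z y) : R^o)).
  exact: is_deriveN.
by apply/funext => y; rewrite Im_conj.
Qed.

Lemma cderM x v z w (d e : C) :
  cder x v z d -> cder x v w e ->
  cder x v (fun y => z y * w y) (d * w x + z x * e).
Proof.
move=> [zr zi] [wr wi]; split.
  rewrite (_ : (fun y => _) =
    (fun y => complex.Re (z y) : R^o) * (fun y => complex.Re (w y) : R^o) -
    (fun y => complex.Im (z y) : R^o) * (fun y => complex.Im (w y) : R^o)).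
    apply: is_derive_eq (is_deriveB (is_deriveM zr wr) (is_deriveM zi wi)) _.
    by rewrite Re_add !Re_mul /GRing.scale /=; ring.
  by apply/funext => y; rewrite Re_mul.
rewrite (_ : (fun y => _) =
  (fun y => complex.Re (z y) : R^o) * (fun y => complex.Im (w y) : R^o) +
  (fun y => complex.Im (z y) : R^o) * (fun y => complex.Re (w y) : R^o)).
  apply: is_derive_eq (is_deriveD (is_deriveM zr wi) (is_deriveM zi wr)) _.
  by rewrite Im_add !Im_mul /GRing.scale /=; ring.
by apply/funext => y; rewrite Im_mul.
Qed.

Lemma cder_sum x v (I : Type) (r : seq I) (z : I -> V -> C) (d : I -> C) :
  (forall i, cder x v (z i) (d i)) ->
  cder x v (fun y => \sum_(i <- r) z i y) (\sum_(i <- r) d i).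
Proof.
move=> zd; elim: r => [|i r IH].
  rewrite big_nil (_ : (fun y => _) = fun=> 0); first exact: cder_cst.
  by apply/funext => y; rewrite big_nil.
rewrite big_cons (_ : (fun y => _) = fun y => z i y + \sum_(j <- r) z j y).
  exact: cderD.
by apply/funext => y; rewrite big_cons.
Qed.

(** Being a derivative is a relation here: velocities are identified by differentiating both sides
    of a matrix identity with the product rules and concluding with [mder_uniq]. *)
Definition mder {p q} x v (F : V -> 'M[C]_(p, q)) (D : 'M[C]_(p, q)) : Prop :=
  forall i j, cder x v (fun y => F y i j) (D i j).

Section Matrices.
Variables (x v : V).

Lemma mder_uniq {p q} (F : V -> 'M[C]_(p, q)) D E :
  mder x v F D -> mder x v F E -> D = E.
Proof. by move=> FD FE; apply/matrixP => i j; exact: cder_uniq (FD i j) (FE i j). Qed.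

Lemma mder_near {p q} (F G : V -> 'M[C]_(p, q)) D :
  (\forall y \near x, F y = G y) -> mder x v F D -> mder x v G D.
Proof.
by move=> FG FD i j; apply: cder_near (FD i j); apply: filterS FG => y ->.
Qed.

Lemma mder_cst {p q} (A : 'M[C]_(p, q)) : mder x v (fun=> A) 0.
Proof. by move=> i j; rewrite mxE; exact: cder_cst. Qed.

Lemma mderD {p q} (F G : V -> 'M[C]_(p, q)) D E :
  mder x v F D -> mder x v G E -> mder x v (fun y => F y + G y) (D + E).
Proof.
move=> FD GE i j; rewrite mxE (_ : (fun y => _) = fun y => F y i j + G y i j).
  exact: cderD.
by apply/funext => y; rewrite mxE.
Qed.

Lemma mderM {p q r} (F : V -> 'M[C]_(p, q)) (G : V -> 'M[C]_(q, r)) D E :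
  mder x v F D -> mder x v G E ->
  mder x v (fun y => F y *m G y) (D *m G x + F x *m E).
Proof.
move=> FD GE i j.
rewrite (_ : (fun y => _) = fun y => \sum_l F y i l * G y l j); last first.
  by apply/funext => y; rewrite mxE.
by rewrite !mxE -big_split /=; apply: cder_sum => l; exact: cderM.
Qed.

Lemma mderMl {p q r} (A : 'M[C]_(p, q)) (G : V -> 'M[C]_(q, r)) E :
  mder x v G E -> mder x v (fun y => A *m G y) (A *m E).
Proof. by move=> GE; have := mderM (mder_cst A) GE; rewrite mul0mx add0r. Qed.

Lemma mderMr {p q r} (F : V -> 'M[C]_(p, q)) (A : 'M[C]_(q, r)) D :
  mder x v F D -> mder x v (fun y => F y *m A) (D *m A).
Proof. by move=> FD; have := mderM FD (mder_cst A); rewrite mulmx0 addr0. Qed.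

Lemma mderZ {p q} (c : C) (F : V -> 'M[C]_(p, q)) D :
  mder x v F D -> mder x v (fun y => c *: F y) (c *: D).
Proof.
move=> FD i j; rewrite mxE (_ : (fun y => _) = fun y => c * F y i j).
  by have := cderM (cder_cst x v c) (FD i j); rewrite mul0r add0r.
by apply/funext => y; rewrite mxE.
Qed.

Lemma mderN {p q} (F : V -> 'M[C]_(p, q)) D :
  mder x v F D -> mder x v (fun y => - F y) (- D).
Proof.
move=> /(mderZ (-1)); rewrite scaleN1r.
by congr (mder _ _ _ _); apply/funext => y; rewrite scaleN1r.
Qed.

Lemma mderB {p q} (F G : V -> 'M[C]_(p, q)) D E :
  mder x v F D -> mder x v G E -> mder x v (fun y => F y - G y) (D - E).
Proof. by move=> FD GE; apply: mderD => //; exact: mderN. Qed.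

Lemma mder_adj {p q} (F : V -> 'M[C]_(p, q)) D :
  mder x v F D -> mder x v (fun y => (F y)^t*) (D^t*).
Proof.
move=> FD i j; rewrite !mxE (_ : (fun y => _) = fun y => Num.conj (F y j i)).
  exact: cder_conj.
by apply/funext => y; rewrite !mxE.
Qed.

End Matrices.

Lemma mCk1_mder {p q} (U : set V) (F : V -> 'M[C]_(p, q)) x v :
  mCk 1 U F -> U x -> exists D, mder x v F D.
Proof.
move=> F1 Ux.
exists (\matrix_(i, j) ('D_v (fun y => complex.Re (F y i j) : R^o) x
  +i* 'D_v (fun y => complex.Im (F y i j) : R^o) x)) => i j.
by have [[Fr _] [Fi _]] := F1 i j; rewrite mxE; split; apply: derivableP;
  apply: diff_derivable; [exact: Fr|exact: Fi].
Qed.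

End PointwiseDerivative.

(** * Smooth dependence of the square root on a positive definite matrix *)

Section SquareRoot.
Context {R : realType}.
Local Notation C := R[i].

(** Meant for [a = |E|^2], [b = <E, G>] and [c = |G|^2], where [a - b - (b - c)] is [|E - G|^2]. *)
Lemma amgm_le {F : numDomainType} (a b c : F) :
  a <= b -> 0 <= a - b - (b - c) -> a <= c.
Proof.
move=> ab abc; have ba : 0 <= b - a by rewrite subr_ge0.
rewrite -subr_ge0 (_ : c - a = (a - b - (b - c)) + (b - a) + (b - a)).
  by apply: addr_ge0 => //; apply: addr_ge0.
by ring.
Qed.

Lemma mxtrace_sqrB {F : numClosedFieldType} {p} (E G : 'M[F]_p) :
  \tr ((E - G)^t* *m (E - G)) = \tr (E^t* *m E) - \tr (E^t* *m G)
    - (\tr (G^t* *m E) - \tr (G^t* *m G)).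
Proof.
rewrite [(E - G)^T]linearB /= map_mxB mulmxBl !mulmxBr.
by rewrite !(raddfB (@mxtrace F p)).
Qed.

(* With [D = S' - S] one has [S' D + D S = S'^2 - S^2]; pairing with [D] bounds
   [tr (T D^dagger D T)], and the arithmetic-geometric inequality concludes. *)
Lemma sqrt_perturbation {p} (S S' T E G : 'M[C]_p) :
  psd S -> psd S' -> T^t* = T -> T \in unitmx -> T *m T = S ->
  E = (S' - S) *m T -> G = (S' *m S' - S *m S) *m invmx T ->
  \tr (E^t* *m E) <= \tr (G^t* *m G).
Proof.
move=> Sp S'p Th Tu TT.
set D := S' - S => EE GE0.
have [[Sh _] [S'h _]] := (Sp, S'p).
have Dh : D^t* = D by rewrite adjmxB S'h Sh.
have SD : S' *m D + D *m S = S' *m S' - S *m S.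
  by rewrite mulmxBr mulmxBl addrA subrK.
have EG : \tr (E^t* *m G) = \tr (D^t* *m S' *m D) + \tr (E^t* *m E).
  have -> : \tr (E^t* *m G) = \tr (D *m (S' *m S' - S *m S)).
    rewrite EE GE0 adjmxM Th Dh !mulmxA mxtrace_mulC !mulmxA.
    by rewrite (mulVmx Tu) mul1mx.
  rewrite -SD mulmxDr mxtraceD -{1}Dh mulmxA; congr (_ + _).
  rewrite EE adjmxM Th Dh -TT -[T *m D *m _]mulmxA [RHS]mxtrace_mulC.
  by rewrite -!mulmxA.
have tD := mxtrace_psd_ge0 D S'p.
have leEG : \tr (E^t* *m E) <= \tr (E^t* *m G) by rewrite EG lerDr.
have realEG : Num.conj (\tr (E^t* *m G)) = \tr (E^t* *m G).
  apply/CrealP; rewrite EG rpredD // ger0_real //; exact: trace_adjmul_ge0.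
have GE : \tr (G^t* *m E) = \tr (E^t* *m G).
  by rewrite -realEG -mxtrace_adj adjmxM trmxCK.
have := trace_adjmul_ge0 (E - G).
rewrite mxtrace_sqrB GE; exact: amgm_le leEG.
Qed.

Lemma Re_sqr_le_trace {p q} (E : 'M[C]_(p, q)) i j :
  complex.Re (E i j) ^+ 2 <= complex.Re (\tr (E^t* *m E)) /\
  complex.Im (E i j) ^+ 2 <= complex.Re (\tr (E^t* *m E)).
Proof.
have le1 : `|E i j| ^+ 2 <= \tr (E^t* *m E).
  rewrite trace_adjmul (bigD1 j) //= (bigD1 i) //= -addrA lerDl.
  apply: addr_ge0; first by apply: sumr_ge0 => *; exact: exprn_ge0.
  by apply: sumr_ge0 => *; apply: sumr_ge0 => *; exact: exprn_ge0.
have : complex.Re (`|E i j| ^+ 2) <= complex.Re (\tr (E^t* *m E)).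
  by move: le1; rewrite lecE => /andP[].
rewrite normCK; case: (E i j) => a b /=; rewrite mulrN opprK -!expr2 => le2.
by split; apply: le_trans le2; rewrite ?lerDl ?lerDr sqr_ge0.
Qed.

Section Family.
Context {V : normedModType R}.
Variables (U : set V) (Uo : open U).

Lemma continuous_sqr_bound (e g : V -> R^o) x :
  U x -> Ck 0 U g -> g x = 0 -> (forall y, U y -> e y ^+ 2 <= g y) ->
  {for x, continuous e}.
Proof.
move=> Ux gc gx eg.
have ex : e x = 0.
  apply/eqP; rewrite -sqrf_eq0 eq_le sqr_ge0 andbT -gx; exact: eg.
have nU : \forall y \near x, U y by exact: open_nbhs_nbhs.
rewrite /prop_for /continuous_at ex; apply/cvgrPdist_le => d d0.
have := gc x Ux; rewrite /prop_for /continuous_at gx => /cvgrPdist_le.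
move=> /(_ (d ^+ 2) (exprn_gt0 2 d0)); apply: filterS2 nU => y Uy.
rewrite !sub0r !normrN => gd.
have := le_trans (le_trans (eg y Uy) (ler_norm _)) gd.
by rewrite -[in X in X -> _](@real_normK _ (e y)) ?num_real // ler_pXn2r ?nnegrE // ltW.
Qed.

Lemma ccont_sum x (I : Type) (r : seq I) (z : I -> V -> C) :
  (forall i, ccont x (z i)) -> ccont x (fun y => \sum_(i <- r) z i y).
Proof.
move=> zc; elim: r => [|i r [IHr IHi]].
  rewrite (_ : (fun y => _) = fun=> 0); last by apply/funext => y; rewrite big_nil.
  by split; exact: cst_continuous.
rewrite (_ : (fun y => _) = fun y => z i y + \sum_(j <- r) z j y); last first.
  by apply/funext => y; rewrite big_cons.
have [zr zi] := zc i; split.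
  rewrite (_ : (fun y => _) = fun y => complex.Re (z i y) +
      complex.Re (\sum_(j <- r) z j y) : R^o); first exact: continuousD.
  by apply/funext => y; rewrite Re_add.
rewrite (_ : (fun y => _) = fun y => complex.Im (z i y) +
    complex.Im (\sum_(j <- r) z j y) : R^o); first exact: continuousD.
by apply/funext => y; rewrite Im_add.
Qed.

Lemma ccont_mulr x (z : V -> C) (c : C) :
  ccont x z -> ccont x (fun y => z y * c).
Proof.
move=> [zr zi]; split.
  rewrite (_ : (fun y => _) = (fun y => complex.Re (z y) * complex.Re c -
      complex.Im (z y) * complex.Im c : R^o)).
    by apply: continuousB; apply: continuousM => //; exact: cst_continuous.
  by apply/funext => y; rewrite Re_mul.
rewrite (_ : (fun y => _) = (fun y => complex.Re (z y) * complex.Im c +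
    complex.Im (z y) * complex.Re c : R^o)).
  by apply: continuousD; apply: continuousM => //; exact: cst_continuous.
by apply/funext => y; rewrite Im_mul.
Qed.

Lemma ccont_addl x (z : V -> C) (c : C) :
  ccont x z -> ccont x (fun y => c + z y).
Proof.
move=> [zr zi]; split.
  rewrite (_ : (fun y => _) = (fun y => complex.Re c + complex.Re (z y) : R^o)).
    by apply: continuousD => //; exact: cst_continuous.
  by apply/funext => y; rewrite Re_add.
rewrite (_ : (fun y => _) = (fun y => complex.Im c + complex.Im (z y) : R^o)).
  by apply: continuousD => //; exact: cst_continuous.
by apply/funext => y; rewrite Im_add.
Qed.

Context {p : nat}.
Variable f : V -> 'M[C]_p.
Hypothesis fpd : forall x, U x -> pd (f x).

Lemma sqrt_family x : U x -> pd (sqrtmx (f x)) /\ sqrtmx (f x) *m sqrtmx (f x) = f x.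
Proof. by move=> /fpd fx; split; [exact: pd_sqrt|case: fx => /sqrtmxP[]]. Qed.

(** With [T] the fourth root of [f x], [sqrt_perturbation] bounds [(S y - S x) T] by
    [(f y - f x) T^-1] in Hilbert-Schmidt norm, and the bound tends to 0 as [y] tends to [x]. *)
Lemma mCk_sqrt0 : mCk 0 U f -> mCk 0 U (fun x => sqrtmx (f x)).
Proof.
move=> fc.
suff cc x (Ux : U x) i j : ccont x (fun y => sqrtmx (f y) i j).
  by move=> i j; split=> x Ux; have [] := cc x Ux i j.
pose S y := sqrtmx (f y); have [Sx Sxx] := sqrt_family Ux.
pose T := sqrtmx (S x).
have [[Th _] Tu] : pd T by exact: pd_sqrt.
have TT : T *m T = S x by case: Sx => /sqrtmxP[].
pose E y := (S y - S x) *m T; pose G y := (f y - f x) *m invmx T.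
pose g y : R^o := complex.Re (\tr ((G y)^t* *m G y)).
have gc : Ck 0 U g.
  have Gc : mCk 0 U G.
    by apply: mCkM; [exact: Uo|apply: mCkB|]; try exact: mCk_cst.
  have /= [] := @cCk_sum _ _ U Uo 0 _ (index_enum 'I_p) xpredT
    (fun k y => ((G y)^t* *m G y) k k)
    (fun k _ => mCkM Uo (mCk_adj Uo Gc) Gc k k).
  by [].
have gx : g x = 0 by rewrite /g /G subrr mul0mx mulmx0 mxtrace0.
have EG y : U y -> \tr ((E y)^t* *m E y) <= \tr ((G y)^t* *m G y).
  move=> Uy; have [Sy Syy] := sqrt_family Uy.
  apply: (sqrt_perturbation Sx.1 Sy.1 Th Tu TT) => //.
  by rewrite Syy Sxx.
have Ec k l : ccont x (fun y => E y k l).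
  split; apply: (continuous_sqr_bound Ux gc gx) => y Uy;
  have [lr li] := Re_sqr_le_trace (E y) k l;
  by apply: le_trans; [exact: lr || exact: li|move: (EG y Uy); rewrite lecE => /andP[]].
rewrite (_ : (fun y => _) = fun y => S x i j + \sum_k E y i k * invmx T k j).
  by apply: ccont_addl; apply: ccont_sum => k; exact: ccont_mulr.
apply/funext => y; have -> : sqrtmx (f y) = S x + E y *m invmx T.
  by rewrite /E mulmxK // addrC subrK.
by rewrite !mxE.
Qed.

(* [S y - S x] solves a Sylvester equation with right-hand side [f y - f x] and
   coefficients continuous in [y], so that Caratheodory's criterion applies. *)
Lemma cdiff_sqrt x i j :
  mCk 1 U f -> U x -> cdiff x (fun y => sqrtmx (f y) i j).
Proof.
move=> f1 Ux; pose S y := sqrtmx (f y); have [Sx Sxx] := sqrt_family Ux.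
have nU : \forall y \near x, U y by exact: open_nbhs_nbhs.
have Sc : mCk 0 U S by apply: mCk_sqrt0; exact: mCkW.
pose A y := invmx (sylv (S y) (S x)).
have Ac : mCk 0 U A.
  apply: mCkV => //; last by apply: mCk_sylv => //; exact: mCk_cst.
  by move=> y Uy; apply: sylv_unit; [case: (sqrt_family Uy)|case: Sx].
pose F y := mxvec (f y).
have Fd k : cdiff x (fun y => F y 0 k).
  have F1 : mCk 1 U F by exact: mCk_mxvec.
  by have [[Fr _] [Fi _]] := F1 0 k; split; [exact: Fr|exact: Fi].
apply: (@cdiff_near _ _ x (fun y => S x i j +
    \sum_k A y k (mxvec_index i j) * (F y 0 k - F x 0 k))); last first.
  apply: cdiffD; first exact: cdiff_cst.
  apply: cdiff_sum => k; apply: cdiff_caratheodory => //.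
  by have [Ar Ai] := Ac k (mxvec_index i j); split; [exact: Ar|exact: Ai].
apply: filterS nU => y Uy; have [Sy Syy] := sqrt_family Uy.
have := sylvester_sol (S y - S x) Sy Sx.1.
rewrite (_ : S y *m _ + _ = f y - f x); last first.
  by rewrite mulmxBr mulmxBl Syy Sxx addrA subrK.
move=> /(congr1 (fun M : 'M[C]_p => M i j)); rewrite !mxE => SE.
rewrite -[RHS](subrK (S x i j)) SE addrC; congr (_ + _).
by apply: eq_bigr => k _; rewrite mulrC linearB !mxE.
Qed.

Lemma mCk_sqrt k : mCk k U f -> mCk k U (fun x => sqrtmx (f x)).
Proof.
elim: k => [|k IH]; first exact: mCk_sqrt0.
move=> fk; pose S y := sqrtmx (f y).
have Sk : mCk k U S by apply: IH; exact: mCkW.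
have f1 : mCk 1 U f.
  by elim: k fk {IH Sk} => // k IH /mCkW.
have Sd x i j : U x -> cdiff x (fun y => S y i j) by exact: cdiff_sqrt.
pose der v (F : V -> 'M[C]_p) y : 'M[C]_p :=
  \matrix_(i, j) ('D_v (fun y => complex.Re (F y i j) : R^o) y
  +i* 'D_v (fun y => complex.Im (F y i j) : R^o) y).
have derS v x : U x -> mder x v S (der v S x).
  move=> Ux i j; have [Sr Si] := Sd x i j Ux.
  by rewrite mxE; split; apply: derivableP; exact: diff_derivable.
have derf v x : U x -> mder x v f (der v f x).
  move=> Ux i j; have [[fr _] [fi _]] := f1 i j.
  by rewrite mxE; split; apply: derivableP; apply: diff_derivable; [exact: fr|exact: fi].
have derfk v : mCk k U (der v f).
  move=> i j; have [[_ fr] [_ fi]] := fk i j.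
  split; [move: (fr v)|move: (fi v)]; apply: Ck_ext => // x _; by rewrite mxE.
have derSE v x : U x ->
    vec_mx (mxvec (der v f x) *m invmx (sylv (S x) (S x))) = der v S x.
  move=> Ux; have [Sx _] := sqrt_family Ux.
  rewrite (sylvester_sol (der v S x) Sx Sx.1); congr (vec_mx (mxvec _ *m _)).
  apply: (mder_uniq (derf v x Ux)).
  have := mderM (derS v x Ux) (derS v x Ux); rewrite addrC.
  apply: mder_near; have : \forall y \near x, U y by exact: open_nbhs_nbhs.
  by apply: filterS => y Uy; case: (sqrt_family Uy).
(* The right-hand side [f'] and the coefficients [S] are both C^k, the latter by induction, hence so
   is the solution; this gains one order for [S]. *)
have derSk v : mCk k U (der v S).
  apply: (mCk_ext Uo (derSE v)); apply: mCk_vec_mx => //.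
  apply: mCkM => //; first exact: mCk_mxvec.
  apply: mCkV => //; last exact: mCk_sylv.
  by move=> x Ux; have [Sx _] := sqrt_family Ux; apply: sylv_unit => //; case: Sx.
move=> i j; split; split=> [x Ux|v].
- by case: (Sd x i j Ux).
- by have [dr _] := derSk v i j; apply: Ck_ext dr => // x _; rewrite mxE.
- by case: (Sd x i j Ux).
- by have [_ di] := derSk v i j; apply: Ck_ext di => // x _; rewrite mxE.
Qed.

End Family.
End SquareRoot.

(* [ring] up to matrix products: the products are generalized, which leaves an
   additive identity to check entrywise. *)
Ltac mx_atoms := repeat match goal with
  | |- context [@mulmx ?R ?m ?n ?p ?A ?B] => move: (@mulmx R m n p A B) => ?
  | |- context [@scalar_mx ?R ?n ?a] => move: (@scalar_mx R n a) => ?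
  end.
Ltac mx_ring := mx_atoms; apply/matrixP => ? ?; rewrite ?mxE; ring.

(** * Geometric means and Riccati equations *)

Section Images.
Context {R : realType}.
Local Notation C := R[i].

Lemma mem_mximg {p q} (A : 'M[C]_(p, q)) (y : 'cV[C]_p) :
  y \in mximg A <-> exists x, y = A *m x.
Proof.
split=> [/memv_imgP[x _ ->]|[x ->]]; first by exists x; rewrite lfunE.
by apply/memv_imgP; exists x; rewrite ?memvf // lfunE.
Qed.

Lemma mximg_factor {p q r} (A : 'M[C]_(p, q)) (B : 'M[C]_(p, r)) :
  (forall y, y \in mximg A -> y \in mximg B) -> exists K, A = B *m K.
Proof.
move=> AB.
have /choice[f fE] : forall j, exists x, col j A = B *m x.
  move=> j; apply/mem_mximg/AB/mem_mximg.
  by exists (delta_mx j 0); rewrite -colE.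
exists (\matrix_(i, j) f j i 0); apply/matrixP => i j.
have := congr1 (fun M : 'M[C]_(p, 1) => M i 0) (fE j); rewrite !mxE => ->.
by apply: eq_bigr => k _; rewrite mxE.
Qed.

Lemma mximg_mulr {p q r} (A : 'M[C]_(p, q)) (B : 'M[C]_(q, r)) L :
  B *m L = 1%:M -> mximg (A *m B) = mximg A.
Proof.
move=> BL; apply/vspaceP => y; apply/idP/idP => /mem_mximg[x ->].
  by apply/mem_mximg; exists (B *m x); rewrite mulmxA.
by apply/mem_mximg; exists (L *m x); rewrite mulmxA -[A *m B *m L]mulmxA BL mulmx1.
Qed.

Lemma dim_mximg {p q} (A : 'M[C]_(p, q)) L : L *m A = 1%:M -> \dim (mximg A) = q.
Proof.
move=> LA; rewrite limg_dim_eq ?dimvf /dim /= ?muln1 //.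
apply/eqP; rewrite -subv0; apply/subvP => x; rewrite memv_cap memvf /=.
rewrite memv_ker lfunE /= => /eqP Ax.
by rewrite memv0 -[x]mul1mx -LA -mulmxA Ax mulmx0.
Qed.

Lemma vspace_basis_mx {p q} (Pi : {vspace 'cV[C]_p}) : \dim Pi = q ->
  exists2 F : 'M[C]_(p, q), mximg F = Pi & exists L, L *m F = 1%:M.
Proof.
move=> dPi; subst q.
pose b := vbasis Pi; pose F : 'M[C]_(p, \dim Pi) := \matrix_(i, j) b`_j i 0.
have FE x : F *m x = \sum_j x j 0 *: b`_j.
  apply/colP => i; rewrite !mxE summxE; apply: eq_bigr => j _.
  by rewrite !mxE mulrC.
have Finj (x : 'cV[C]_(\dim Pi)) : F *m x = 0 -> x = 0.
  rewrite FE => Fx; apply/colP => j; rewrite mxE.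
  have /freeP := basis_free (vbasisP Pi); move=> /(_ (fun j => x j 0)); exact.
have FPi : mximg F = Pi.
  apply/vspaceP => y; apply/idP/idP => [/mem_mximg[x ->]|yPi].
    rewrite FE; apply: rpred_sum => j _; apply: rpredZ.
    by apply: vbasis_mem; apply: mem_nth; rewrite size_tuple.
  apply/mem_mximg; exists (\col_j coord b j y); rewrite FE.
  rewrite {1}(coord_vbasis yPi); apply: eq_bigr => j _.
  by rewrite mxE.
exists F => //.
have FFu : F^t* *m F \in unitmx.
  apply: mulmx_inj_unit => x FFx; apply: Finj; apply: adjmul_eq0.
  by rewrite adjmxM -mulmxA [F^t* *m _]mulmxA FFx mulmx0.
by exists (invmx (F^t* *m F) *m F^t*); rewrite -mulmxA mulVmx.
Qed.

End Images.

Section Means.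
Context {R : realType} {m : nat}.
Local Notation C := R[i].
Implicit Types A B G M : 'M[C]_m.

Lemma pd_mulmm A B : pd A -> pd B -> pd (A *m B *m A).
Proof. by move=> [[Ah _] Au] /(pd_conj Au); rewrite Ah. Qed.

(* The geometric mean of [A^-1] and [B], that is, the positive solution [M] of
   [M A M = B]. *)
Definition gmean A B : 'M[C]_m :=
  invmx (sqrtmx A) *m sqrtmx (sqrtmx A *m B *m sqrtmx A) *m invmx (sqrtmx A).

Lemma gmean_pd A B : pd A -> pd B -> pd (gmean A B).
Proof.
move=> /pd_sqrt Ap Bp; apply: pd_mulmm; first exact: pd_inv.
by apply: pd_sqrt; exact: pd_mulmm.
Qed.

Lemma gmeanP A B : pd A -> pd B -> gmean A B *m A *m gmean A B = B.
Proof.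
move=> Ap Bp; have [[ap au] [_ aa]] := (pd_sqrt Ap, sqrtmxP Ap.1).
have [_ cc] := sqrtmxP (pd_mulmm (pd_sqrt Ap) Bp).1.
rewrite /gmean -[X in _ *m X *m _]aa; move: cc au; clear.
move: (sqrtmx A) => a; move: (sqrtmx _) => c cc au.
rewrite !mulmxA (mulmxKV au) -[X in X *m c]mulmxA (mulmxV au) mulmx1.
rewrite -[_ *m c *m c]mulmxA cc !mulmxA (mulVmx au) mul1mx.
by rewrite -mulmxA (mulmxV au) mulmx1.
Qed.

(* Substituting [M = G^-1 + M'] turns [M G M = 2 M + B] into
   [M' G M' = B + G^-1]. *)
Definition riccati G B : 'M[C]_m := invmx G + gmean G (B + invmx G).

Lemma riccati_pd G B : pd G -> psd B -> pd (riccati G B).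
Proof.
move=> Gp Bp; have iGp := pd_inv Gp; rewrite /riccati.
apply: (pdD iGp); apply: (gmean_pd Gp _).1.
by rewrite addrC; exact: pdD.
Qed.

Lemma riccatiP G B : pd G -> psd B ->
  riccati G B *m G *m riccati G B = riccati G B *+ 2 + B.
Proof.
move=> Gp Bp; have iGp := pd_inv Gp.
have BGp : pd (B + invmx G) by rewrite addrC; exact: pdD.
have := gmeanP Gp BGp; rewrite /riccati; have Gu := Gp.2.
move: (gmean _ _) => M MGM.
rewrite (mulmxDl (invmx G)) (mulVmx Gu) mulmxDl mul1mx mulmxDr.
rewrite -[M *m G *m invmx G]mulmxA (mulmxV Gu) mulmx1 MGM.
by move: (invmx G) => iG; mx_ring.
Qed.

(* With [E = M - 1] and [g = sqrt M] the equation reads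
   [B (E g^-1) + (E g^-1) (g G g) = 0]. *)
Lemma riccati_uniq B M : psd B -> pd M ->
  M *m (2%:M + B) *m M = M *+ 2 + B -> M = 1%:M.
Proof.
move=> Bp Mp MGM; set G := 2%:M + B in MGM.
have Gp : pd G.
  rewrite /G -[_%:M]scalemx1; apply: pdD => //; split.
    by apply: psdZ; [exact: ler0n|exact: psd1].
  by rewrite scalemx1 unitmxE det_scalar unitrX // unitfE pnatr_eq0.
have [gp gu] := pd_sqrt Mp; have [_ gg] := sqrtmxP Mp.1.
set g := sqrtmx M in gp gu gg.
have gGg := pd_mulmm (conj gp gu) Gp.
apply/eqP; rewrite -subr_eq0; apply/eqP.
suff : (M - 1%:M) *m invmx g = 0.
  by move=> /(congr1 (mulmx^~ g)); rewrite mulmxKV // mul0mx.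
have : B *m ((M - 1%:M) *m invmx g) + (M - 1%:M) *m invmx g *m (g *m G *m g) = 0.
  rewrite !mulmxA mulmxKV // -[RHS](mul0mx _ (invmx g)).
  rewrite -[X in _ + X](mulmxK gu) -mulmxDl; congr (_ *m _).
  rewrite -[_ *m g *m g]mulmxA gg mulmxBr mulmx1 mulmxBl mul1mx mulmxBl MGM.
  rewrite /G mulmxDl mul_scalar_mx scaler_nat.
  by mx_ring.
move=> /(sylvester_eq0 Bp gGg.1)[_].
move=> /(congr1 (mulmx^~ (invmx (g *m G *m g)))).
by rewrite (mulmxK gGg.2) mul0mx.
Qed.

End Means.

(** * The level set and the two quotient maps *)

Section Scalars.
Context {F : numClosedFieldType}.

Lemma two_neq0 : (2 : F) != 0.
Proof. by rewrite pnatr_eq0. Qed.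

Lemma mulii : ('i : F) * 'i = -1.
Proof. by rewrite -expr2 sqrCi. Qed.

Lemma conj_half_i : Num.conj ('i / 2 : F) = - ('i / 2).
Proof. by rewrite rmorphM /= conjCi fmorphV /= conjC_nat mulNr. Qed.

Lemma half_i_neq0 : ('i / 2 : F) != 0.
Proof. by rewrite mulf_neq0 ?neq0Ci // invr_eq0 two_neq0. Qed.

Lemma sqr_half_i : ('i / 2 : F) * ('i / 2) = - (2^-1 * 2^-1).
Proof. by rewrite mulrACA mulii mulN1r. Qed.

End Scalars.

Section LevelSet.
Context {R : realType} {n m : nat}.
Local Notation C := R[i].
Implicit Types (q : @QP R n m).

Lemma pd_scalar2 : pd (2%:M : 'M[C]_m).
Proof.
split; last by rewrite unitmxE det_scalar unitrX // unitfE two_neq0.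
by rewrite -scalemx1; apply: psdZ; [exact: ler0n|exact: psd1].
Qed.

Lemma levelP q :
  level q <-> q.1^t* *m q.1 = 2%:M + q.2 *m q.2^t* /\ q.2 *m q.1 = 0.
Proof.
case: q => Q P; rewrite /level /= /mu1 /mu2 /mu3 /=; split.
  move=> [_ mu1E mu2E mu3E]; split.
    have := congr1 (fun X => (2 / 'i) *: X) mu1E.
    rewrite scalerA mulrA divfK ?neq0Ci // divff ?two_neq0 // scale1r.
    rewrite scale_scalar_mx divfK ?neq0Ci // => <-.
    by rewrite subrK.
  have := congr1 (fun X => 2 *: X) mu2E.
  rewrite scalerA divff ?two_neq0 // scale1r scaler0 => /eqP.
  rewrite subr_eq0 => /eqP PQ.
  have := congr1 (fun X => (2 * 'i) *: X) mu3E.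
  rewrite scalerA divff ?mulf_neq0 ?two_neq0 ?neq0Ci // scale1r scaler0 -PQ.
  rewrite -mulr2n -scaler_nat => /(congr1 (fun X => 2^-1 *: X)).
  by rewrite scalerA mulVf ?two_neq0 // scale1r scaler0.
move=> [QQ PQ]; rewrite PQ adjmx0 subrr addr0 !scaler0 QQ addrK.
split=> //; last by rewrite scale_scalar_mx divfK ?two_neq0.
(* The rank of [Q] is read off the invertible matrix [Q^dagger Q = 2 + P P^dagger]. *)
have Gp : pd (Q^t* *m Q).
  by rewrite QQ; apply: pdD; [exact: pd_scalar2|exact: psd_muladj].
apply/eqP; rewrite eqn_leq rank_leq_col /= -[X in (X <= _)%N](mxrank_unit Gp.2).
exact: mxrankM_maxr.
Qed.

Section AtLevel.
Variables (q : @QP R n m) (ql : level q).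
Local Notation Q := q.1.
Local Notation P := q.2.

Lemma level_QQ : Q^t* *m Q = 2%:M + P *m P^t*.
Proof. by case/levelP: ql. Qed.

Lemma level_PQ : P *m Q = 0.
Proof. by case/levelP: ql. Qed.

Lemma level_QP : Q^t* *m P^t* = 0.
Proof. by rewrite -adjmxM level_PQ adjmx0. Qed.

Lemma level_pd : pd (Q^t* *m Q).
Proof. by rewrite level_QQ; apply: pdD; [exact: pd_scalar2|exact: psd_muladj]. Qed.

Definition linv : 'M[C]_(m, n) := invmx (Q^t* *m Q) *m Q^t*.

Lemma linvK : linv *m Q = 1%:M.
Proof. by rewrite /linv -mulmxA (mulVmx level_pd.2). Qed.

End AtLevel.
End LevelSet.

Section BlockIdentities.
Context {F : fieldType} {n m : nat}.
Variables (Q Pd : 'M[F]_(n, m)) (Qd P : 'M[F]_(m, n)).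
Hypotheses (QQ : Qd *m Q = 2%:M + P *m Pd) (PQ : P *m Q = 0) (QP : Qd *m Pd = 0).

(** In this section [Qd] and [Pd] stand for the adjoints of [Q] and [P] but are independent letters:
    the level equations then act as rewriting rules and what is left is a ring identity, free of
    conjugations. *)
Lemma level_sum_diff : (Qd + P) *m (Q - Pd) = 2%:M.
Proof. by rewrite mulmxDl !mulmxBr QQ PQ QP; mx_ring. Qed.

Lemma level_norms : (Qd - P) *m (Q - Pd) = (Qd + P) *m (Q + Pd).
Proof. by rewrite mulmxBl mulmxDl !mulmxDr !mulmxN PQ QP; mx_ring. Qed.

(** At a point of the level set with image [xi] in the orbit, the four signed terms are twice
    [sqrt(xi^dagger xi)], [- sqrt(xi xi^dagger)], [- i xi] and [- i xi^dagger]. Together with the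
    prefactor 1/2 of eta, this cancels the 4. *)
Lemma eta_expansion :
  (Q + Pd) *m (Qd + P) - (Q - Pd) *m (Qd - P)
  + ((Q - Pd) *m (Qd + P) - (Q + Pd) *m (Qd - P)) = 4 *: (Q *m P).
Proof.
rewrite !mulmxDl !mulmxDr !mulNmx !mulmxN; mx_ring.
Qed.

End BlockIdentities.

Section Products.
Context {F : comPzRingType}.

Lemma mulmx_mid {a b c d e f} (A : 'M[F]_(a, b)) (B : 'M[F]_(b, c))
    (B' : 'M[F]_(b, f)) (D : 'M[F]_(c, d)) (D' : 'M[F]_(f, d)) (E : 'M[F]_(d, e)) :
  B *m D = B' *m D' -> A *m B *m (D *m E) = A *m B' *m (D' *m E).
Proof. by move=> BD; rewrite !mulmxA -[A *m B *m D]mulmxA BD mulmxA. Qed.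

Lemma scale_mulmx2 {a b c} (x y : F) (A : 'M[F]_(a, b)) (B : 'M[F]_(b, c)) :
  (x *: A) *m (y *: B) = (x * y) *: (A *m B).
Proof. by rewrite -scalemxAl -scalemxAr scalerA. Qed.

End Products.

Section Maps.
Context {R : realType} {n m : nat}.
Local Notation C := R[i].
Implicit Types (q : @QP R n m).

Lemma sqrt2_sqr : ((Num.sqrt 2)%:C * (Num.sqrt 2)%:C : C) = 2.
Proof. by rewrite -rmorphM /= -expr2 sqr_sqrtr ?ler0n // rmorph_nat. Qed.

Lemma toOrbE q :
  toOrb q = ('i / 2) *: ((q.1 - q.2^t*) *m (q.1^t* + q.2)).
Proof.
rewrite /toOrb -scalemxAl -scalemxAr scalerA; congr (_ *: _).
by rewrite mulrCA -invfM sqrt2_sqr.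
Qed.

Section AtLevel.
Variables (q : @QP R n m) (ql : level q).
Local Notation Q := q.1.
Local Notation P := q.2.

Lemma level_orb : Orb m 'i (toOrb q).
Proof.
have K := level_sum_diff (level_QQ ql) (level_PQ ql) (level_QP ql).
exists (('i / 2) *: (Q - P^t*)), (Q^t* + P); rewrite toOrbE scalemxAl; split=> //.
by rewrite -scalemxAr K scale_scalar_mx divfK ?two_neq0.
Qed.

Let DK : (Q^t* - P) *m (Q - P^t*) = (Q^t* + P) *m (Q + P^t*).
Proof. exact: level_norms (level_PQ ql) (level_QP ql). Qed.

Let adjD : (Q - P^t*)^t* = Q^t* - P.
Proof. by rewrite adjmxB trmxCK. Qed.

Let adjS : (Q^t* + P)^t* = Q + P^t*.
Proof. by rewrite adjmxD trmxCK. Qed.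

Lemma adj_toOrb :
  (toOrb q)^t* = - ('i / 2) *: ((Q + P^t*) *m (Q^t* - P)).
Proof. by rewrite toOrbE adjmxZ conj_half_i adjmxM adjS adjD. Qed.

Lemma half_ge0 : 0 <= (2^-1 : C).
Proof. by rewrite invr_ge0 ler0n. Qed.

Lemma sqrt_adjmul_toOrb :
  sqrtmx ((toOrb q)^t* *m toOrb q) = 2^-1 *: ((Q + P^t*) *m (Q^t* + P)).
Proof.
apply: sqrtmx_uniq.
  by apply: psdZ half_ge0 _; rewrite -adjS; exact: psd_adjmul.
rewrite adj_toOrb toOrbE !scale_mulmx2 mulNr sqr_half_i opprK.
by rewrite (mulmx_mid _ _ DK).
Qed.

Lemma sqrt_muladj_toOrb :
  sqrtmx (toOrb q *m (toOrb q)^t*) = 2^-1 *: ((Q - P^t*) *m (Q^t* - P)).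
Proof.
apply: sqrtmx_uniq.
  by apply: psdZ half_ge0 _; rewrite -adjD; exact: psd_muladj.
rewrite adj_toOrb toOrbE !scale_mulmx2 mulrN sqr_half_i opprK.
by rewrite (mulmx_mid _ _ (esym DK)).
Qed.

End AtLevel.

Definition Phi_map (xi : 'M[C]_n) : @cotpoint R n :=
  (mximg (xi + sqrtmx (xi^t* *m xi) *m xi),
   2^-1 *: (sqrtmx (xi^t* *m xi) - sqrtmx (xi *m xi^t*)
            - 'i *: xi - 'i *: xi^t*)).

Lemma Phi_toOrb q : level q -> Phi_map (toOrb q) = toCot q.
Proof.
move=> ql; rewrite /Phi_map /toCot sqrt_adjmul_toOrb // sqrt_muladj_toOrb //.
have K := level_sum_diff (level_QQ ql) (level_PQ ql) (level_QP ql).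
congr (_, _).
  (* By [E D = 2], the factor [i E] has the right inverse [(2 i)^-1 D]; multiplying [Q] by it on the
     right leaves the image unchanged. *)
  rewrite -(@mximg_mulr _ _ _ _ q.1 ('i *: (q.1^t* + q.2))
    ((2^-1 / 'i) *: (q.1 - q.2^t*))); last first.
    rewrite -scalemxAl -scalemxAr K scalerA scale_scalar_mx.
    by rewrite mulrCA divff ?neq0Ci // mulr1 mulVf ?two_neq0.
  congr mximg; rewrite toOrbE -scalemxAl -scalemxAr !mulmxA.
  rewrite -[X in _ + _ *: (_ *: (X *m _))]mulmxA K mul_mx_scalar.
  rewrite -!scalemxAl !scalerA -scalemxAr.
  rewrite [2^-1 * _]mulrC divfK ?two_neq0 // -scalerDr -mulmxDl.
  have -> : q.1 - q.2^t* + (q.1 + q.2^t*) = 2 *: q.1.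
    by rewrite addrACA addNr addr0 scaler_nat mulr2n.
  rewrite -scalemxAl scalerA.
  by rewrite divfK ?two_neq0.
rewrite adj_toOrb toOrbE !scalerA mulrN mulrA mulii mulN1r scaleNr opprK.
rewrite scaleNr scaleNr !opprK.
rewrite -!addrA -scalerBr addrA -scalerBr -scalerDr scalerA.
rewrite eta_expansion scalerA -[RHS]scale1r; congr (_ *: _).
by rewrite -invfM -natrM mulVf // pnatr_eq0.
Qed.

Lemma toCot_CotGr q : level q -> CotGr m (toCot q).
Proof.
move=> ql; split=> /=.
- exact: dim_mximg (linvK ql).
- move=> y /mem_mximg[x ->].
  by rewrite -mulmxA [q.2 *m _]mulmxA level_PQ // mul0mx mulmx0.
- by move=> y; apply/mem_mximg; exists (q.2 *m y); rewrite mulmxA.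
Qed.

End Maps.

(** * Moving a pair to the level set *)

Section BalancingIdentities.
Context {F : fieldType} {n m : nat}.

(** Conjugation by [g^-1] of the Riccati equation [M G M = 2 M + B], where [M = g g]. For
    [G = F^dagger F] and [B = H H^dagger] the result is the momentum equation of the pair
    [(F g, g^-1 H)]. *)
Lemma balance_unit (g G B : 'M[F]_m) : g \in unitmx ->
  g *m g *m G *m (g *m g) = (g *m g) *+ 2 + B ->
  g *m G *m g = 2%:M + invmx g *m B *m invmx g.
Proof.
move=> gu; have : g *m G *m g = invmx g *m (g *m g *m G *m (g *m g)) *m invmx g.
  by rewrite !mulmxA (mulVmx gu) mul1mx (mulmxK gu).
move=> -> ->; rewrite mulmxDr mulmxDl; congr (_ + _).
rewrite -scaler_nat -scalemxAr -scalemxAl mulmxA (mulVmx gu) mul1mx (mulmxV gu).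
by rewrite scalemx1.
Qed.

Lemma mean_unit (g A B : 'M[F]_m) : g \in unitmx ->
  g *m g *m A *m (g *m g) = B -> g *m A *m g = invmx g *m B *m invmx g.
Proof.
by move=> gu <-; rewrite !mulmxA (mulVmx gu) mul1mx (mulmxK gu).
Qed.

Section Frames.
Variables (U Wd : 'M[F]_(n, m)) (Ud W : 'M[F]_(m, n)) (g ig : 'M[F]_m) (s : F).
Hypotheses (gig : g *m ig = 1%:M) (igg : ig *m g = 1%:M).
Hypotheses (WU : W *m U = 1%:M) (UW : Ud *m Wd = 1%:M).
Hypothesis gUg : g *m (Ud *m U) *m g = ig *m (W *m Wd) *m ig.
Hypotheses (s2 : s * s = 2^-1) (neq2 : (2 : F) != 0).

Let gUWg : g *m Ud *m (Wd *m ig) = 1%:M.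
Proof. by rewrite mulmxA -[g *m Ud *m Wd]mulmxA UW mulmx1. Qed.

Let gWUg : ig *m W *m (U *m g) = 1%:M.
Proof. by rewrite mulmxA -[ig *m W *m U]mulmxA WU mulmx1. Qed.

Let gUUg : g *m Ud *m (U *m g) = ig *m W *m (Wd *m ig).
Proof. by move: gUg; rewrite !mulmxA. Qed.

(** The Hermitian squares agree on both sides; the cross products are all 1 and occur with opposite
    signs on the two sides, which leaves [4 s^2 = 2]. *)
Lemma frame_level_QQ :
  (s *: (g *m Ud + ig *m W)) *m (s *: (U *m g + Wd *m ig)) =
  2%:M + (s *: (ig *m W - g *m Ud)) *m (s *: (Wd *m ig - U *m g)).
Proof.
rewrite !scale_mulmx2 s2 !mulmxDl !mulmxDr !mulNmx !mulmxN gUWg gWUg gUUg.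
rewrite -[2%:M]scalemx1; mx_atoms.
by apply/matrixP => i j; rewrite !mxE; field.
Qed.

(** The two cross products, both 1, cancel each other; the two squares cancel by the balancing
    condition [gUg]. *)
Lemma frame_level_PQ :
  (s *: (ig *m W - g *m Ud)) *m (s *: (U *m g + Wd *m ig)) = 0.
Proof.
rewrite scale_mulmx2 mulmxBl !mulmxDr gUWg gWUg gUUg; mx_ring.
Qed.

Lemma frame_prod :
  (s *: (U *m g + Wd *m ig) - s *: (Wd *m ig - U *m g)) *m
  (s *: (g *m Ud + ig *m W) + s *: (ig *m W - g *m Ud)) = 2 *: (U *m W).
Proof.
have -> : s *: (U *m g + Wd *m ig) - s *: (Wd *m ig - U *m g) =
  (2 * s) *: (U *m g) by mx_ring.
have -> : s *: (g *m Ud + ig *m W) + s *: (ig *m W - g *m Ud) =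
  (2 * s) *: (ig *m W) by mx_ring.
rewrite scale_mulmx2 mulmxA -[U *m g *m ig]mulmxA gig mulmx1; congr (_ *: _).
by rewrite mulrACA s2 mulfK.
Qed.

End Frames.
End BalancingIdentities.

Section Balancing.
Context {R : realType} {n m : nat}.
Local Notation C := R[i].
Implicit Types (q : @QP R n m) (F U : 'M[C]_(n, m)) (H W : 'M[C]_(m, n)).

Lemma sqrtmx1 p : sqrtmx (1%:M : 'M[C]_p) = 1%:M.
Proof. by apply: sqrtmx_uniq; [exact: psd1|rewrite mulmx1]. Qed.

Definition bal_factor F H : 'M[C]_m :=
  sqrtmx (riccati (F^t* *m F) (H *m H^t*)).

(** A point of the GL(m)-orbit of [(F, H)]: the image of [F] and the product [F H] are kept, and [g]
    is chosen so that the momentum equation holds. *)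
Definition bal F H : @QP R n m :=
  (F *m bal_factor F H, invmx (bal_factor F H) *m H).

Lemma bal_factorP F H : F^t* *m F \in unitmx ->
  [/\ pd (bal_factor F H),
      bal_factor F H *m bal_factor F H = riccati (F^t* *m F) (H *m H^t*)
    & bal_factor F H *m (F^t* *m F) *m bal_factor F H =
      2%:M + invmx (bal_factor F H) *m (H *m H^t*) *m invmx (bal_factor F H)].
Proof.
move=> Fu.
have Gp : pd (F^t* *m F) by split=> //; exact: psd_adjmul.
have Bp := psd_muladj H.
have Mp := riccati_pd Gp Bp; have := riccatiP Gp Bp.
have gp := pd_sqrt Mp; have [_ gg] := sqrtmxP Mp.1.
rewrite -/(bal_factor F H) in gp gg *; rewrite -gg.
by move=> MGM; split; [exact: gp|exact: erefl|exact: balance_unit gp.2 MGM].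
Qed.

Lemma bal_level F H :
  F^t* *m F \in unitmx -> H *m F = 0 -> level (bal F H).
Proof.
move=> Fu HF; have [[[gh _] gu] _ gE] := bal_factorP H Fu.
apply/levelP; rewrite /bal /=; split.
  by rewrite !adjmxM adjmxV gh !mulmxA in gE *; rewrite gE.
by rewrite mulmxA -[_ *m H *m F]mulmxA HF mulmx0 mul0mx.
Qed.

Lemma bal_toCot F H :
  F^t* *m F \in unitmx -> toCot (bal F H) = (mximg F, F *m H).
Proof.
move=> Fu; have [[_ gu] _ _] := bal_factorP H Fu.
rewrite /toCot /bal /= (mximg_mulr F (mulmxV gu)); congr (_, _).
by rewrite !mulmxA (mulmxK gu).
Qed.

(** On the level set [G = 2 + B], and then 1 is the only positive definite solution; hence [bal]
    fixes the level set pointwise. *)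
Lemma riccati_level q : level q ->
  riccati (q.1^t* *m q.1) (q.2 *m q.2^t*) = 1%:M.
Proof.
move=> ql; have Gp := level_pd ql; have Bp := psd_muladj q.2.
apply: (riccati_uniq Bp (riccati_pd Gp Bp)).
by have := riccatiP Gp Bp; rewrite {2}(level_QQ ql).
Qed.

Lemma bal_factor_level q : level q -> bal_factor q.1 q.2 = 1%:M.
Proof. by move=> ql; rewrite /bal_factor riccati_level // sqrtmx1. Qed.

Lemma bal_id q : level q -> bal q.1 q.2 = q.
Proof.
move=> ql; rewrite /bal bal_factor_level // mulmx1 invmx1 mul1mx.
by case: q {ql}.
Qed.

(* For [W U = 1], the pair [(U g, g^-1 W)] comes from the level set if and only if
   [g U^dagger U g = g^-1 W W^dagger g^-1]. *)
Definition orb_factor U W : 'M[C]_m := sqrtmx (gmean (U^t* *m U) (W *m W^t*)).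

(** The solution of [Q - P^dagger = sqrt 2 U g] and [Q^dagger + P = sqrt 2 g^-1 W], with [g]
    self-adjoint: the product of the two right-hand sides is [2 U W], whatever [g] is. *)
Definition orb_level U W : @QP R n m :=
  let g := orb_factor U W in let s : C := (Num.sqrt 2)%:C in
  (s^-1 *: (U *m g + W^t* *m invmx g), s^-1 *: (invmx g *m W - g *m U^t*)).

Lemma pd_WU U W : W *m U = 1%:M -> pd (U^t* *m U) /\ pd (W *m W^t*).
Proof.
move=> WU; split; first exact: pd_adjmul WU.
rewrite -{1}[W]trmxCK; apply: (@pd_adjmul _ _ _ (W^t*) (U^t*)).
by rewrite -adjmxM WU adjmx1.
Qed.

Lemma conj_sqrt2V : Num.conj ((Num.sqrt 2)%:C^-1 : C) = (Num.sqrt 2)%:C^-1.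
Proof.
apply/CrealP; apply: ger0_real; rewrite invr_ge0.
by rewrite lecR sqrtr_ge0.
Qed.

Lemma sqrt2V_sqr : (Num.sqrt 2)%:C^-1 * (Num.sqrt 2)%:C^-1 = 2^-1 :> C.
Proof. by rewrite -invfM sqrt2_sqr. Qed.

Lemma orb_levelP U W : W *m U = 1%:M ->
  level (orb_level U W) /\ toOrb (orb_level U W) = 'i *: (U *m W).
Proof.
move=> WU; have [Ap Bp] := pd_WU WU.
have Mp := gmean_pd Ap Bp; have MAM := gmeanP Ap Bp.
have [[gh _] gu] := pd_sqrt Mp; have [_ gg] := sqrtmxP Mp.1.
rewrite -gg in MAM; have gAg := mean_unit gu MAM.
have UW : U^t* *m W^t* = 1%:M by rewrite -adjmxM WU adjmx1.
rewrite /orb_level -/(orb_factor U W) in gh gu gAg *.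
move: (orb_factor U W) gh gu gAg {MAM gg Mp} => g gh gu gAg.
have q1h : ((Num.sqrt 2)%:C^-1 *: (U *m g + W^t* *m invmx g))^t* =
    (Num.sqrt 2)%:C^-1 *: (g *m U^t* + invmx g *m W).
  by rewrite adjmxZ conj_sqrt2V adjmxD !adjmxM trmxCK adjmxV gh.
have q2h : ((Num.sqrt 2)%:C^-1 *: (invmx g *m W - g *m U^t*))^t* =
    (Num.sqrt 2)%:C^-1 *: (W^t* *m invmx g - U *m g).
  by rewrite adjmxZ conj_sqrt2V adjmxB !adjmxM trmxCK adjmxV gh.
have gig := mulmxV gu; have igg := mulVmx gu.
split.
  apply/levelP; rewrite /= q1h q2h; split.
    exact: (frame_level_QQ gig igg WU UW gAg sqrt2V_sqr two_neq0).
  exact: (frame_level_PQ _ gig igg WU UW gAg).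
rewrite toOrbE /= q1h q2h (frame_prod _ _ _ _ gig sqrt2V_sqr two_neq0).
by rewrite scalerA divfK ?two_neq0.
Qed.

End Balancing.

(** * Cotangent charts and the sections of the level set above them *)

Section Charts.
Context {R : realType} {n m : nat}.
Local Notation C := R[i].
Implicit Types (q : @QP R n m) (phi : frame R n m) (e : @chartspace R n m).

Lemma frame_blocks phi :
  [/\ fa' phi *m fa phi = 1%:M, fa' phi *m fb phi = 0,
      fb' phi *m fa phi = 0, fb' phi *m fb phi = 1%:M
    & fa phi *m fa' phi + fb phi *m fb' phi = 1%:M].
Proof.
have := frameK phi; rewrite mul_col_row scalar_mx_block => /eq_block_mx[-> -> -> ->].
by have := frameVK phi; rewrite mul_row_col => ->.
Qed.

Definition chart_emb phi (Z : 'M[C]_(n - m, m)) : 'M[C]_(n, m) :=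
  fa phi + fb phi *m Z.

Definition chart_ker phi (Z : 'M[C]_(n - m, m)) : 'M[C]_(n - m, n) :=
  fb' phi - Z *m fa' phi.

(** The blocks [fa'] and [chart_ker] form the dual basis of [chart_emb] and [fb], so the two terms
    of the last identity are the projectors of the splitting of C^n into Pi and the image of
    [fb]. *)
Lemma chart_embP phi Z :
  [/\ fa' phi *m chart_emb phi Z = 1%:M, fb' phi *m chart_emb phi Z = Z,
      chart_ker phi Z *m chart_emb phi Z = 0,
      chart_ker phi Z *m fb phi = 1%:M
    & chart_emb phi Z *m fa' phi + fb phi *m chart_ker phi Z = 1%:M].
Proof.
have [aa ab ba bb abV] := frame_blocks phi; rewrite /chart_emb /chart_ker.
have a1 : fa' phi *m (fa phi + fb phi *m Z) = 1%:M.
  by rewrite mulmxDr mulmxA aa ab mul0mx addr0.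
have b1 : fb' phi *m (fa phi + fb phi *m Z) = Z.
  by rewrite mulmxDr mulmxA ba bb mul1mx add0r.
split=> //.
- by rewrite mulmxBl b1 -mulmxA a1 mulmx1 subrr.
- by rewrite mulmxBl bb -mulmxA ab mulmx0 subr0.
- by rewrite mulmxDl mulmxBr !mulmxA addrA addrAC addrK.
Qed.

(* Inverse of the chart [par phi]: [coord phi q] parametrizes [toCot q]. *)
Definition coord phi q : @chartspace R n m :=
  (fb' phi *m q.1 *m invmx (fa' phi *m q.1), fa' phi *m (q.1 *m q.2) *m fb phi).

Lemma chart_emb_coord phi q : fa' phi *m q.1 \in unitmx ->
  chart_emb phi (coord phi q).1 *m (fa' phi *m q.1) = q.1.
Proof.
move=> ku; have [_ _ _ _ abV] := frame_blocks phi.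
rewrite /chart_emb mulmxDl /= -[fb phi *m _ *m _]mulmxA (mulmxKV ku).
by rewrite !mulmxA -mulmxDl abV mul1mx.
Qed.

Lemma par_coord phi q : q.2 *m q.1 = 0 -> fa' phi *m q.1 \in unitmx ->
  par phi (coord phi q) = toCot q.
Proof.
move=> PQ ku; have Q1 := chart_emb_coord ku.
set Z := (coord phi q).1 in Q1.
have [aF bF KF Kb FK] := chart_embP phi Z.
rewrite /par /toCot -/Z -/(chart_emb phi Z) -/(chart_ker phi Z); congr (_, _).
  by rewrite -[in RHS]Q1 (mximg_mulr _ (mulmxV ku)).
have FQ : chart_emb phi Z *m fa' phi *m q.1 = q.1 by rewrite -mulmxA.
rewrite [(coord phi q).2]/= !mulmxA FQ -[_ *m chart_ker phi Z]mulmxA.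
rewrite -[_ *m (fb phi *m chart_ker phi Z)]mulmxA.
have QF : q.2 *m chart_emb phi Z = 0.
  by rewrite -[chart_emb phi Z](mulmxK ku) Q1 mulmxA PQ mul0mx.
have -> : fb phi *m chart_ker phi Z = 1%:M - chart_emb phi Z *m fa' phi.
  by rewrite -FK addrC addKr.
by rewrite mulmxBr mulmx1 mulmxA QF mul0mx subr0.
Qed.

Lemma coord_par phi q e : (exists L, L *m q.1 = 1%:M) ->
  toCot q = par phi e -> fa' phi *m q.1 \in unitmx /\ coord phi q = e.
Proof.
move=> [L LQ] [qe1 qe2].
have [aF bF KF Kb FK] := chart_embP phi e.1.
rewrite -/(chart_emb phi e.1) in qe1 qe2.
have [k Qk] : exists k, q.1 = chart_emb phi e.1 *m k.
  by apply: mximg_factor => y; rewrite qe1.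
have ak : fa' phi *m q.1 = k by rewrite Qk mulmxA aF mul1mx.
have ku : k \in unitmx.
  by apply: (@mulmx1_unit _ _ (L *m chart_emb phi e.1) k _).2; rewrite -mulmxA -Qk.
rewrite ak; split=> //; rewrite /coord ak qe2.
rewrite Qk !mulmxA bF (mulmxK ku) aF mul1mx -mulmxA.
rewrite -/(chart_ker phi e.1) Kb mulmx1; by case: e {qe1 qe2 aF bF KF Kb FK Qk}.
Qed.

(** A section of [toCot] over the whole chart with values in the level set. Being explicit it is
    smooth; it serves both to lift curves and to write the inverse of the diffeomorphism. *)
Definition parq phi e : @QP R n m :=
  bal (chart_emb phi e.1) (e.2 *m chart_ker phi e.1).

Lemma chart_emb_unit phi Z : (chart_emb phi Z)^t* *m chart_emb phi Z \in unitmx.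
Proof. by have [aF _ _ _ _] := chart_embP phi Z; case: (pd_adjmul aF). Qed.

Lemma parq_level phi e : level (parq phi e).
Proof.
apply: bal_level; first exact: chart_emb_unit.
by have [_ _ KF _ _] := chart_embP phi e.1; rewrite -mulmxA KF mulmx0.
Qed.

Lemma parq_toCot phi e : toCot (parq phi e) = par phi e.
Proof. by rewrite bal_toCot ?chart_emb_unit // mulmxA. Qed.

Lemma CotGr_lift x : CotGr m x -> exists2 q : @QP R n m, level q & toCot q = x.
Proof.
case: x => Pi eta [/= dPi etaPi imeta].
have [F FPi [L LF]] := vspace_basis_mx dPi.
have Fu : F^t* *m F \in unitmx by case: (pd_adjmul LF).
have FL y : y \in Pi -> F *m L *m y = y.
  rewrite -FPi => /mem_mximg[x ->].
  by rewrite -mulmxA [L *m _]mulmxA LF mul1mx.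
have colext r (A B : 'M[C]_(n, r)) : (forall y : 'cV_r, A *m y = B *m y) -> A = B.
  move=> AB; apply/matrixP => i j.
  have := AB (delta_mx j 0); rewrite -!colE => /colP /(_ i).
  by rewrite !mxE.
have Feta : F *m (L *m eta) = eta.
  by apply: colext => y; rewrite mulmxA -mulmxA FL.
have etaF : eta *m F = 0.
  apply: colext => y; rewrite mul0mx -mulmxA; apply: etaPi.
  by rewrite -FPi; apply/mem_mximg; exists y.
exists (bal F (L *m eta)); first by apply: bal_level; rewrite // -mulmxA etaF mulmx0.
by rewrite bal_toCot // FPi Feta.
Qed.

(** A [frame] asks for both products of its blocks to be 1, but the stacked blocks have size
    [m + (n - m)], which equals [n] only propositionally. *)
Lemma mulmx1C_cast p (A : 'M[C]_(p, n)) (B : 'M[C]_(n, p)) :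
  p = n -> A *m B = 1%:M -> B *m A = 1%:M.
Proof. by move=> pn; subst p; exact: mulmx1C. Qed.

(** The frame consists of [Q] and a basis of the orthogonal complement of its image: the rows of [B]
    span the left kernel of [Q], so the columns of [B^dagger] are orthogonal to the image. The dual
    block [linv q] then satisfies [fa' Q = 1]. *)
Lemma frame_ex q : level q -> exists phi : frame R n m, fa' phi *m q.1 \in unitmx.
Proof.
move=> ql.
have rQ : \rank q.1 = m by case: ql.
have le_mn : (m <= n)%N by rewrite -rQ rank_leq_row.
have rK : \rank (kermx q.1) = (n - m)%N by rewrite mxrank_ker rQ.
have [B Bfree BQ] : exists2 B : 'M[C]_(n - m, n), row_free B & B *m q.1 = 0.
  rewrite -rK; exists (row_base (kermx q.1)); first exact: row_base_free.
  by apply/sub_kermxP; rewrite eq_row_base.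
have BBu : B *m B^t* \in unitmx.
  have [L BL] := row_freeP Bfree.
  have : (L^t*) *m B^t* = 1%:M by rewrite -adjmxM BL adjmx1.
  by move=> /pd_adjmul[_]; rewrite trmxCK.
pose b := B^t* *m invmx (B *m B^t*).
have K : col_mx (linv q) B *m row_mx q.1 b = 1%:M.
  rewrite mul_col_row scalar_mx_block; congr block_mx.
  - exact: linvK.
  - by rewrite /linv /b mulmxA -[_ *m q.1^t* *m _]mulmxA -adjmxM BQ adjmx0 mulmx0 mul0mx.
  - exact: BQ.
  - by rewrite /b mulmxA mulmxV.
exists (Frame K (mulmx1C_cast (subnKC le_mn) K)) => /=.
by rewrite linvK // unitmx1.
Qed.

End Charts.

Lemma congruence_identity {F : fieldType} {n m : nat} (k ka : 'M[F]_m)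
    (Q Pa : 'M[F]_(n, m)) (Qa P : 'M[F]_(m, n)) :
  k \in unitmx -> ka \in unitmx ->
  ka *m Qa *m (Q *m k) = 2%:M + invmx k *m P *m (Pa *m invmx ka) ->
  k *m ka *m (Qa *m Q) *m (k *m ka) = (k *m ka) *+ 2 + P *m Pa.
Proof.
move=> ku kau /(congr1 (fun M => k *m M *m ka)).
rewrite mulmxDr mulmxDl mul_mx_scalar -scalemxAl scaler_nat !mulmxA => ->.
by congr (_ + _); rewrite (mulmxV ku) mul1mx (mulmxKV kau).
Qed.

(** * Fibres of the quotient maps and bijectivity *)

Section Fibers.
Context {R : realType} {n m : nat}.
Local Notation C := R[i].
Implicit Types (q A B : @QP R n m) (h k : 'M[C]_m).

Definition rot q h : @QP R n m := (q.1 *m h, h^t* *m q.2).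

Lemma toOrb_rot q h : h *m h^t* = 1%:M -> toOrb (rot q h) = toOrb q.
Proof.
move=> hh; rewrite !toOrbE /= !adjmxM trmxCK -mulmxBl -mulmxDr.
by rewrite mulmxA -[_ *m h *m h^t*]mulmxA hh mulmx1.
Qed.

(** The momentum equation at [(Q k, k^-1 P)], multiplied by [k] on the left and by [k^dagger] on the
    right, says that [k k^dagger] solves the Riccati equation of [q]; uniqueness forces it to be
    1. *)
Lemma rot_congruence q k : k \in unitmx -> level q ->
  level (q.1 *m k, invmx k *m q.2) -> k *m k^t* = 1%:M.
Proof.
move=> ku ql qkl; have Bp := psd_muladj q.2.
have Np : pd (k *m k^t*).
  by split; [exact: psd_muladj|rewrite unitmx_mul unitmx_adj ku].
apply: (riccati_uniq Bp Np); rewrite -(level_QQ ql).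
have := level_QQ qkl; rewrite /= !adjmxM adjmxV.
have kau : k^t* \in unitmx by rewrite unitmx_adj.
exact: congruence_identity.
Qed.

Lemma level_fiber q q' : level q -> level q' -> toCot q' = toCot q ->
  exists h, [/\ h *m h^t* = 1%:M, h^t* *m h = 1%:M & q' = rot q h].
Proof.
move=> ql q'l [q1 q2].
have [k Qk] : exists k, q'.1 = q.1 *m k by apply: mximg_factor => y; rewrite q1.
have [k' Qk'] : exists k', q.1 = q'.1 *m k' by apply: mximg_factor => y; rewrite q1.
have kk' : k *m k' = 1%:M.
  by rewrite -(linvK ql) [X in _ = _ *m X]Qk' Qk -mulmxA [RHS]mulmxA linvK // mul1mx.
have [ku _] := mulmx1_unit kk'.
have P' : q'.2 = invmx k *m q.2.
  have := congr1 (mulmx (linv q)) q2; rewrite Qk !mulmxA linvK // !mul1mx => <-.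
  by rewrite mulmxA (mulVmx ku) mul1mx.
have q'E : q' = (q.1 *m k, invmx k *m q.2).
  by case: q' Qk P' {q1 q2 q'l Qk'} => Q' P' /= -> ->.
have hh : k *m k^t* = 1%:M by apply: (rot_congruence ku ql); rewrite -q'E.
have hh' := mulmx1C hh.
exists k; split=> //; rewrite q'E /rot; congr (_, _ *m _).
by rewrite -[LHS]mulmx1 -hh mulmxA (mulVmx ku) mul1mx.
Qed.

Lemma Orb_lift (xi : 'M[C]_n) : Orb m 'i xi ->
  exists2 q : @QP R n m, level q & toOrb q = xi.
Proof.
move=> [Q [P [-> PQ]]].
have WU : ('i^-1 *: P) *m Q = 1%:M.
  by rewrite -scalemxAl PQ scale_scalar_mx mulVf ?neq0Ci.
have [ql qE] := orb_levelP WU.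
exists (orb_level Q ('i^-1 *: P)) => //.
by rewrite qE -scalemxAr scalerA divff ?neq0Ci // scale1r.
Qed.

Lemma Phi_bij : set_bij (Orb m 'i) (CotGr m) (@Phi_map R n).
Proof.
split.
- by move=> xi /Orb_lift[q ql <-]; rewrite (Phi_toOrb ql); exact: toCot_CotGr.
- move=> xi xi' /set_mem/Orb_lift[q ql <-] /set_mem/Orb_lift[q' q'l <-].
  rewrite (Phi_toOrb ql) (Phi_toOrb q'l) => qq'.
  by have [h [hh _ ->]] := level_fiber ql q'l (esym qq'); rewrite toOrb_rot.
- move=> x /CotGr_lift[q ql <-]; exists (toOrb q); first exact: level_orb.
  by rewrite Phi_toOrb.
Qed.

End Fibers.

(** * Horizontal vectors *)

Section HorizontalIdentities.
Context {F : fieldType} {n m : nat}.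
Variables (D : 'M[F]_(n, m)) (E : 'M[F]_(m, n)).
Hypotheses (ED : E *m D = 2%:M) (neq2 : (2 : F) != 0).

(** When [E D = 2], the kernel of the differential of [D E] consists of the infinitesimal
    gl(m)-action [(D c, - c E)]; [c] is found by multiplying by [D] on the right. *)
Lemma split_product0 (dD : 'M[F]_(n, m)) (dE : 'M[F]_(m, n)) :
  dD *m E + D *m dE = 0 ->
  let c := - 2^-1 *: (dE *m D) in dD = D *m c /\ dE = - (c *m E).
Proof.
move=> dDE c.
have dDc : dD = D *m c.
  have := congr1 (fun M => 2^-1 *: (M *m D)) dDE.
  rewrite mulmxDl -!mulmxA ED mul0mx scaler0 mul_mx_scalar scalerDr scalerA.
  rewrite mulVf // scale1r => /eqP; rewrite addr_eq0 => /eqP ->.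
  by rewrite /c -scalemxAr scaleNr.
split=> //.
have := congr1 (fun M => 2^-1 *: (E *m M)) dDE.
rewrite mulmxDr !mulmxA ED mulmx0 scaler0 mul_scalar_mx scalerDr scalerA.
rewrite mulVf // scale1r addrC => /eqP; rewrite addr_eq0 => /eqP ->.
by rewrite dDc mulmxA ED mul_scalar_mx -scalemxAl scalerA mulVf // scale1r.
Qed.

Section Projector.
Variables (dD dD' : 'M[F]_(n, m)) (dE dE' : 'M[F]_(m, n)).
Hypotheses (t0 : E *m dD + dE *m D = 0) (t0' : E *m dD' + dE' *m D = 0).
Let p := 2^-1 *: (D *m E).
Let p1 := 2^-1 *: (dD *m E + D *m dE).
Let p2 := 2^-1 *: (dD' *m E + D *m dE').

Lemma projector_idem : p *m p = p.
Proof.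
rewrite /p scale_mulmx2 mulmxA -[D *m E *m D]mulmxA ED mul_mx_scalar -scalemxAl scalerA.
by rewrite -mulrA mulVf // mulr1.
Qed.

(** The derivative of [p p = p] along a variation that preserves [E D = 2], the latter being
    expressed by [t0]. Points of the orbit are [i p] with [p] idempotent. *)
Lemma projector_leibniz : p *m p1 + p1 *m p = p1.
Proof.
rewrite /p /p1 !scale_mulmx2 -scalerDr mulmxDr mulmxDl !mulmxA.
rewrite -[D *m E *m D]mulmxA ED -[D *m E *m dD]mulmxA -[dD *m E *m D]mulmxA ED.
rewrite -[D *m dE *m D]mulmxA.
have -> : E *m dD = - (dE *m D) by apply/eqP; rewrite -addr_eq0 t0.
rewrite !mul_mx_scalar mulmxN mulNmx -!scalemxAl; mx_atoms.
by apply/matrixP => i j; rewrite !mxE; field.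
Qed.

End Projector.

(** The last trace is symmetric in the two variations by cyclicity, so it drops out once the KKS
    form antisymmetrizes; only [tr(dE' dD)] survives. *)
Lemma projector_trace dD dD' (dE dE' : 'M[F]_(m, n)) :
  E *m dD + dE *m D = 0 -> E *m dD' + dE' *m D = 0 ->
  let p := 2^-1 *: (D *m E) in
  let p1 := 2^-1 *: (dD *m E + D *m dE) in
  let p2 := 2^-1 *: (dD' *m E + D *m dE') in
  \tr (p1 *m p *m p2) =
  2^-1 * \tr (dE' *m dD) + 2^-1 * 2^-1 * \tr (E *m dD' *m (E *m dD)).
Proof.
move=> t0 t0' p p1 p2.
have ED1 : dE *m D = - (E *m dD) by apply/eqP; rewrite -addr_eq0 addrC t0.
have ED2 : dE' *m D = - (E *m dD') by apply/eqP; rewrite -addr_eq0 addrC t0'.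
have p1D : p1 *m D = dD - 2^-1 *: (D *m (E *m dD)).
  rewrite /p1 -scalemxAl mulmxDl -!mulmxA ED ED1 mul_mx_scalar mulmxN.
  by rewrite scalerDr scalerN scalerA mulVf // scale1r.
have Ep2 : E *m p2 = dE' + 2^-1 *: (E *m dD' *m E).
  rewrite /p2 -scalemxAr mulmxDr !mulmxA ED mul_scalar_mx.
  by rewrite scalerDr addrC scalerA mulVf // scale1r.
clearbody p1 p2.
have -> : p1 *m p *m p2 = 2^-1 *: ((p1 *m D) *m (E *m p2)).
  by rewrite /p -scalemxAr -scalemxAl !mulmxA.
rewrite mxtraceZ mxtrace_mulC p1D Ep2.
rewrite mulmxDl !mulmxBr -!scalemxAl -!scalemxAr !mulmxA ED2.
rewrite -[E *m dD' *m E *m D]mulmxA ED !mulNmx.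
rewrite mul_mx_scalar -!scalemxAl.
rewrite !(raddfB (@mxtrace F m), raddfD (@mxtrace F m), raddfN (@mxtrace F m), mxtraceZ).
rewrite /= -!mulmxA !mxtraceZ.
set a := \tr _; set b := \tr _.
by field.
Qed.

End HorizontalIdentities.

Lemma vertical_cancel {F : fieldType} {n m : nat} (X Yd Q Pd : 'M[F]_(n, m))
    (Xd Y Qd P : 'M[F]_(m, n)) (a : 'M[F]_m) :
  (X + Q *m a - (Yd - Pd *m - a)) *m (Qd + P)
    + (Q - Pd) *m (Xd + - a *m Qd + (Y - a *m P)) =
  (X - Yd) *m (Qd + P) + (Q - Pd) *m (Xd + Y).
Proof.
by rewrite !(mulmxDl, mulmxDr, mulNmx, mulmxN, opprD, opprK, mulmxA); mx_ring.
Qed.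

Section ChartDifference.
Context {F : fieldType} {n m k : nat}.

Lemma chart_diff_sub1 (b : 'M[F]_(k, n)) (a : 'M[F]_(m, n)) (Z : 'M[F]_(k, m))
    (K : 'M[F]_m) (X X' : 'M[F]_(n, m)) :
  (b *m (X - X') - Z *m (a *m (X - X'))) *m K =
  (b *m X - Z *m (a *m X)) *m K - (b *m X' - Z *m (a *m X')) *m K.
Proof. rewrite !(mulmxDl, mulmxDr, mulNmx, mulmxN); mx_ring. Qed.

Lemma chart_diff_sub2 (b : 'M[F]_(n, k)) (a : 'M[F]_(m, n)) (Q X X' : 'M[F]_(n, m))
    (P Y Y' : 'M[F]_(m, n)) :
  a *m ((X - X') *m P + Q *m (Y - Y')) *m b =
  a *m (X *m P + Q *m Y) *m b - a *m (X' *m P + Q *m Y') *m b.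
Proof. rewrite !(mulmxDl, mulmxDr, mulNmx, mulmxN); mx_ring. Qed.

End ChartDifference.

Section Horizontal.
Context {R : realType} {n m : nat}.
Local Notation C := R[i].
Implicit Types (q A B : @QP R n m) (phi : frame R n m).

Definition level_tangent q A : Prop :=
  A.1^t* *m q.1 + q.1^t* *m A.1 = A.2 *m q.2^t* + q.2 *m A.2^t* /\
  A.2 *m q.1 + q.2 *m A.1 = 0.

(* Orthogonality to the [U(m)]-orbit completes the tangency conditions to this
   quaternionic-linear system. *)
Definition hor q A : Prop :=
  q.1^t* *m A.1 = A.2 *m q.2^t* /\ q.2 *m A.1 + A.2 *m q.1 = 0.

Lemma level_tangent_skew q A : level_tangent q A ->
  (q.1^t* *m A.1 - A.2 *m q.2^t*)^t* = - (q.1^t* *m A.1 - A.2 *m q.2^t*).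
Proof.
move=> [T1 _]; rewrite adjmxB !adjmxM !trmxCK opprB; apply/eqP.
by rewrite subr_eq addrAC eq_sym subr_eq addrC [X in X == _]addrC T1.
Qed.

Definition dOrb q A : 'M[C]_n :=
  ('i / 2) *: ((A.1 - A.2^t*) *m (q.1^t* + q.2)
             + (q.1 - q.2^t*) *m (A.1^t* + A.2)).

(** The first component is the derivative of [Z = (fb' Q) (fa' Q)^-1], with the derivative of the
    inverse absorbed into the term in [Z]. *)
Definition dCot phi q A : @chartspace R n m :=
  ((fb' phi *m A.1 - (coord phi q).1 *m (fa' phi *m A.1))
     *m invmx (fa' phi *m q.1),
   fa' phi *m (A.1 *m q.2 + q.1 *m A.2) *m fb phi).

Definition qsub A B : @QP R n m := (A.1 - B.1, A.2 - B.2).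

Definition qvert q (a : 'M[C]_m) A : @QP R n m :=
  (A.1 + q.1 *m a, A.2 - a *m q.2).

Lemma hor_sub q A B : hor q A -> hor q B -> hor q (qsub A B).
Proof.
move=> [A1 A2] [B1 B2]; split=> /=; first by rewrite mulmxBr mulmxBl A1 B1.
by rewrite mulmxBr mulmxBl addrACA A2 add0r -opprD B2 oppr0.
Qed.

Lemma dOrb_sub q A B : dOrb q (qsub A B) = dOrb q A - dOrb q B.
Proof.
rewrite /dOrb /= !adjmxB -scalerBr; congr (_ *: _).
move: (A.2^t*) (B.2^t*) (A.1^t*) (B.1^t*) (q.1 - _) (q.1^t* + _) => a b c d e f.
by rewrite opprB !(mulmxDl, mulmxDr, mulNmx, mulmxN); mx_ring.
Qed.

Lemma dCot_sub phi q A B : dCot phi q (qsub A B) = dCot phi q A - dCot phi q B.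
Proof.
rewrite /dCot; move: (coord phi q).1 (invmx (fa' phi *m q.1)) => Z K.
by apply: injective_projections; [exact: chart_diff_sub1|exact: chart_diff_sub2].
Qed.

Section AtLevel.
Variables (q : @QP R n m) (ql : level q).
Local Notation Q := q.1.
Local Notation P := q.2.

Let ED : (Q^t* + P) *m (Q - P^t*) = 2%:M.
Proof. exact: level_sum_diff (level_QQ ql) (level_PQ ql) (level_QP ql). Qed.

(** In the variables [D = Q - P^dagger] and [E = Q^dagger + P] the equations read [E dD + dE D = 0]
    and [E dE^dagger = dD^dagger D]. This is the system [hor] again, up to an adjoint, with [(D, E)]
    in place of [(Q, P)]. *)
Lemma hor_frame A : hor q A ->
  (Q^t* + P) *m (A.1 - A.2^t*) + (A.1^t* + A.2) *m (Q - P^t*) = 0 /\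
  (Q^t* + P) *m (A.1 + A.2^t*) = (A.1^t* - A.2) *m (Q - P^t*).
Proof.
move=> [H1 H2].
have H1' : A.1^t* *m Q = P *m A.2^t*.
  by have := congr1 (fun M => M^t*) H1; rewrite !adjmxM !trmxCK.
have H2' : A.1^t* *m P^t* + Q^t* *m A.2^t* = 0.
  by have := congr1 (fun M => M^t*) H2; rewrite adjmxD !adjmxM adjmx0.
have H2a : P *m A.1 = - (A.2 *m Q) by apply/eqP; rewrite -addr_eq0 H2.
have H2b : A.1^t* *m P^t* = - (Q^t* *m A.2^t*) by apply/eqP; rewrite -addr_eq0 H2'.
rewrite !(mulmxDl, mulmxDr, mulNmx, mulmxN) H1 H1' H2a H2b.
by split; mx_ring.
Qed.

(** A vector killed by [dOrb] has [dD = D c] and [dE = - c E]; the second equation of [hor_frame]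
    then becomes a Sylvester equation for [c^dagger] with positive definite coefficient
    [E E^dagger], so [c = 0]. *)
Lemma hor_dOrb_inj A : hor q A -> dOrb q A = 0 -> A = (0, 0).
Proof.
move=> Ah A0; have [_ Hb] := hor_frame Ah.
have dDE : (A.1 - A.2^t*) *m (Q^t* + P) + (Q - P^t*) *m (A.1^t* + A.2) = 0.
  by move/eqP: A0; rewrite scaler_eq0 (negPf half_i_neq0) => /eqP.
have [dDc dEc] := split_product0 ED two_neq0 dDE.
set c := _ *: _ in dDc dEc.
have dEa : A.1 + A.2^t* = - ((Q + P^t*) *m c^t*).
  have := congr1 (fun M => M^t*) dEc.
  by rewrite adjmxD trmxCK adjmxN adjmxM adjmxD trmxCK.
have dDa : A.1^t* - A.2 = c^t* *m (Q^t* - P).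
  have := congr1 (fun M => M^t*) dDc.
  by rewrite adjmxB trmxCK adjmxM adjmxB trmxCK.
have EEp : pd ((Q^t* + P) *m (Q + P^t*)).
  have -> : Q + P^t* = (Q^t* + P)^t* by rewrite adjmxD trmxCK.
  rewrite -{1}[Q^t* + P]trmxCK; apply: (@pd_adjmul _ _ _ _ (2^-1 *: (Q - P^t*)^t*)).
  by rewrite -scalemxAl -adjmxM ED adjmx_scalar conjC_nat scale_scalar_mx mulVf ?two_neq0.
have DDp : psd ((Q^t* - P) *m (Q - P^t*)).
  have -> : Q^t* - P = (Q - P^t*)^t* by rewrite adjmxB trmxCK.
  exact: psd_adjmul.
have c0 : c^t* = 0.
  apply: (sylvester_inj EEp DDp); rewrite -mulmxA.
  move: Hb; rewrite dEa dDa mulmxN => /eqP; rewrite eq_sym -addr_eq0 => /eqP <-.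
  by rewrite addrC !mulmxA.
have dE0 : A.1 + A.2^t* = 0 by rewrite dEa c0 mulmx0 oppr0.
have dD0 : A.1 - A.2^t* = 0 by rewrite dDc -[c]trmxCK c0 adjmx0 mulmx0.
have two0 (X : 'M[C]_(n, m)) : X + X = 0 -> X = 0.
  move=> /eqP; rewrite -mulr2n -scaler_nat scaler_eq0 (negPf two_neq0) /=.
  by move/eqP.
have A10 : A.1 = 0.
  by apply: two0; rewrite -[RHS]addr0 -{1}dE0 -dD0 addrACA subrr addr0.
move: dE0; rewrite A10 add0r => /(congr1 (fun M => M^t*)).
rewrite trmxCK adjmx0 => A20.
by rewrite [A]surjective_pairing A10 A20.
Qed.

(** A vector killed by [dCot] is [(Q c, - c P)], and horizontality becomes
    [Q^dagger Q c + c P P^dagger = 0], whose only solution is 0. *)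
Lemma hor_dCot_inj phi A : fa' phi *m Q \in unitmx ->
  hor q A -> dCot phi q A = (0, 0) -> A = (0, 0).
Proof.
move=> ku [H1 H2] dA.
have A1 : (fb' phi *m A.1 - (coord phi q).1 *m (fa' phi *m A.1))
    *m invmx (fa' phi *m Q) = 0.
  exact: (congr1 (fun e : @chartspace R n m => e.1) dA).
have A2 : fa' phi *m (A.1 *m P + Q *m A.2) *m fb phi = 0.
  exact: (congr1 (fun e : @chartspace R n m => e.2) dA).
have Q1 := chart_emb_coord ku; set Z := (coord phi q).1 in Q1 A1.
have [aF bF KF Kb FK] := chart_embP phi Z.
have KX : chart_ker phi Z *m A.1 = 0.
  have := congr1 (mulmx^~ (fa' phi *m Q)) A1; rewrite (mulmxKV ku) mul0mx.
  by move=> KX; rewrite /chart_ker mulmxBl -[Z *m _ *m _]mulmxA.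
pose c := invmx (fa' phi *m Q) *m (fa' phi *m A.1).
have XQ : A.1 = Q *m c.
  rewrite -{1}Q1 /c -mulmxA (mulKVmx ku) -[LHS]mul1mx -FK mulmxDl.
  by rewrite -[fb phi *m _ *m _]mulmxA KX mulmx0 addr0 mulmxA.
have YQ : A.2 *m Q = 0.
  by move: H2; rewrite XQ mulmxA (level_PQ ql) mul0mx add0r.
have cPY : (c *m P + A.2) *m chart_emb phi Z = 0.
  rewrite -[chart_emb phi Z](mulmxK ku) Q1 mulmxA mulmxDl YQ addr0.
  by rewrite -[c *m P *m Q]mulmxA (level_PQ ql) mulmx0 mul0mx.
have cPYb : (c *m P + A.2) *m fb phi = 0.
  move: A2; rewrite XQ -[Q *m c *m P]mulmxA -mulmxDr !mulmxA.
  move=> /(congr1 (mulmx (invmx (fa' phi *m Q)))).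
  by rewrite mulmx0 -!mulmxA [fa' phi *m (Q *m _)]mulmxA (mulKmx ku).
have AP : A.2 = - (c *m P).
  apply/eqP; rewrite -addr_eq0 addrC -[_ + _]mulmx1 -FK mulmxDr !mulmxA.
  by rewrite cPY cPYb !mul0mx addr0.
have c0 : c = 0.
  apply: (sylvester_inj (level_pd ql) (psd_muladj P)).
  by rewrite -mulmxA -XQ H1 AP mulNmx -mulmxA addrC addrN.
by rewrite [A]surjective_pairing XQ AP c0 mulmx0 mul0mx oppr0.
Qed.

(** The horizontal part of a tangent vector: [a] must solve [Q^dagger Q a + a S = - Z] with
    [S = P P^dagger]. As [Q^dagger Q = 2 + S], this is the symmetric equation
    [(1 + S) a + a (1 + S) = - Z], and since [Z] is skew-Hermitian, uniqueness makes [a]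
    skew-Hermitian too. *)
Lemma hor_qvert A : level_tangent q A ->
  exists2 a, a^t* = - a & hor q (qvert q a A).
Proof.
move=> T; have [_ T2] := T.
pose Z := Q^t* *m A.1 - A.2 *m P^t*.
have Zs : Z^t* = - Z by exact: level_tangent_skew.
pose S := P *m P^t*; have Sp : psd S by exact: psd_muladj.
have S1p : pd (1%:M + S) by exact: pdD pd1 Sp.
have sol a : (1%:M + S) *m a + a *m (1%:M + S) = - Z ->
    Q^t* *m Q *m a + a *m S = - Z.
  move=> <-; rewrite (level_QQ ql) -/S -[2%:M]scalemx1 mulmxDl mulmxDl mulmxDr.
  rewrite -scalemxAl !mul1mx mulmx1.
  by mx_ring.
have [a aE] := sylvester_solve (- Z) S1p S1p.1.
have as_ : a^t* = - a.
  apply/eqP; rewrite -addr_eq0; apply/eqP.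
  apply: (sylvester_inj S1p S1p.1).
  rewrite (mulmxDr _ (a^t*)) (mulmxDl (a^t*)) addrACA aE.
  have := congr1 (fun M => M^t*) aE; have [Sh _] := S1p.1.
  by rewrite adjmxD !adjmxM Sh adjmxN Zs opprK [X in X = _]addrC => ->; rewrite addrN.
exists a; [exact: as_|split; rewrite /qvert [(_, _).1]/= [(_, _).2]/=].
  have := sol a aE; rewrite /Z mulmxDr mulmxBl -!mulmxA -/S => /eqP.
  rewrite opprB eq_sym subr_eq => /eqP E.
  by rewrite E; mx_ring.
rewrite mulmxDr mulmxBl !mulmxA (level_PQ ql) mul0mx -mulmxA (level_PQ ql) mulmx0.
by rewrite addr0 subr0 addrC.
Qed.

Lemma dOrb_qvert a A : a^t* = - a -> dOrb q (qvert q a A) = dOrb q A.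
Proof.
move=> as_; rewrite /dOrb /qvert [(_, _).1]/= [(_, _).2]/= adjmxB adjmxD !adjmxM as_.
by rewrite vertical_cancel.
Qed.

Lemma dCot_qvert phi a A : fa' phi *m Q \in unitmx ->
  dCot phi q (qvert q a A) = dCot phi q A.
Proof.
move=> ku; rewrite /dCot.
have ZQ : (coord phi q).1 *m (fa' phi *m Q) = fb' phi *m Q by exact: mulmxKV.
move: (coord phi q).1 ZQ => Z ZQ.
have -> : fb' phi *m (qvert q a A).1 - Z *m (fa' phi *m (qvert q a A).1) =
    fb' phi *m A.1 - Z *m (fa' phi *m A.1).
  rewrite [(qvert q a A).1]/= !mulmxDr [fa' phi *m (Q *m a)]mulmxA.
  by rewrite [Z *m (_ *m a)]mulmxA ZQ -[fb' phi *m Q *m a]mulmxA; mx_ring.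
have -> // : (qvert q a A).1 *m P + Q *m (qvert q a A).2 = A.1 *m P + Q *m A.2.
by rewrite /qvert [(_, _).1]/= [(_, _).2]/= mulmxDl mulmxBr mulmxA; mx_ring.
Qed.

End AtLevel.
End Horizontal.

(** * The KKS and canonical forms as traces on horizontal vectors *)

Lemma common_term_cancel {F : comPzRingType} (i h a b c : F) :
  i * (h * a + h * h * c - (h * b + h * h * c)) = i * h * (a - b).
Proof. by ring. Qed.

Section TraceAlgebra.
Context {F : fieldType} {n m : nat}.

Lemma trace_split (X X' Yd Yd' : 'M[F]_(n, m))
   (Xd Xd' Y Y' : 'M[F]_(m, n)) :
  \tr ((Xd' + Y') *m (X - Yd)) - \tr ((Xd + Y) *m (X' - Yd')) =
  (\tr (Xd' *m X) - \tr (Xd *m X')) + (\tr (Y *m Yd') - \tr (Y' *m Yd)) +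
  ((\tr (Y' *m X) - \tr (Y *m X')) + (\tr (Xd *m Yd') - \tr (Xd' *m Yd))).
Proof.
rewrite !(mulmxDl, mulmxDr, mulmxN).
rewrite !(raddfD (@mxtrace F m), raddfN (@mxtrace F m)) /=; ring.
Qed.

(** A tangent vector to the idempotents at [p] is off-diagonal for the splitting defined by [p], and
    there the square of [ad p] is the identity. Hence [i p1 = [i p, [p, p1]]], which supplies the
    matrix [X] in the definition of the KKS form. *)
Lemma double_bracket (p p1 : 'M[F]_n) : p *m p = p ->
  p *m p1 + p1 *m p = p1 ->
  p *m (p *m p1 - p1 *m p) - (p *m p1 - p1 *m p) *m p = p1.
Proof.
move=> pp p1E; have pp1p : p *m p1 *m p = 0.
  apply: (addIr (p1 *m p)); rewrite add0r.
  by have := congr1 (mulmx^~ p) p1E; rewrite mulmxDl -[p1 *m p *m p]mulmxA pp.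
rewrite mulmxBr mulmxBl !mulmxA pp pp1p -[p1 *m p *m p]mulmxA pp.
by rewrite subr0 sub0r opprK p1E.
Qed.

(** The two traces in parentheses are exchanged by swapping [X] and [X'], so they cancel in the
    antisymmetrized canonical form and leave [tr(Y' X) - tr(Y X')]. *)
Lemma chart_trace (fa' : 'M[F]_(m, n)) (fb : 'M[F]_(n, n - m))
    (Ker : 'M[F]_(n - m, n)) (Q Emb X X' : 'M[F]_(n, m)) (P Y' : 'M[F]_(m, n))
    (k ik : 'M[F]_m) :
  k *m ik = 1%:M -> ik *m k = 1%:M -> fa' *m Q = k -> Emb *m k = Q ->
  Emb *m fa' + fb *m Ker = 1%:M -> P *m Q = 0 -> P *m X' + Y' *m Q = 0 ->
  \tr (fa' *m (X' *m P + Q *m Y') *m fb *m (Ker *m X *m ik)) =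
  \tr (Y' *m X) + (\tr (ik *m (fa' *m X') *m (P *m X))
                 + \tr (ik *m (fa' *m X) *m (P *m X'))).
Proof.
move=> kik ikk aQ Ek EK PQ PX.
have -> : fa' *m (X' *m P + Q *m Y') *m fb *m (Ker *m X *m ik) =
    fa' *m (X' *m P + Q *m Y') *m (fb *m Ker) *m X *m ik by rewrite !mulmxA.
have -> : fb *m Ker = 1%:M - Emb *m fa' by rewrite -EK addrC addKr.
have E0 : Emb = Q *m ik by rewrite -Ek -mulmxA kik mulmx1.
have PE : P *m Emb = 0 by rewrite E0 mulmxA PQ mul0mx.
have YE : Y' *m Emb = - (P *m X' *m ik).
  rewrite E0 mulmxA -mulNmx; congr (_ *m _).
  by apply/eqP; rewrite -addr_eq0 addrC PX.
have QE : (X' *m P + Q *m Y') *m Emb = - (Q *m (P *m X' *m ik)).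
  by rewrite mulmxDl -!mulmxA PE mulmx0 add0r YE mulmxN !mulmxA.
have -> : fa' *m (X' *m P + Q *m Y') *m (1%:M - Emb *m fa') *m X *m ik =
    (fa' *m X' *m (P *m X) + k *m (Y' *m X) + k *m (P *m X' *m (ik *m (fa' *m X)))) *m ik.
  rewrite mulmxBr mulmx1 [_ *m (Emb *m fa')]mulmxA -[fa' *m _ *m Emb]mulmxA QE.
  rewrite mulmxN mulNmx opprK.
  rewrite mulmxDr [fa' *m (Q *m Y')]mulmxA [fa' *m (Q *m _)]mulmxA aQ.
  by rewrite !mulmxDl !mulmxA.
rewrite mxtrace_mulC !mulmxDr ![ik *m (k *m _)]mulmxA ikk !mul1mx.
rewrite !(raddfD (@mxtrace F m)) /= [X in _ + X]mxtrace_mulC -!mulmxA.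
by rewrite [RHS]addrCA addrA.
Qed.

End TraceAlgebra.

Section Forms.
Context {R : realType} {n m : nat}.
Local Notation C := R[i].
Implicit Types (q A B : @QP R n m) (phi : frame R n m) (e u v : @chartspace R n m).

Lemma Re_half (z : C) : 2^-1 * complex.Re (z + Num.conj z) = complex.Re z.
Proof. by rewrite Re_add Re_conj; field. Qed.

Lemma gflatE A B :
  gflat (qmx_of A) (qmx_of B) =
  complex.Re (\tr (A.1 *m B.1^t*) + \tr (A.2 *m B.2^t*)).
Proof.
have prod1 X Y : \tr (qmul (@qmx_of R n m X) (qadj (qmx_of Y))).1 =
    \tr (X.1 *m Y.1^t*) + \tr (X.2 *m Y.2^t*).
  rewrite /qmul /qadj /qmx_of /= mulmxN opprK mxtraceD; congr (_ + _).
  rewrite -mxtrace_tr trmx_mul trmxK mxtrace_mulC; congr (\tr (_ *m _)).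
  by apply/matrixP => i j; rewrite !mxE conjCK.
rewrite -Re_half; congr (_ * complex.Re _).
apply: etrans (mxtraceD (qmul (qmx_of A) (qadj (qmx_of B))).1
  (qmul (qmx_of B) (qadj (qmx_of A))).1) _.
apply: (congr2 +%R (prod1 A B)); apply: etrans (prod1 B A) _.
by rewrite rmorphD /= -!mxtrace_adj !adjmxM !trmxCK.
Qed.

Lemma gflat_rot A B (h : 'M[C]_m) : h *m h^t* = 1%:M -> h^t* *m h = 1%:M ->
  gflat (qmx_of (rot A h)) (qmx_of (rot B h)) = gflat (qmx_of A) (qmx_of B).
Proof.
move=> hh hh'; rewrite !gflatE /rot [(_, _).1]/= [(_, _).2]/= !adjmxM trmxCK.
rewrite mulmxA -[A.1 *m h *m _]mulmxA hh mulmx1.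
rewrite [\tr (_ *m (B.2^t* *m h))]mxtrace_mulC.
by rewrite -mulmxA [h *m _]mulmxA hh mul1mx [X in _ + X]mxtrace_mulC.
Qed.

Lemma invmx_uniq {p} (A B : 'M[C]_p) : A *m B = 1%:M -> invmx A = B.
Proof.
by move=> AB; have [Au _] := mulmx1_unit AB; rewrite -[LHS]mulmx1 -AB (mulKmx Au).
Qed.

Section Rotation.
Variables (q : @QP R n m) (h : 'M[C]_m).
Hypotheses (hh : h *m h^t* = 1%:M) (hh' : h^t* *m h = 1%:M).

Lemma hor_rot A : hor (rot q h) A -> hor q (rot A (h^t*)).
Proof.
rewrite /hor /rot; case: A => X Y /=; rewrite trmxCK !adjmxM trmxCK => -[H1 H2]; split.
  have := congr1 (fun M => h *m M *m h^t*) H1; rewrite !mulmxA hh mul1mx.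
  by rewrite -[h *m Y *m _ *m h *m h^t*]mulmxA hh mulmx1.
have := congr1 (fun M => h *m M *m h^t*) H2; rewrite mulmxDr mulmxDl mulmx0 mul0mx.
by rewrite !mulmxA hh mul1mx -[_ *m h *m h^t*]mulmxA hh mulmx1.
Qed.

Lemma dOrb_rot A : dOrb (rot q h) A = dOrb q (rot A (h^t*)).
Proof.
rewrite /dOrb /rot; case: A => X Y /=; rewrite !adjmxM !trmxCK -!mulmxBl -!mulmxDr.
by rewrite !mulmxA.
Qed.

Lemma dCot_rot phi A : fa' phi *m q.1 \in unitmx ->
  dCot phi (rot q h) A = dCot phi q (rot A (h^t*)).
Proof.
move=> ku.
have kV : invmx (fa' phi *m (q.1 *m h)) = h^t* *m invmx (fa' phi *m q.1).
  by apply: invmx_uniq; rewrite !mulmxA -[_ *m h *m h^t*]mulmxA hh mulmx1 mulmxV.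
have cE : (coord phi (rot q h)).1 = (coord phi q).1.
  change (fb' phi *m (q.1 *m h) *m invmx (fa' phi *m (q.1 *m h)) =
    fb' phi *m q.1 *m invmx (fa' phi *m q.1)).
  by rewrite kV !mulmxA -[fb' phi *m _ *m h *m _]mulmxA hh mulmx1.
rewrite /dCot cE; move: (coord phi q).1 => Z.
apply: injective_projections; rewrite /rot.
  change ((fb' phi *m A.1 - Z *m (fa' phi *m A.1)) *m invmx (fa' phi *m (q.1 *m h)) =
    (fb' phi *m (A.1 *m h^t*) - Z *m (fa' phi *m (A.1 *m h^t*)))
      *m invmx (fa' phi *m q.1)).
  by rewrite kV [LHS]mulmxA (mulmxBl _ _ (h^t*)) !mulmxA.
change (fa' phi *m (A.1 *m (h^t* *m q.2) + q.1 *m h *m A.2) *m fb phi =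
  fa' phi *m (A.1 *m h^t* *m q.2 + q.1 *m ((h^t*)^t* *m A.2)) *m fb phi).
by rewrite trmxCK !mulmxA.
Qed.

End Rotation.

(* Left multiplications by [i] and [k] of the quaternionic matrix
   [A.1 + j A.2^dagger]. *)
Definition rotI A : @QP R n m := ('i *: A.1, 'i *: A.2).
Definition rotK A : @QP R n m := (- 'i *: A.2^t*, 'i *: A.1^t*).

Lemma hor_rotI q A : hor q A -> hor q (rotI A).
Proof.
move=> [H1 H2]; rewrite /rotI; split=> /=.
  by rewrite -scalemxAr -scalemxAl H1.
by rewrite -scalemxAr -scalemxAl -scalerDr H2 scaler0.
Qed.

Lemma hor_rotK q A : hor q A -> hor q (rotK A).
Proof.
move=> [H1 H2]; rewrite /rotK; split=> /=.
  rewrite -scalemxAr -scalemxAl scaleNr -scalerN -!adjmxM; congr (_ *: _).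
  have : (q.2 *m A.1)^t* = - (A.2 *m q.1)^t*.
    by rewrite -adjmxN; congr (_^t*); apply/eqP; rewrite -addr_eq0 H2.
  by move=> ->.
have := congr1 (fun M => M^t*) H1; rewrite !adjmxM !trmxCK => H1'.
by rewrite -scalemxAr -scalemxAl H1' scaleNr addNr.
Qed.

Lemma dCot_rotI phi q A : dCot phi q (rotI A) = 'i *: dCot phi q A.
Proof.
rewrite /dCot; move: (coord phi q).1 (invmx (fa' phi *m q.1)) => Z K.
apply: injective_projections; rewrite /rotI [('i *: A.1, _).1]/= [('i *: A.1, _).2]/=.
  rewrite [RHS]/= -!scalemxAr -scalerBr -scalemxAl.
  by [].
change (fa' phi *m ('i *: A.1 *m q.2 + q.1 *m ('i *: A.2)) *m fb phi =
  'i *: (fa' phi *m (A.1 *m q.2 + q.1 *m A.2) *m fb phi)).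
have -> : 'i *: A.1 *m q.2 + q.1 *m ('i *: A.2) = 'i *: (A.1 *m q.2 + q.1 *m A.2).
  by rewrite -scalemxAl -scalemxAr -scalerDr.
by rewrite -scalemxAr -scalemxAl.
Qed.

Lemma dOrb_rotK q A : dOrb q (rotK A) = 'i *: dOrb q A.
Proof.
rewrite /dOrb /rotK [(_, _).1]/= [(_, _).2]/= !adjmxZ !trmxCK rmorphN /= conjCi opprK.
rewrite !scaleNr opprK -[_ + 'i *: A.1]addrC -scalerBr -scalerDr.
rewrite [A.2 + _]addrC -scalemxAl -scalemxAr -scalerDr !scalerA; congr (_ *: _).
by rewrite mulrC.
Qed.

Lemma mxtrace_bracket (xi X Y : 'M[C]_n) :
  \tr (xi *m bracket X Y) = \tr (bracket xi X *m Y).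
Proof.
rewrite /bracket mulmxBr mulmxBl !(raddfB (@mxtrace C n)) /= !mulmxA; congr (_ - _).
by rewrite mxtrace_mulC mulmxA.
Qed.

(** By invariance of the trace, [tr(xi [X, Y]) = tr([xi, X] Y)], and likewise for [Y] with a sign.
    The value thus depends on [X] and [Y] only through the tangent vectors, and the choice in
    [OmegaKKS] is made in a singleton. *)
Lemma OmegaKKS_bracket (xi X Y : 'M[C]_n) :
  OmegaKKS xi (bracket xi X) (bracket xi Y) = \tr (xi *m bracket X Y).
Proof.
have trE := mxtrace_bracket xi.
have trE' X1 Y1 : \tr (xi *m bracket X1 Y1) = - \tr (bracket xi Y1 *m X1).
  rewrite -trE /bracket -[Y1 *m X1 - _]opprB mulmxN.
  by rewrite (raddfN (@mxtrace C n)) /= opprK.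
apply: (@xget_subset1 _ 0 [set z | exists X0 Y0,
  [/\ bracket xi X = bracket xi X0, bracket xi Y = bracket xi Y0
    & z = \tr (xi *m bracket X0 Y0)]]).
  by exists X, Y.
move=> z z' /= [X1 [Y1 [XX1 YY1 ->]]] [X2 [Y2 [XX2 YY2 ->]]].
by rewrite trE -XX1 XX2 -trE trE' -YY1 YY2 -trE'.
Qed.

Lemma OmegaKKS_hor q A B : level q -> hor q A -> hor q B ->
  OmegaKKS (toOrb q) (dOrb q A) (dOrb q B) =
  ('i / 2) * (\tr ((B.1^t* + B.2) *m (A.1 - A.2^t*))
            - \tr ((A.1^t* + A.2) *m (B.1 - B.2^t*))).
Proof.
move=> ql /hor_frame[tA _] /hor_frame[tB _].
have ED := level_sum_diff (level_QQ ql) (level_PQ ql) (level_QP ql).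
rewrite toOrbE /dOrb.
move: (q.1 - q.2^t*) (q.1^t* + q.2) (A.1 - A.2^t*) (A.1^t* + A.2)
  (B.1 - B.2^t*) (B.1^t* + B.2) ED tA tB => D E dD dE dD' dE' ED tA tB.
have pp := projector_idem ED (two_neq0 (F := C)).
have p1 := projector_leibniz ED (two_neq0 (F := C)) tA.
have p2 := projector_leibniz ED (two_neq0 (F := C)) tB.
have b1 := double_bracket pp p1; have b2 := double_bracket pp p2.
have e12 := projector_trace ED (two_neq0 (F := C)) tA tB.
have e21 := projector_trace ED (two_neq0 (F := C)) tB tA.
rewrite -![('i / 2) *: _]scalerA.
move: pp p1 p2 b1 b2 e12 e21.
move: (2^-1 *: (D *m E)) (2^-1 *: (dD *m E + _)) (2^-1 *: (dD' *m E + _)).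
move=> p P1 P2 pp p1 p2 b1 b2 e12 e21.
have bi1 : 'i *: P1 = bracket ('i *: p) (bracket p P1).
  by rewrite /bracket -scalemxAl -scalemxAr -scalerBr b1.
have bi2 : 'i *: P2 = bracket ('i *: p) (bracket p P2).
  by rewrite /bracket -scalemxAl -scalemxAr -scalerBr b2.
rewrite bi1 bi2 OmegaKKS_bracket -scalemxAl mxtraceZ.
have -> : \tr (p *m bracket (bracket p P1) (bracket p P2)) =
   \tr (P1 *m p *m P2) - \tr (P2 *m p *m P1).
  rewrite mxtrace_bracket [bracket p (bracket p P1)]b1 /bracket mulmxBr.
  rewrite (raddfB (@mxtrace C n)) /= !mulmxA; congr (_ - _).
  by rewrite [RHS]mxtrace_mulC mulmxA.
rewrite e12 e21 [\tr (E *m dD *m _)]mxtrace_mulC; exact: common_term_cancel.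
Qed.


(** The holomorphic form [Omega_1 = omega_2 + i omega_3] on pairs [(Q, P)]. *)
Definition gamma_form A B : C := \tr (B.2 *m A.1) - \tr (A.2 *m B.1).

Lemma conj_gamma_form A B :
  Num.conj (gamma_form A B) = \tr (A.1^t* *m B.2^t*) - \tr (B.1^t* *m A.2^t*).
Proof. by rewrite /gamma_form rmorphB /= -!mxtrace_adj !adjmxM. Qed.

Lemma gflat_rotI A B : gflat (qmx_of (rotI A)) (qmx_of B) =
  - complex.Im (\tr (A.1 *m B.1^t*) + \tr (A.2 *m B.2^t*)).
Proof.
rewrite gflatE /rotI [(_, _).1]/= [(_, _).2]/= -!scalemxAl !mxtraceZ -mulrDr.
by rewrite Re_mul Re_i Im_i mul0r sub0r mul1r.
Qed.

Lemma gflat_rotK A B : gflat (qmx_of (rotK A)) (qmx_of B) =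
  complex.Im (gamma_form A B).
Proof.
rewrite gflatE /rotK [(_, _).1]/= [(_, _).2]/= -!scalemxAl !mxtraceZ.
have -> : - 'i * \tr (A.2^t* *m B.1^t*) + 'i * \tr (A.1^t* *m B.2^t*) =
    'i * Num.conj (gamma_form A B).
  by rewrite conj_gamma_form [\tr (B.1^t* *m _)]mxtrace_mulC mulrBr mulNr addrC.
by rewrite Re_mul Re_i Im_i mul0r sub0r mul1r Im_conj opprK.
Qed.

Lemma ReIm_half_i (z g : C) :
  let w := ('i / 2) * (z - Num.conj z + (g + Num.conj g)) in
  complex.Re w = - complex.Im z /\ complex.Im w = complex.Re g.
Proof.
rewrite /= [('i / 2) * _]mulrAC !(Re_mul, Im_mul, Re_inv, Im_inv) Re_i Im_i.
rewrite !(Re_add, Im_add, Re_opp, Im_opp, Re_conj, Im_conj).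
have -> : complex.Re (1 : C) = 1 by [].
have -> : complex.Im (1 : C) = 0 by [].
by split; field.
Qed.

Lemma OmegaKKS_parts q A B : level q -> hor q A -> hor q B ->
  complex.Re (OmegaKKS (toOrb q) (dOrb q A) (dOrb q B)) =
    gflat (qmx_of (rotI A)) (qmx_of B) /\
  complex.Im (OmegaKKS (toOrb q) (dOrb q A) (dOrb q B)) =
    complex.Re (gamma_form A B).
Proof.
move=> ql hA hB; rewrite (OmegaKKS_hor ql hA hB) trace_split gflat_rotI.
set z := \tr (A.1 *m B.1^t*) + \tr (A.2 *m B.2^t*).
have -> : \tr (B.1^t* *m A.1) - \tr (A.1^t* *m B.1) +
    (\tr (A.2 *m B.2^t*) - \tr (B.2 *m A.2^t*)) = z - Num.conj z.
  have -> : Num.conj z = \tr (A.1^t* *m B.1) + \tr (B.2 *m A.2^t*).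
    rewrite /z rmorphD /= -!mxtrace_adj !adjmxM !trmxCK.
    by rewrite [\tr (B.1 *m _)]mxtrace_mulC.
  by rewrite [\tr (B.1^t* *m _)]mxtrace_mulC /z opprD addrACA.
by rewrite -conj_gamma_form; exact: ReIm_half_i.
Qed.

(** Since [fa' F = 1] and [chart_ker fb = 1], the coordinates [Z] and [W] are Darboux coordinates:
    the one-form is [tr(W dZ)]. *)
Lemma lambda_canE phi e u : lambda_can phi e u = \tr (e.2 *m u.1).
Proof.
have [aF _ _ Kb _] := chart_embP phi e.1.
rewrite /lambda_can /dproj /par [(_, _).2]/= -/(chart_emb phi e.1) -/(chart_ker phi e.1).
rewrite mulmxA mxtrace_mulC !mulmxA aF mul1mx -[_ *m chart_ker phi e.1 *m _]mulmxA.
by rewrite Kb mulmx1.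
Qed.

Lemma derive1_affine (a b : R) : derive1 (fun t : R => a + t * b) 0 = b.
Proof.
rewrite derive1E.
have d : is_derive (0 : R) (1 : R) (cst a + b \*: id) (0 + b *: (1 : R)).
  exact: is_deriveD.
have -> : (fun t : R => a + t * b) = cst a + b \*: id.
  by apply/funext => t; rewrite fctE /GRing.scale /= mulrC.
by rewrite (@derive_val _ _ _ _ _ _ _ d) add0r /GRing.scale /= mulr1.
Qed.

Lemma dirder_trace e u v :
  dirder (fun e' : @chartspace R n m => \tr (e'.2 *m v.1)) e u = \tr (u.2 *m v.1).
Proof.
have trE (t : R) : \tr ((e + t%:C *: u).2 *m v.1) =
    \tr (e.2 *m v.1) + t%:C * \tr (u.2 *m v.1).
  change (\tr ((e.2 + t%:C *: u.2) *m v.1) = \tr (e.2 *m v.1) + t%:C * \tr (u.2 *m v.1)).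
  by rewrite mulmxDl mxtraceD -scalemxAl mxtraceZ.
rewrite /dirder; move: (\tr (e.2 *m v.1)) (\tr (u.2 *m v.1)) trE => a b trE.
have -> : (fun t : R => complex.Re (\tr ((e + t%:C *: u).2 *m v.1))) =
    fun t => complex.Re a + t * complex.Re b.
  by apply/funext => t; rewrite trE Re_add Re_mul /= mul0r subr0.
have -> : (fun t : R => complex.Im (\tr ((e + t%:C *: u).2 *m v.1))) =
    fun t => complex.Im a + t * complex.Im b.
  by apply/funext => t; rewrite trE Im_add Im_mul /= mul0r addr0.
by rewrite !derive1_affine; apply: complex_eq.
Qed.

Lemma OmegaCanE phi e u v :
  OmegaCan phi e u v = \tr (v.2 *m u.1) - \tr (u.2 *m v.1).
Proof.
have lamE w : lambda_can phi ^~ w = (fun e' => \tr (e'.2 *m w.1)).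
  by apply/funext => e'; exact: lambda_canE.
by rewrite /OmegaCan /ext_d (lamE u) (lamE v) !dirder_trace opprB.
Qed.

Lemma OmegaCan_hor phi q A B : level q -> fa' phi *m q.1 \in unitmx ->
  hor q A -> hor q B ->
  OmegaCan phi (coord phi q) (dCot phi q A) (dCot phi q B) = gamma_form A B.
Proof.
move=> ql ku [_ A2] [_ B2]; rewrite OmegaCanE.
have Q1 := chart_emb_coord ku.
have [_ _ _ _ FK] := chart_embP phi (coord phi q).1.
have dCot1 X : (dCot phi q X).1 =
    chart_ker phi (coord phi q).1 *m X.1 *m invmx (fa' phi *m q.1).
  by rewrite /chart_ker mulmxBl -[_ *m fa' phi *m X.1]mulmxA.
have dCot2 X : (dCot phi q X).2 = fa' phi *m (X.1 *m q.2 + q.1 *m X.2) *m fb phi by [].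
rewrite (dCot1 A) (dCot1 B) (dCot2 A) (dCot2 B).
have kk := mulmxV ku; have kk' := mulVmx ku.
rewrite (chart_trace A.1 kk kk' erefl Q1 FK (level_PQ ql) B2).
rewrite (chart_trace B.1 kk kk' erefl Q1 FK (level_PQ ql) A2).
by rewrite [X in _ - (_ + X)]addrC opprD addrACA addrN addr0.
Qed.

End Forms.

(** * Curves and velocities *)

Section RealCoordinateDerivatives.
Context {R : realType} {V : normedModType R}.
Local Notation C := R[i].

Lemma Ck_pair {W W' : normedModType R} k (U : set V) (f : V -> W) (g : V -> W') :
  open U -> Ck k U f -> Ck k U g -> Ck k U (fun x => (f x, g x)).
Proof.
move=> Uo; elim: k f g => [|k IH] f g /=.
  by move=> fc gc x Ux; apply: cvg_pair; [exact: fc|exact: gc].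
move=> [fd fD] [gd gD]; split=> [x Ux|v].
  by apply: differentiable_pair; [exact: fd|exact: gd].
apply: Ck_ext (IH _ _ (fD v) (gD v)) => // x Ux.
have [fx gx] := (fd x Ux, gd x Ux).
rewrite [RHS]deriveE; last exact: differentiable_pair.
by rewrite diff_pair // !deriveE.
Qed.

Lemma is_derive_comp_linear {W W' : normedModType R} (f : V -> W)
    (l : {linear W -> W'}) x v :
  continuous l -> differentiable f x ->
  is_derive x v (fun y => l (f y)) (l ('D_v f x)).
Proof.
move=> lc fd.
have ld : differentiable (fun y => l (f y)) x.
  by apply: differentiable_comp => //; exact: linear_differentiable.
apply: DeriveDef; first exact: diff_derivable.
rewrite [LHS]deriveE // diff_comp //; last exact: linear_differentiable.
by rewrite /= diff_lin // deriveE.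
Qed.

Lemma mder_rc {p q} (F : V -> 'M[C]_(p, q)) x v :
  differentiable (fun y => rc (F y)) x ->
  mder x v F (cr ('D_v (fun y => rc (F y)) x)).
Proof.
move=> Fd i j; split.
  have := @is_derive_comp_linear _ _ _ _ x v (@coord_re_continuous R p q i j) Fd.
  rewrite mxE /= (_ : (fun y => coord_re i j (rc (F y))) =
    fun y => complex.Re (F y i j)) //.
  by apply/funext => y; rewrite /coord_re mxE.
have := @is_derive_comp_linear _ _ _ _ x v (@coord_im_continuous R p q i j) Fd.
rewrite mxE /= (_ : (fun y => coord_im i j (rc (F y))) =
  fun y => complex.Im (F y i j)) //.
by apply/funext => y; rewrite /coord_im mxE.
Qed.

Lemma derive_rc {p q} (F : V -> 'M[C]_(p, q)) x v D :
  differentiable (fun y => rc (F y)) x -> mder x v F D ->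
  'D_v (fun y => rc (F y)) x = rc D.
Proof.
by move=> Fd FD; rewrite (mder_uniq FD (mder_rc v Fd)) crK.
Qed.

End RealCoordinateDerivatives.

Section CurveCoordinates.
Context {R : realType}.
Local Notation C := R[i].

Lemma curve1P {p q} (c : R -> 'M[C]_(p, q)) x v :
  curve rc c x v <->
  [/\ c 0 = x, exists U : set R^o, [/\ open U, U 0 & forall k, mCk (V := R^o) k U c]
    & mder (V := R^o) 0 1 c v].
Proof.
split=> [[c0 [U U0 [Uo Uc]] cv]|[c0 [U [Uo U0 Uc]] cv]].
  have cd : differentiable (fun t : R^o => rc (c t)) 0 by case: (Uc 1%N) => d _; exact: d.
  split=> //; first by exists U; split=> // k; exact: mCk_rc.
  have := mder_rc (1 : R^o) cd.
  suff -> : 'D_1 (fun t : R^o => rc (c t)) 0 = rc v by rewrite rcK.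
  by rewrite -cv derive1E.
have Uk k : Ck k U (fun t : R^o => rc (c t)) by exact: Ck_rc.
have cd : differentiable (fun t : R^o => rc (c t)) 0 by case: (Uk 1%N) => d _; exact: d.
split=> //; first by exists U.
by rewrite derive1E -(derive_rc cd cv).
Qed.

Lemma curve2P {p q p' q'} (c : R -> 'M[C]_(p, q) * 'M[C]_(p', q')) x v :
  curve rc2 c x v <->
  [/\ c 0 = x,
      exists U : set R^o, [/\ open U, U 0, forall k, mCk (V := R^o) k U (fun t => (c t).1)
        & forall k, mCk (V := R^o) k U (fun t => (c t).2)],
      mder (V := R^o) 0 1 (fun t => (c t).1) v.1
    & mder (V := R^o) 0 1 (fun t => (c t).2) v.2].
Proof.
have pairD (d1 : differentiable (fun t : R^o => rc (c t).1) 0)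
    (d2 : differentiable (fun t : R^o => rc (c t).2) 0) :
    'D_1 (fun t : R^o => rc2 (c t)) 0 =
    ('D_1 (fun t : R^o => rc (c t).1) 0, 'D_1 (fun t : R^o => rc (c t).2) 0).
  rewrite [LHS]deriveE; last exact: differentiable_pair.
  by rewrite diff_pair // !deriveE.
split=> [[c0 [U U0 [Uo Uc]] cv]|[c0 [U [Uo U0 Uc1 Uc2]] cv1 cv2]].
  have k1 k : Ck k U (fun t : R^o => rc (c t).1).
    by apply: (Ck_comp_linear (l := fst) Uo _ (Uc k)) => a; exact: cvg_fst.
  have k2 k : Ck k U (fun t : R^o => rc (c t).2).
    by apply: (Ck_comp_linear (l := snd) Uo _ (Uc k)) => a; exact: cvg_snd.
  have d1 : differentiable (fun t : R^o => rc (c t).1) 0.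
    by case: (k1 1%N) => d _; exact: d.
  have d2 : differentiable (fun t : R^o => rc (c t).2) 0 by case: (k2 1%N) => d _; exact: d.
  have := pairD d1 d2; rewrite -derive1E cv => -[v1 v2].
  split=> //.
  - by exists U; split=> // k; exact: mCk_rc.
  - by have := mder_rc (1 : R^o) d1; rewrite -v1 [X in mder _ _ _ X]rcK.
  - by have := mder_rc (1 : R^o) d2; rewrite -v2 [X in mder _ _ _ X]rcK.
have k1 k : Ck k U (fun t : R^o => rc (c t).1) by exact: Ck_rc.
have k2 k : Ck k U (fun t : R^o => rc (c t).2) by exact: Ck_rc.
have d1 : differentiable (fun t : R^o => rc (c t).1) 0 by case: (k1 1%N) => d _; exact: d.
have d2 : differentiable (fun t : R^o => rc (c t).2) 0 by case: (k2 1%N) => d _; exact: d.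
split=> //; first by exists U => //; split=> // k; exact: Ck_pair.
rewrite derive1E; apply: etrans (pairD d1 d2) _.
by rewrite (derive_rc d1 cv1) (derive_rc d2 cv2).
Qed.

End CurveCoordinates.

(** * Smoothness of the explicit constructions *)

Section SmoothFamilies.
Context {R : realType} {V : normedModType R} {n m : nat}.
Local Notation C := R[i].
Variables (U : set V) (Uo : open U) (k : nat).

Lemma mCk_gmean (A B : V -> 'M[C]_m) :
  (forall x, U x -> pd (A x)) -> (forall x, U x -> pd (B x)) ->
  mCk k U A -> mCk k U B -> mCk k U (fun x => gmean (A x) (B x)).
Proof.
move=> Ap Bp Ak Bk; have Sk := mCk_sqrt Uo Ap Ak.
have Su x : U x -> sqrtmx (A x) \in unitmx by move=> /Ap/pd_sqrt[].
have iSk := mCkV Uo Su Sk.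
apply: mCkM => //; apply: mCkM => //; apply: mCk_sqrt => //.
  by move=> x Ux; apply: pd_mulmm; [exact/pd_sqrt/Ap|exact: Bp].
by apply: mCkM => //; exact: mCkM.
Qed.

Lemma mCk_bal_factor (F : V -> 'M[C]_(n, m)) (H : V -> 'M[C]_(m, n)) :
  (forall x, U x -> (F x)^t* *m F x \in unitmx) ->
  mCk k U F -> mCk k U H -> mCk k U (fun x => bal_factor (F x) (H x)).
Proof.
move=> Fu Fk Hk.
have Gp x : U x -> pd ((F x)^t* *m F x).
  by move=> Ux; split; [exact: psd_adjmul|exact: Fu].
have Gk : mCk k U (fun x => (F x)^t* *m F x) by apply: mCkM => //; exact: mCk_adj.
have iGk := mCkV Uo Fu Gk.
have Bk : mCk k U (fun x => H x *m (H x)^t*) by apply: mCkM => //; exact: mCk_adj.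
apply: mCk_sqrt => //.
  by move=> x Ux; apply: riccati_pd; [exact: Gp|exact: psd_muladj].
apply: mCkD => //; apply: mCk_gmean => //; last exact: mCkD.
move=> x Ux; rewrite addrC; apply: pdD; last exact: psd_muladj.
exact/pd_inv/Gp.
Qed.

Lemma mCk_bal (F : V -> 'M[C]_(n, m)) (H : V -> 'M[C]_(m, n)) :
  (forall x, U x -> (F x)^t* *m F x \in unitmx) ->
  mCk k U F -> mCk k U H ->
  mCk k U (fun x => (bal (F x) (H x)).1) /\ mCk k U (fun x => (bal (F x) (H x)).2).
Proof.
move=> Fu Fk Hk; have gk := mCk_bal_factor Fu Fk Hk.
split; apply: mCkM => //; apply: mCkV => // x Ux.
by have [[]] := bal_factorP (H x) (Fu x Ux).
Qed.

Lemma mCk_orb_level (F : V -> 'M[C]_(n, m)) (W : V -> 'M[C]_(m, n)) :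
  (forall x, U x -> W x *m F x = 1%:M) ->
  mCk k U F -> mCk k U W ->
  mCk k U (fun x => (orb_level (F x) (W x)).1) /\
  mCk k U (fun x => (orb_level (F x) (W x)).2).
Proof.
move=> WF Fk Wk.
have Ap x : U x -> pd ((F x)^t* *m F x) by move=> /WF/pd_WU[].
have Bp x : U x -> pd (W x *m (W x)^t*) by move=> /WF/pd_WU[].
have Fak := mCk_adj Uo Fk; have Wak := mCk_adj Uo Wk.
have gk : mCk k U (fun x => orb_factor (F x) (W x)).
  apply: mCk_sqrt => //; first by move=> x Ux; apply: gmean_pd; [exact: Ap|exact: Bp].
  by apply: mCk_gmean => //; exact: mCkM.
have gu x : U x -> orb_factor (F x) (W x) \in unitmx.
  by move=> Ux; have [] := pd_sqrt (gmean_pd (Ap x Ux) (Bp x Ux)).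
have igk := mCkV Uo gu gk.
split; apply: mCkZc => //.
  by apply: mCkD => //; exact: mCkM.
by apply: mCkB => //; exact: mCkM.
Qed.

Lemma mCk_toOrb (q : V -> @QP R n m) :
  mCk k U (fun x => (q x).1) -> mCk k U (fun x => (q x).2) ->
  mCk k U (fun x => toOrb (q x)).
Proof.
move=> Qk Pk; apply: (mCk_ext Uo (fun x _ => esym (toOrbE (q x)))).
apply: mCkZc => //; apply: mCkM => //; [apply: mCkB|apply: mCkD] => //;
  exact: mCk_adj.
Qed.

Lemma mCk_coord (phi : frame R n m) (q : V -> @QP R n m) :
  (forall x, U x -> fa' phi *m (q x).1 \in unitmx) ->
  mCk k U (fun x => (q x).1) -> mCk k U (fun x => (q x).2) ->
  mCk k U (fun x => (coord phi (q x)).1) /\ mCk k U (fun x => (coord phi (q x)).2).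
Proof.
move=> ku Qk Pk; split.
  apply: mCkM => //; first by apply: mCkM => //; exact: mCk_cst.
  by apply: mCkV => //; apply: mCkM => //; exact: mCk_cst.
apply: mCkM => //; last exact: mCk_cst.
by apply: mCkM => //; [exact: mCk_cst|exact: mCkM].
Qed.

Lemma mCk_parq (phi : frame R n m) (e : V -> @chartspace R n m) :
  mCk k U (fun x => (e x).1) -> mCk k U (fun x => (e x).2) ->
  mCk k U (fun x => (parq phi (e x)).1) /\ mCk k U (fun x => (parq phi (e x)).2).
Proof.
move=> Zk Wk; apply: mCk_bal; first by move=> x _; exact: chart_emb_unit.
  by apply: mCkD => //; [exact: mCk_cst|apply: mCkM => //; exact: mCk_cst].
apply: mCkM => //; apply: mCkB => //; first exact: mCk_cst.
by apply: mCkM => //; exact: mCk_cst.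
Qed.

End SmoothFamilies.

Section Velocities.
Context {R : realType} {n m : nat}.
Local Notation C := R[i].
Implicit Types (q A : @QP R n m) (c : R -> @QP R n m) (phi : frame R n m).

Lemma mder_toOrb c q A : c 0 = q ->
  mder (V := R^o) 0 1 (fun t => (c t).1) A.1 ->
  mder (V := R^o) 0 1 (fun t => (c t).2) A.2 ->
  mder (V := R^o) 0 1 (fun t => toOrb (c t)) (dOrb q A).
Proof.
move=> c0 Q' P'.
have -> : (fun t => toOrb (c t)) = fun t =>
    ('i / 2) *: (((c t).1 - (c t).2^t*) *m ((c t).1^t* + (c t).2)).
  by apply/funext => t; rewrite toOrbE.
have Qa' := mder_adj Q'; have Pa' := mder_adj P'.
by have := mderZ ('i / 2) (mderM (mderB Q' Pa') (mderD Qa' P')); rewrite c0.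
Qed.

Lemma level_curve_tangent c q A : c 0 = q -> (\forall t \near (0 : R), level (c t)) ->
  mder (V := R^o) 0 1 (fun t => (c t).1) A.1 ->
  mder (V := R^o) 0 1 (fun t => (c t).2) A.2 -> level_tangent q A.
Proof.
move=> c0 cl Q' P'; have Qa' := mder_adj Q'; have Pa' := mder_adj P'.
split.
  have e1 := mderM Qa' Q'; rewrite c0 in e1.
  have e2 := mderD (mder_cst (V := R^o) 0 1 (2%:M : 'M[C]_m)) (mderM P' Pa').
  rewrite c0 add0r in e2.
  apply: (mder_uniq e1); apply: mder_near e2.
  by apply: filterS cl => t ct; rewrite (level_QQ ct).
have e1 := mderM P' Q'; rewrite c0 in e1.
apply: (mder_uniq e1); apply: mder_near (mder_cst (V := R^o) 0 1 0).
by apply: filterS cl => t ct; rewrite (level_PQ ct).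
Qed.

Lemma coord_velocity phi c (d : R -> @chartspace R n m) q A u :
  c 0 = q -> fa' phi *m q.1 \in unitmx ->
  (\forall t \near (0 : R), fa' phi *m (c t).1 \in unitmx /\ coord phi (c t) = d t) ->
  mder (V := R^o) 0 1 (fun t => (c t).1) A.1 ->
  mder (V := R^o) 0 1 (fun t => (c t).2) A.2 ->
  mder (V := R^o) 0 1 (fun t => (d t).1) u.1 ->
  mder (V := R^o) 0 1 (fun t => (d t).2) u.2 -> u = dCot phi q A.
Proof.
move=> c0 ku cd Q' P' d1 d2.
have [_ d0] := nbhs_singleton cd; rewrite c0 in d0.
have u1 : u.1 *m (fa' phi *m q.1) + (coord phi q).1 *m (fa' phi *m A.1) = fb' phi *m A.1.
  have := mderM d1 (mderMl (fa' phi) Q'); rewrite c0 -d0 => e1.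
  apply: (mder_uniq e1); apply: mder_near (mderMl (fb' phi) Q').
  by apply: filterS cd => t [kt <-]; rewrite [RHS]mulmxKV.
have u2 : u.2 = fa' phi *m (A.1 *m q.2 + q.1 *m A.2) *m fb phi.
  have := mderMr (fb phi) (mderMl (fa' phi) (mderM Q' P')); rewrite c0 => e2.
  by apply: (mder_uniq d2); apply: mder_near e2; apply: filterS cd => t [_ <-].
rewrite [LHS]surjective_pairing u2 /dCot; congr (_, _).
by rewrite -u1 addrK mulmxK.
Qed.

End Velocities.

Section LevelCurves.
Context {R : realType} {n m : nat}.
Local Notation C := R[i].
Implicit Types (q A : @QP R n m) (c : R -> @QP R n m) (phi : frame R n m).

Lemma cCk_real (U : set R^o) k : open U -> cCk (V := R^o) k U (fun t : R => t%:C).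
Proof.
move=> Uo; split; last exact: Ck_cst.
by apply: (@Ck_linear _ _ _ k U idfun) => t; exact: cvg_id.
Qed.

Lemma mCk_affine (U : set R^o) k p r (A B : 'M[C]_(p, r)) :
  open U -> mCk (V := R^o) k U (fun t : R => A + t%:C *: B).
Proof.
move=> Uo; apply: mCkD => //; first exact: mCk_cst.
by apply: mCkZ => //; [exact: cCk_real|exact: mCk_cst].
Qed.

Lemma cder_real : cder (V := R^o) 0 1 (fun t : R => t%:C) (1 : C).
Proof. by split; [exact: is_derive_id|exact: is_derive_cst]. Qed.

Lemma mder_affine p r (A B : 'M[C]_(p, r)) :
  mder (V := R^o) 0 1 (fun t : R => A + t%:C *: B) B.
Proof.
move=> i j; have -> : (fun t : R => (A + t%:C *: B) i j) =
    (fun t : R => A i j + t%:C * B i j) by apply/funext => t; rewrite !mxE.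
have := cderD (cder_cst (V := R^o) 0 1 (A i j))
  (cderM cder_real (cder_cst (V := R^o) 0 1 (B i j))).
by rewrite mulr0 addr0 mul1r add0r.
Qed.

Lemma mder_square p r (F : R -> 'M[C]_(p, r)) D :
  mder (V := R^o) 0 1 F D ->
  mder (V := R^o) 0 1 (fun t : R => (t%:C * t%:C) *: F t) 0.
Proof.
move=> FD i j; have -> : (fun t : R => ((t%:C * t%:C) *: F t) i j) =
    (fun t : R => t%:C * (t%:C * F t i j)) by apply/funext => t; rewrite mxE mulrA.
have := cderM cder_real (cderM cder_real (FD i j)).
by rewrite !mul0r !mulr0 addr0 mxE.
Qed.

(** Differentiate [M G M = 2 M + B] at [M = 1]. Horizontality gives [G' = B'], and with [G = 2 + S],
    [S = P P^dagger], the rest is [(1 + S) M' + M' (1 + S) = 0]. So [M' = 2 g'] vanishes: balancing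
    does not disturb a horizontal velocity. *)
Lemma bal_factor_velocity (F : R -> 'M[C]_(n, m)) (H : R -> 'M[C]_(m, n)) q A
    (U : set R^o) : open U -> U 0 -> F 0 = q.1 -> H 0 = q.2 -> level q -> hor q A ->
  (forall t, U t -> (F t)^t* *m F t \in unitmx) ->
  (forall k, mCk (V := R^o) k U F) -> (forall k, mCk (V := R^o) k U H) ->
  mder (V := R^o) 0 1 F A.1 -> mder (V := R^o) 0 1 H A.2 ->
  mder (V := R^o) 0 1 (fun t => bal_factor (F t) (H t)) 0.
Proof.
move=> Uo U0 F0 H0 ql [hA _] Fu Fk Hk F' H'.
pose G t := (F t)^t* *m F t; pose B t := H t *m (H t)^t*.
pose M t := bal_factor (F t) (H t) *m bal_factor (F t) (H t).
have gk : mCk (V := R^o) 1 U (fun t => bal_factor (F t) (H t)) by exact: mCk_bal_factor.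
have g0 : bal_factor (F 0) (H 0) = 1%:M by rewrite F0 H0 bal_factor_level.
have [D gD] := mCk1_mder (1 : R^o) gk U0.
have nU : \forall t \near (0 : R^o), U t by exact: open_nbhs_nbhs.
have M' := mderM gD gD; rewrite g0 mulmx1 mul1mx in M'.
have G' := mderM (mder_adj F') F'; have B' := mderM H' (mder_adj H').
rewrite F0 in G'; rewrite H0 in B'.
have hA' : A.1^t* *m q.1 = q.2 *m A.2^t*.
  by have := congr1 (fun X => X^t*) hA; rewrite !adjmxM !trmxCK.
rewrite hA hA' addrC in G'.
have e1 := mderM (mderM M' G') M'.
have e2 := mderD (mderD M' M') B'.
rewrite g0 F0 (level_QQ ql) !mulmx1 !mul1mx in e1.
have e12 : mder (V := R^o) 0 1 (fun t => M t *m G t *m M t)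
    (D + D + (D + D) + (A.2 *m q.2^t* + q.2 *m A.2^t*)).
  apply: mder_near e2; apply: filterS nU => t Ut.
  have Gp : pd (G t) by split; [exact: psd_adjmul|exact: Fu].
  have [_ MM _] := bal_factorP (H t) (Fu t Ut).
  have := riccatiP Gp (psd_muladj (H t)); rewrite /M MM => ->.
  by rewrite mulr2n.
have D0 : D + D = 0.
  have S1 : pd (1%:M + q.2 *m q.2^t*) by apply: pdD; [exact: pd1|exact: psd_muladj].
  apply: (sylvester_inj S1 S1.1).
  have := mder_uniq e1 e12; move: (D + D) (q.2 *m q.2^t*) (_ + q.2 *m A.2^t*) => X S Y.
  rewrite -[2%:M]scalemx1 !(mulmxDl, mulmxDr) -scalemxAl -scalemxAr !mul1mx !mulmx1 => E.
  by apply: (addIr (X + X + Y)); rewrite add0r -[RHS]E; mx_ring.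
suff -> : (0 : 'M[C]_m) = D by [].
move/eqP: D0; rewrite -mulr2n -scaler_nat scaler_eq0 (negPf two_neq0) /=.
by move=> /eqP.
Qed.

(* The line [q + t A] satisfies the constraints to first order; the corrections
   that put it on the level set do not change its velocity. *)
Lemma hor_curve q A : level q -> hor q A ->
  exists c, [/\ c 0 = q,
    exists U : set R^o, [/\ open U, U 0, forall k, mCk (V := R^o) k U (fun t => (c t).1)
      & forall k, mCk (V := R^o) k U (fun t => (c t).2)],
    \forall t \near (0 : R), level (c t),
    mder (V := R^o) 0 1 (fun t => (c t).1) A.1
  & mder (V := R^o) 0 1 (fun t => (c t).2) A.2].
Proof.
move=> ql hA; have [_ PXYQ] := hA.
pose F t := q.1 + (t : R)%:C *: A.1; pose P t := q.2 + (t : R)%:C *: A.2.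
(* The line [P t] satisfies [P t F t = t^2 Y X] for [A = (X, Y)], because the terms of order 0 and 1
   vanish. The correction is [t^2 Y X] times a left inverse of [F t]; hence [H F = 0] exactly, and
   the velocity at 0 is unchanged. *)
pose H t := P t - (t%:C * t%:C) *:
  (A.2 *m A.1 *m (invmx ((F t)^t* *m F t) *m (F t)^t*)).
pose U : set R^o := [set t | setT t /\ (F t)^t* *m F t \in unitmx].
have FTk k : mCk (V := R^o) k setT F by apply: mCk_affine; exact: openT.
have GTk k : mCk (V := R^o) k setT (fun t => (F t)^t* *m F t).
  by apply: mCkM; [exact: openT|apply: mCk_adj => //; exact: openT|].
have Uo : open U by exact: (open_unitmx openT (GTk 0%N)).
have F0 : F 0 = q.1 by rewrite /F scale0r addr0.
have H0 : H 0 = q.2 by rewrite /H /P mulr0 !scale0r subr0 addr0.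
have U0 : U 0 by split=> //; rewrite F0; case: (level_pd ql).
have Fu t : U t -> (F t)^t* *m F t \in unitmx by case.
have Fk k : mCk (V := R^o) k U F by exact: mCk_affine.
have Lk k : mCk (V := R^o) k U (fun t => invmx ((F t)^t* *m F t) *m (F t)^t*).
  have Fak := mCk_adj Uo (Fk k).
  by apply: mCkM => //; apply: mCkV => //; exact: mCkM.
have Yk k : mCk (V := R^o) k U (fun t =>
    A.2 *m A.1 *m (invmx ((F t)^t* *m F t) *m (F t)^t*)).
  by apply: mCkM => //; exact: mCk_cst.
have Hk k : mCk (V := R^o) k U H.
  apply: mCkB => //; first exact: mCk_affine.
  by apply: mCkZ => //; apply: cCkM => //; exact: cCk_real.
have HF t : U t -> H t *m F t = 0.
  move=> Ut; rewrite /H mulmxBl -scalemxAl -[_ *m _ *m F t]mulmxA.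
  rewrite -[invmx _ *m _ *m F t]mulmxA (mulVmx (Fu t Ut)) mulmx1 /P /F.
  rewrite !mulmxDl !mulmxDr (level_PQ ql) add0r -!scalemxAl -!scalemxAr scalerA.
  by rewrite addrA -scalerDr PXYQ scaler0 add0r subrr.
have F' : mder (V := R^o) 0 1 F A.1 by exact: mder_affine.
have H' : mder (V := R^o) 0 1 H A.2.
  have [D YD] := mCk1_mder (1 : R^o) (Yk 1%N) U0.
  have := mderB (mder_affine q.2 A.2) (mder_square YD).
  by rewrite subr0.
have gk k : mCk (V := R^o) k U (fun t => bal_factor (F t) (H t)) by exact: mCk_bal_factor.
have g0 : bal_factor (F 0) (H 0) = 1%:M by rewrite F0 H0 bal_factor_level.
have g' := bal_factor_velocity Uo U0 F0 H0 ql hA Fu Fk Hk F' H'.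
have gu t : U t -> bal_factor (F t) (H t) \in unitmx.
  by move=> Ut; have [[]] := bal_factorP (H t) (Fu t Ut).
have nU : \forall t \near (0 : R^o), U t by exact: open_nbhs_nbhs.
exists (fun t => bal (F t) (H t)); split.
- by rewrite F0 H0 bal_id.
- exists U; split; [exact: Uo|exact: U0| |].
    by move=> k; exact: (mCk_bal Uo Fu (Fk k) (Hk k)).1.
  by move=> k; exact: (mCk_bal Uo Fu (Fk k) (Hk k)).2.
- by apply: filterS nU => t Ut; apply: bal_level; [exact: Fu|exact: HF].
- by have := mderM F' g'; rewrite g0 mulmx1 mulmx0 addr0.
- have [D ig'] := mCk1_mder (1 : R^o) (mCkV Uo gu (gk 1%N)) U0.
  have D0 : D = 0.
    have e := mderM g' ig'; rewrite g0 mul0mx add0r mul1mx in e.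
    apply: (mder_uniq e); apply: mder_near (mder_cst (V := R^o) 0 1 1%:M).
    by apply: filterS nU => t Ut; rewrite mulmxV // gu.
  have := mderM ig' H'; rewrite D0 mul0mx add0r g0 invmx1 mul1mx; exact.
Qed.

End LevelCurves.

(** * Metrics evaluated on horizontal vectors, and horizontal lifts *)

Section Metrics.
Context {R : realType} {n m : nat}.
Local Notation C := R[i].
Implicit Types (q A B : @QP R n m) (c : R -> @QP R n m) (phi : frame R n m).

Lemma gflat_vertical q A (a : 'M[C]_m) : a^t* = - a ->
  gflat (qmx_of A) (qmx_of (- (q.1 *m a), a *m q.2)) =
  complex.Re (\tr (a *m (q.1^t* *m A.1 - A.2 *m q.2^t*))).
Proof.
move=> as_; rewrite gflatE [(_, _).1]/= [(_, _).2]/= adjmxN !adjmxM as_.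
congr complex.Re; rewrite mulNmx opprK !mulmxN (raddfN (@mxtrace C m)) /=.
rewrite mulmxBr (raddfB (@mxtrace C m)) /=; congr (_ - _).
  by rewrite mxtrace_mulC -mulmxA.
by rewrite [RHS]mxtrace_mulC mulmxA.
Qed.

(** Tangency makes [Z = Q^dagger X - Y P^dagger] skew-Hermitian, so [Z] may itself be taken as the
    vertical direction [a]; orthogonality then says that [tr(Z^dagger Z) = 0]. The converse rests on
    [hor_curve]. *)
Lemma horizontalP q A : horizontal q A <-> level q /\ hor q A.
Proof.
split=> [[[c [/curve2P[c0 _ Q' P'] cl]] orth]|[ql hA]].
  have ql : level q by rewrite -c0; exact: nbhs_singleton cl.
  have T := level_curve_tangent c0 cl Q' P'; have [_ T2] := T.
  split=> //; split; last by rewrite addrC.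
  set Z := q.1^t* *m A.1 - A.2 *m q.2^t*.
  have Zs : Z^t* = - Z by exact: level_tangent_skew.
  apply/eqP; rewrite -subr_eq0; apply/eqP; rewrite -/Z.
  apply: trace_adjmul_eq0; have t0 := trace_adjmul_ge0 Z.
  have := orth Z Zs; rewrite gflat_vertical // -/Z.
  have -> : Z *m Z = - (Z^t* *m Z) by rewrite Zs mulNmx opprK.
  rewrite (raddfN (@mxtrace C m)) Re_opp => /eqP; rewrite oppr_eq0 => /eqP tR.
  move: t0; rewrite lecE => /andP[/eqP tI _].
  exact: complex_eq.
have [c [c0 [U [Uo U0 c1 c2]] cl Q' P']] := hor_curve ql hA.
split; first by exists c; split=> //; apply/curve2P; split=> //; exists U.
move=> a as_; rewrite gflat_vertical //.
have [-> _] := hA; by rewrite subrr mulmx0 (raddf0 (@mxtrace C m)).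
Qed.

Lemma push_OrbP q A v : level q -> hor q A -> push_Orb q A v <-> v = dOrb q A.
Proof.
move=> ql hA; split=> [[c [[/curve2P[c0 _ Q' P'] _] /curve1P[_ _ v']]]|->].
  by apply: (mder_uniq v'); exact: mder_toOrb.
have [c [c0 [U [Uo U0 c1 c2]] cl Q' P']] := hor_curve ql hA.
exists c; split; first by split=> //; apply/curve2P; split=> //; exists U.
apply/curve1P; split; first by rewrite /= c0.
  by exists U; split=> // k; exact: mCk_toOrb.
exact: mder_toOrb.
Qed.

Lemma push_CotP q A phi e u : level q -> hor q A ->
  push_Cot q A phi e u <->
  [/\ fa' phi *m q.1 \in unitmx, e = coord phi q & u = dCot phi q A].
Proof.
move=> ql hA; split=> [[c [[/curve2P[c0 _ Q' P'] cl]]]|[ku -> ->]].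
  move=> [d [/curve2P[d0 _ d1 d2] dc]].
  have cd : \forall t \near (0 : R),
      fa' phi *m (c t).1 \in unitmx /\ coord phi (c t) = d t.
    apply: filterS2 cl dc => t ct dt; apply: coord_par; last by rewrite dt.
    by exists (linv (c t)); exact: linvK.
  have [ku de] := nbhs_singleton cd; rewrite c0 in ku de.
  split=> //; first by rewrite de.
  exact: (coord_velocity c0 ku cd Q' P' d1 d2).
have [c [c0 [U [Uo U0 c1 c2]] cl Q' P']] := hor_curve ql hA.
pose U' : set R^o := [set t | U t /\ fa' phi *m (c t).1 \in unitmx].
have kk k : mCk (V := R^o) k U (fun t => fa' phi *m (c t).1).
  by apply: mCkM => //; exact: mCk_cst.
have U'o : open U' by exact: (open_unitmx Uo (kk 0%N)).
have U'0 : U' 0 by split=> //; rewrite c0.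
have U'U : U' `<=` U by move=> t [].
have U'u t : U' t -> fa' phi *m (c t).1 \in unitmx by case.
have dk k := mCk_coord U'o U'u (mCk_sub U'U (c1 k)) (mCk_sub U'U (c2 k)).
have nU' : \forall t \near (0 : R^o), U' t by exact: open_nbhs_nbhs.
have [D1 d1] := mCk1_mder (1 : R^o) (dk 1%N).1 U'0.
have [D2 d2] := mCk1_mder (1 : R^o) (dk 1%N).2 U'0.
have cd : \forall t \near (0 : R), fa' phi *m (c t).1 \in unitmx /\
    coord phi (c t) = coord phi (c t) by apply: filterS nU' => t [].
have uE := @coord_velocity _ _ _ phi c (fun t => coord phi (c t)) q A (D1, D2)
  c0 ku cd Q' P' d1 d2.
exists c; split; first by split=> //; apply/curve2P; split=> //; exists U.
exists (fun t => coord phi (c t)); split.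
  apply/curve2P; split; first by rewrite c0.
  - exists U'; split; [exact: U'o|exact: U'0|by move=> k; exact: (dk k).1|].
    by move=> k; exact: (dk k).2.
  - by rewrite -uE.
  - by rewrite -uE.
apply: filterS2 cl nU' => t ct [_ kt]; apply: par_coord => //.
exact: level_PQ.
Qed.

Lemma qsub0 A B : qsub A B = (0, 0) -> A = B.
Proof.
case: A B => [A1 A2] [B1 B2] [/eqP + /eqP]; rewrite !subr_eq0.
by move=> /eqP -> /eqP ->.
Qed.

Lemma dOrb_inj q A B : level q -> hor q A -> hor q B -> dOrb q A = dOrb q B -> A = B.
Proof.
move=> ql hA hB AB; apply: qsub0; apply: (hor_dOrb_inj ql (hor_sub hA hB)).
by rewrite dOrb_sub AB subrr.
Qed.

Lemma dCot_inj phi q A B : level q -> fa' phi *m q.1 \in unitmx ->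
  hor q A -> hor q B -> dCot phi q A = dCot phi q B -> A = B.
Proof.
move=> ql ku hA hB AB; apply: qsub0; apply: (hor_dCot_inj ql ku (hor_sub hA hB)).
by rewrite dCot_sub AB subrr.
Qed.

(** Any other preimage is [rot q h] with [h] unitary. Its horizontal vectors, rotated back to [q],
    have the same image under [dOrb], hence are [A] and [B] by injectivity; as [gflat] is
    U(m)-invariant, only one value can be chosen. *)
Lemma gOrb_hor q A B : level q -> hor q A -> hor q B ->
  gOrb m (toOrb q) (dOrb q A) (dOrb q B) = gflat (qmx_of A) (qmx_of B).
Proof.
move=> ql hA hB.
apply: (@xget_unique _ 0 [set r | exists q' A' B',
    [/\ toOrb q' = toOrb q, horizontal q' A' /\ push_Orb q' A' (dOrb q A),
        horizontal q' B' /\ push_Orb q' B' (dOrb q B)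
      & r = gflat (qmx_of A') (qmx_of B')]]).
  exists q, A, B; split=> //; split; try (by apply/horizontalP; split);
    exact/push_OrbP.
move=> r [q' [A' [B' [qq' [/horizontalP[q'l hA'] pA] [/horizontalP[_ hB'] pB] ->]]]].
move: pA pB => /(push_OrbP _ q'l hA') pA /(push_OrbP _ q'l hB') pB.
have tq' : toCot q' = toCot q by rewrite -(Phi_toOrb ql) -(Phi_toOrb q'l) qq'.
have [h [hh hh' q'E]] := level_fiber ql q'l tq'.
subst q'; have pA' := etrans pA (dOrb_rot q h A').
have pB' := etrans pB (dOrb_rot q h B').
rewrite (dOrb_inj ql hA (hor_rot hh hA') pA') (dOrb_inj ql hB (hor_rot hh hB') pB').
by rewrite gflat_rot ?trmxCK.
Qed.

Lemma gCot_hor phi q A B : level q -> fa' phi *m q.1 \in unitmx ->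
  hor q A -> hor q B ->
  gCot phi (coord phi q) (dCot phi q A) (dCot phi q B) = gflat (qmx_of A) (qmx_of B).
Proof.
move=> ql ku hA hB.
have qpar : toCot q = par phi (coord phi q) by rewrite par_coord // (level_PQ ql).
apply: (@xget_unique _ 0 [set r | exists q' A' B',
    [/\ toCot q' = par phi (coord phi q),
        horizontal q' A' /\ push_Cot q' A' phi (coord phi q) (dCot phi q A),
        horizontal q' B' /\ push_Cot q' B' phi (coord phi q) (dCot phi q B)
      & r = gflat (qmx_of A') (qmx_of B')]]).
  exists q, A, B; split=> //; split; try (by apply/horizontalP; split);
    exact/push_CotP.
move=> r [q' [A' [B' [qq' [/horizontalP[q'l hA'] pA] [/horizontalP[_ hB'] pB] ->]]]].
move: pA pB => /(push_CotP _ _ _ q'l hA')[_ _ pA] /(push_CotP _ _ _ q'l hB')[_ _ pB].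
have [h [hh hh' q'E]] := level_fiber ql q'l (etrans qq' (esym qpar)).
subst q'; have pA' := etrans pA (dCot_rot hh A' ku).
have pB' := etrans pB (dCot_rot hh B' ku).
rewrite (dCot_inj ql ku hA (hor_rot hh hA') pA') (dCot_inj ql ku hB (hor_rot hh hB') pB').
by rewrite gflat_rot ?trmxCK.
Qed.

(** The curve read in the chart is lifted to the level set by [parq]; injectivity of [Phi_map] shows
    that the lift projects to the given curve in the orbit. The horizontal part of its velocity then
    induces [v] and [u] at once, since vertical vectors are killed on both sides. *)
Lemma differential_lift (xi v : 'M[C]_n) phi e u : Orb m 'i xi ->
  differential (@Phi_map R n) xi v phi e u ->
  [/\ fa' phi *m (parq phi e).1 \in unitmx, coord phi (parq phi e) = e,
      toOrb (parq phi e) = xi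
    & exists A, [/\ hor (parq phi e) A, dOrb (parq phi e) A = v
                  & dCot phi (parq phi e) A = u]].
Proof.
move=> xiO [c [[/curve1P[c0 _ v'] cO] [d [/curve2P[d0 [U [Uo U0 d1k d2k]] d1 d2] dc]]]].
have ql := parq_level phi e.
have gk k := mCk_parq Uo phi (d1k k) (d2k k).
pose g t := parq phi (d t); have g0 : g 0 = parq phi e by rewrite /g d0.
have [D1 g1] := mCk1_mder (1 : R^o) (gk 1%N).1 U0.
have [D2 g2] := mCk1_mder (1 : R^o) (gk 1%N).2 U0.
have gl : \forall t \near (0 : R), level (g t).
  by apply: filterS dc => t _; exact: parq_level.
have gd : \forall t \near (0 : R), fa' phi *m (g t).1 \in unitmx /\ coord phi (g t) = d t.
  apply: filterS dc => t _; apply: coord_par; last exact: parq_toCot.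
  by exists (linv (g t)); apply: linvK; exact: parq_level.
have [ku ce] := nbhs_singleton gd; rewrite g0 d0 in ku ce.
have gc : \forall t \near (0 : R), toOrb (g t) = c t.
  apply: filterS2 cO dc => t ct dt; have gtl := parq_level phi (d t).
  have [_ inj _] := @Phi_bij R n m.
  apply: inj; [by apply/mem_set; exact: level_orb|exact/mem_set|].
  exact: (etrans (Phi_toOrb gtl) (etrans (parq_toCot phi (d t)) dt)).
have xiE : toOrb (parq phi e) = xi.
  by have := nbhs_singleton gc; rewrite g0 c0.
have T := @level_curve_tangent _ _ _ g _ (D1, D2) g0 gl g1 g2.
have [a as_ hA] := hor_qvert ql T.
split; [exact: ku|exact: ce|exact: xiE|].
exists (qvert (parq phi e) a (D1, D2)); split; first exact: hA.
  apply: (etrans (dOrb_qvert _ _ as_)).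
  have e1 := @mder_toOrb _ _ _ g _ (D1, D2) g0 g1 g2.
  exact: (mder_uniq (mder_near gc e1) v').
apply: (etrans (dCot_qvert a (D1, D2) ku)); apply/esym.
exact: (@coord_velocity _ _ _ phi g d _ (D1, D2) u g0 ku gd g1 g2 d1 d2).
Qed.

End Metrics.

(** * The diffeomorphism *)

Section Smoothness.
Context {R : realType} {n m : nat}.
Local Notation C := R[i].

Lemma mCk_cr p r k (U : set (@Defs.realmx R p r)) :
  mCk k U (fun a : @Defs.realmx R p r => cr a).
Proof.
move=> i j; split.
  have -> : (fun a : @Defs.realmx R p r => complex.Re (cr a i j)) = coord_re i j.
    by apply/funext => a; rewrite /coord_re mxE.
  by apply: Ck_linear; exact: coord_re_continuous.
have -> : (fun a : @Defs.realmx R p r => complex.Im (cr a i j)) = coord_im i j.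
  by apply/funext => a; rewrite /coord_im mxE.
by apply: Ck_linear; exact: coord_im_continuous.
Qed.

Lemma mCk_cr2 p r p' r' k :
  mCk k setT (fun a : @realmx2 R p r p' r' => (cr2 a).1) /\
  mCk k setT (fun a : @realmx2 R p r p' r' => (cr2 a).2).
Proof.
have cE p0 r0 (l : @realmx2 R p r p' r' -> @Defs.realmx R p0 r0) :
    Ck k setT l -> mCk k setT (fun a => cr (l a)).
  move=> lk; apply: mCk_rc; first exact: openT.
  by apply: Ck_ext lk => // [|x _]; [exact: openT|rewrite crK].
split; apply: cE.
  by apply: (@Ck_linear _ _ _ k setT fst) => a; exact: cvg_fst.
by apply: (@Ck_linear _ _ _ k setT snd) => a; exact: cvg_snd.
Qed.

Lemma rc2K p r p' r' : cancel (@rc2 R p r p' r') cr2.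
Proof. by case=> a b; rewrite /cr2 /= !rcK. Qed.

Section LocalSection.
Variables (U0 : 'M[C]_(n, m)) (W0 : 'M[C]_(m, n)).

(* Near [xi = i U0 W0] with [W0 U0 = 1], a point [xi' = i p] of the orbit factors
   as [p = U W] with [U = p U0] and [W = (W0 p p U0)^-1 W0 p]; the square [p p] in
   place of [p] makes [W U = 1] hold off the orbit too. *)
Definition loc_p (x : @Defs.realmx R n n) : 'M[C]_n := - 'i *: cr x.
Definition loc_N x : 'M[C]_m := W0 *m loc_p x *m (loc_p x *m U0).
Definition loc_q x : @QP R n m :=
  orb_level (loc_p x *m U0) (invmx (loc_N x) *m (W0 *m loc_p x)).

Lemma loc_qP x : loc_N x \in unitmx ->
  level (loc_q x) /\
  (Orb m 'i (cr x) -> toOrb (loc_q x) = cr x).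
Proof.
move=> Nu.
have WU : invmx (loc_N x) *m (W0 *m loc_p x) *m (loc_p x *m U0) = 1%:M.
  by rewrite -mulmxA; exact: mulVmx.
have [ql qE] := orb_levelP WU; split; first exact: ql.
move=> [Q [P [xE PQ]]]; apply: (etrans qE).
pose P' := - 'i *: P.
have pE : loc_p x = Q *m P' by rewrite /loc_p xE -scalemxAr.
have P'Q : P' *m Q = 1%:M.
  by rewrite -scalemxAl PQ scale_scalar_mx mulNr mulii opprK.
have NE : loc_N x = W0 *m Q *m (P' *m U0).
  by rewrite /loc_N pE !mulmxA -[_ *m P' *m Q]mulmxA P'Q mulmx1.
have xE' : cr x = 'i *: (Q *m P').
  by rewrite xE -scalemxAr scalerA mulrN mulii opprK scale1r.
rewrite xE'; congr (_ *: _).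
have := Nu; rewrite NE unitmx_mul => /andP[WQu PUu].
have NV : invmx (W0 *m Q *m (P' *m U0)) = invmx (P' *m U0) *m invmx (W0 *m Q).
  apply: invmx_uniq; rewrite -!mulmxA [P' *m (U0 *m _)]mulmxA (mulKVmx PUu).
  by rewrite mulmxA mulmxV.
rewrite pE NV !mulmxA.
rewrite -[Q *m P' *m U0]mulmxA -[_ *m invmx (P' *m U0)]mulmxA (mulmxV PUu) mulmx1.
by rewrite -[_ *m W0 *m Q]mulmxA -[_ *m invmx (W0 *m Q) *m _]mulmxA (mulVmx WQu) mulmx1.
Qed.

End LocalSection.

Lemma Phi_smooth : smooth_on_Orb (m := m) (@Phi_map R n).
Proof.
move=> xi /(@Orb_lift R n m)[q ql qxi].
have [phi ku] := frame_ex ql.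
have ED := level_sum_diff (level_QQ ql) (level_PQ ql) (level_QP ql).
(* The base point of the local factorization: [- i xi = U0 W0], and [E D = 2] gives [W0 U0 = 1]. *)
pose U0 := 2^-1 *: (q.1 - q.2^t*); pose W0 := q.1^t* + q.2.
have WU0 : W0 *m U0 = 1%:M by rewrite -scalemxAr ED scale_scalar_mx mulVf ?two_neq0.
have p0 : loc_p (rc xi) = U0 *m W0.
  rewrite /loc_p rcK -qxi toOrbE scalerA mulrA mulNr mulii opprK mul1r.
  by rewrite -scalemxAl.
pose T1 := [set x : @Defs.realmx R n n | setT x /\ loc_N U0 W0 x \in unitmx].
have pk k (T : set (@Defs.realmx R n n)) : open T -> mCk k T (fun x => loc_p x).
  by move=> To; apply: mCkZc => //; exact: mCk_cr.
have Nk k T : open T -> mCk k T (loc_N U0 W0).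
  move=> To; have pkT := pk k T To.
  by apply: mCkM => //; apply: mCkM => //; exact: mCk_cst.
have T1o : open T1 by exact: (open_unitmx openT (Nk 0%N setT openT)).
have N0 : loc_N U0 W0 (rc xi) = 1%:M.
  by rewrite /loc_N p0 -!mulmxA WU0 mulmx1 !mulmxA WU0 mul1mx WU0.
have T10 : T1 (rc xi) by split=> //; rewrite N0 unitmx1.
have T1u x : T1 x -> loc_N U0 W0 x \in unitmx by case.
have qk k : mCk k T1 (fun x => (loc_q U0 W0 x).1) /\
            mCk k T1 (fun x => (loc_q U0 W0 x).2).
  have pkT := pk k T1 T1o; have NkT := Nk k T1 T1o.
  apply: mCk_orb_level.
  - exact: T1o.
  - by move=> x Tx; rewrite -mulmxA; exact: (mulVmx (T1u x Tx)).
  - by apply: mCkM => //; exact: mCk_cst.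
  - by apply: mCkM => //; [exact: mCkV|apply: mCkM => //; exact: mCk_cst].
pose T2 := [set x : @Defs.realmx R n n | T1 x /\ fa' phi *m (loc_q U0 W0 x).1 \in unitmx].
have T2o : open T2.
  apply: (open_unitmx T1o); apply: mCkM => //; first exact: mCk_cst.
  exact: (qk 0%N).1.
have T2T1 : T2 `<=` T1 by move=> x [].
have T2u x : T2 x -> fa' phi *m (loc_q U0 W0 x).1 \in unitmx by case.
have ck k := mCk_coord T2o T2u (mCk_sub T2T1 (qk k).1) (mCk_sub T2T1 (qk k).2).
have PhiE xi' : Orb m 'i xi' -> T1 (rc xi') ->
    level (loc_q U0 W0 (rc xi')) /\ Phi_map xi' = toCot (loc_q U0 W0 (rc xi')).
  move=> xiO /T1u xT; have [lx tx] := loc_qP xT; split; first exact: lx.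
  by rewrite -(Phi_toOrb lx) tx rcK.
exists phi, T2, (fun x => rc2 (coord phi (loc_q U0 W0 x))); split.
- split; first exact: T10.
  have xiO : Orb m 'i xi by rewrite -qxi; exact: level_orb.
  have [lx Ex] := PhiE xi xiO T10.
  (* At the base point [loc_q] and [q] have the same image under [toCot], and the invertibility of
     [fa' Q] depends only on that image. *)
  apply: (@coord_par _ _ _ phi (loc_q U0 W0 (rc xi)) (coord phi q) _ _).1.
    by exists (linv (loc_q U0 W0 (rc xi))); exact: linvK.
  by rewrite -Ex -qxi (Phi_toOrb ql) par_coord // (level_PQ ql).
- split; first exact: T2o.
  move=> k; apply: Ck_pair; first exact: T2o.
    by apply: (Ck_rc T2o); exact: (ck k).1.
  by apply: (Ck_rc T2o); exact: (ck k).2.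
- move=> xi' xiO xT; have [lx Ex] := PhiE xi' xiO (T2T1 _ xT).
  rewrite rc2K; apply: (etrans Ex); apply/esym.
  exact: (par_coord (level_PQ lx) (T2u _ xT)).
Qed.

Definition Psi_map (x : @cotpoint R n) : 'M[C]_n :=
  xget 0 [set xi | Orb m 'i xi /\ Phi_map xi = x].

Lemma Phi_mapK (xi : 'M[C]_n) : Orb m 'i xi -> Psi_map (Phi_map xi) = xi.
Proof.
move=> xiO.
apply: (@xget_unique _ 0 [set xi' | Orb m 'i xi' /\ Phi_map xi' = Phi_map xi]).
  by split.
move=> xi' [xiO' xiE]; have [_ inj _] := @Phi_bij R n m.
exact: (inj xi' xi (mem_set xiO') (mem_set xiO) xiE).
Qed.

(** On each chart the inverse, defined by choice, coincides with [toOrb] after the smooth section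
    [parq]. *)
Lemma Psi_smooth : smooth_on_Cot (m := m) Psi_map.
Proof.
move=> phi; split; first exact: openT.
move=> k; have [k1 k2] := @mCk_cr2 (n - m) m m (n - m) k.
have [g1 g2] := mCk_parq openT phi k1 k2.
apply: Ck_ext (Ck_rc openT (mCk_toOrb openT g1 g2)); first exact: openT.
move=> e _; have ql := parq_level phi (cr2 e).
by rewrite -(parq_toCot phi (cr2 e)) -(Phi_toOrb ql) (Phi_mapK (level_orb ql)).
Qed.

Lemma Phi_diffeo : diffeo m (@Phi_map R n).
Proof.
split; first exact: Phi_bij.
split; first exact: Phi_smooth.
by exists Psi_map; split; [exact: Phi_mapK|exact: Psi_smooth].
Qed.

Lemma Phi_equivariant (h xi : 'M[C]_n) : h \is unitarymx -> Orb m 'i xi ->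
  Phi_map (h *m xi *m invmx h) = act h (Phi_map xi).
Proof.
move=> hu /(@Orb_lift R n m)[q ql <-].
have hV := invmx_unitary hu.
have hh : h^t* *m h = 1%:M by rewrite -hV mulVmx // unitarymx_unit.
(* U(n) acts on pairs by [(h Q, P h^dagger)]; this preserves the level equations and makes both
   quotient maps equivariant. *)
pose hq : @QP R n m := (h *m q.1, q.2 *m h^t*).
have hql : level hq.
  apply/levelP; rewrite /hq [(_, _).1]/= [(_, _).2]/= !adjmxM trmxCK.
  rewrite !mulmxA -[q.1^t* *m h^t* *m h]mulmxA -[q.2 *m h^t* *m h]mulmxA hh !mulmx1.
  by split; [exact: level_QQ|exact: level_PQ].
have hqE : h *m toOrb q *m invmx h = toOrb hq.
  rewrite !toOrbE hV /hq [(h *m _, _).1]/= [(h *m _, _).2]/= !adjmxM trmxCK.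
  by rewrite -mulmxBr -mulmxDl -scalemxAr -scalemxAl !mulmxA.
rewrite hqE (Phi_toOrb hql) (Phi_toOrb ql) /act /toCot hV.
rewrite /hq [(h *m _, _).1]/= [(h *m _, _).2]/=; congr (_, _); last by rewrite !mulmxA.
apply/vspaceP => y; apply/idP/idP.
  move=> /mem_mximg[x ->]; apply/memv_imgP; exists (q.1 *m x).
    by apply/mem_mximg; exists x.
  by rewrite lfunE /= mulmxA.
move=> /memv_imgP[z /mem_mximg[x ->] ->].
by apply/mem_mximg; exists x; rewrite lfunE /= mulmxA.
Qed.

Lemma Phi_forms (xi v w : 'M[C]_n) (phi : frame R n m) (e u1 u2 : @chartspace R n m) :
  Orb m 'i xi ->
  differential (@Phi_map R n) xi v phi e u1 ->
  differential (@Phi_map R n) xi w phi e u2 ->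
  [/\ gCot phi e u1 u2 = gOrb m xi v w,
      complex.Re (OmegaCan phi e u1 u2) = complex.Im (OmegaKKS xi v w),
      complex.Im (OmegaCan phi e u1 u2) = omegaK m xi v w
    & omegaC phi e u1 u2 = complex.Re (OmegaKKS xi v w)].
Proof.
move=> xiO /(differential_lift xiO)[ku ce xiE [A [hA vA uA]]].
move=> /(differential_lift xiO)[_ _ _ [B [hB wB uB]]].
have ql := parq_level phi e.
move: (parq phi e) ql ku ce xiE hA vA uA hB wB uB => q ql ku ce xiE hA vA uA hB wB uB.
subst e xi v w u1 u2.
have [reK imK] := OmegaKKS_parts ql hA hB.
have can := OmegaCan_hor ql ku hA hB.
split.
- exact: (etrans (gCot_hor ql ku hA hB) (esym (gOrb_hor ql hA hB))).
- exact: (etrans (congr1 _ can) (esym imK)).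
(* The vector [i v] lifts to [rotK A], which is again horizontal, so [omegaK] is
   [g(K A, B) = omega_3]. The next item uses [rotI] in the same way to obtain [omega_1]. *)
- rewrite can -gflat_rotK /omegaK -dOrb_rotK.
  exact: (esym (gOrb_hor ql (hor_rotK hA) hB)).
- rewrite /omegaC -dCot_rotI.
  exact: (etrans (gCot_hor ql ku (hor_rotI hA) hB) (esym reK)).
Qed.

Lemma mem_Phi (xi : 'M[C]_n) (y : 'cV[C]_n) :
  y \in (Phi_map xi).1 <->
  exists2 x : 'cV[C]_n, x \in mximg xi & y = x + sqrtmx (xi^t* *m xi) *m x.
Proof.
rewrite /Phi_map [(_, _).1]/=; split.
  move=> /mem_mximg[x ->]; exists (xi *m x); first by apply/mem_mximg; exists x.
  by rewrite mulmxDl mulmxA.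
move=> [x /mem_mximg[z ->] ->]; apply/mem_mximg; exists z.
by rewrite mulmxDl mulmxA.
Qed.

End Smoothness.

Unset Implicit Arguments.

Theorem theorem4p6 (R : realType) (n m : nat) (m_gt0 : (1 <= m)%N)
    (le_mn : (m <= n)%N) :
  exists Phi : 'M[R[i]]_n -> @cotpoint R n,
  [/\ diffeo m Phi,
      (forall h xi : 'M[R[i]]_n, h \is unitarymx -> Orb m 'i xi ->
        Phi (h *m xi *m invmx h) = act h (Phi xi)),
      (forall (xi v w : 'M[R[i]]_n) (phi : frame R n m) (e u1 u2 : chartspace),
        Orb m 'i xi ->
        differential Phi xi v phi e u1 ->
        differential Phi xi w phi e u2 ->
        [/\ gCot phi e u1 u2 = gOrb m xi v w,
            complex.Re (OmegaCan phi e u1 u2) = complex.Im (OmegaKKS xi v w),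
            complex.Im (OmegaCan phi e u1 u2) = omegaK m xi v w
          & omegaC phi e u1 u2 = complex.Re (OmegaKKS xi v w)])
    & (forall xi : 'M[R[i]]_n, Orb m 'i xi ->
        (forall y : 'cV[R[i]]_n, y \in (Phi xi).1 <->
          exists2 x : 'cV[R[i]]_n, x \in mximg xi
            & y = x + sqrtmx (xi^t* *m xi) *m x) /\
        (Phi xi).2 = 2^-1 *: (sqrtmx (xi^t* *m xi) - sqrtmx (xi *m xi^t*)
                              - 'i *: xi - 'i *: xi^t*))].
Proof.
exists (@Phi_map R n); split.
- exact: Phi_diffeo.
- by move=> h xi hu xiO; exact: (Phi_equivariant hu xiO).
- exact: Phi_forms.
- by move=> xi _; split; [move=> y; exact: mem_Phi|].
Qed.
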